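(* Let $k$ be a field with algebraic closure $\overline{k}$. Let $R$ be a finite scheme over $k$ and let $R'=R\times_{\operatorname{Spec} k}\operatorname{Spec}\overline{k}$, a finite scheme over $\overline{k}$. Then $R$ is smoothable (over $k$) if and only if $R'$ is smoothable (over $\overline{k}$).
   Context: For a field $F$, all schemes over $F$ are separated and locally Noetherian. A finite scheme $R$ over $F$ is smoothable over $F$ if there exist an irreducible $F$-scheme $T$ and a morphism of $F$-schemes $Z\to T$ such that (1) $Z\to T$ is flat and finite; (2) $T$ has an $F$-rational point $t$ whose fibre satisfies $Z_t\simeq R$; (3) $Z_\eta$ is smooth over $\eta$, where $\eta$ is the generic point of $T$. *)

(* Defs.v *)
From HB Require Import structures.
From mathcomp Require Import all_boot all_order all_algebra.
From mathcomp Require Import(canonicals, coercions) mpoly.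
From mathcomp Require Import boolp classical_sets functions topology.
From mathcomp Require Import ring.

Set Implicit Arguments.
Unset Strict Implicit.
Unset Printing Implicit Defensive.

Import GRing.Theory.
Local Open Scope quotient_scope.
Local Open Scope classical_set_scope.
Local Open Scope ring_scope.

(* Rings of sections over the empty set, and the coordinate ring of an empty
   finite scheme, are zero: rings are [comPzRingType], and [comNzRingType]
   only where the ring cannot be zero. *)

Definition invertible (A : comPzRingType) (a : A) : Prop :=
  exists b, a * b = 1.

Definition is_local_ring (A : comNzRingType) : Prop :=
  forall a b : A, invertible (a + b) -> invertible a \/ invertible b.

Definition is_local_hom (A B : comPzRingType) (phi : A -> B) : Prop :=
  forall a : A, invertible (phi a) -> invertible a.

Definition is_ideal (A : comPzRingType) (I : set A) : Prop :=
  [/\ I 0, forall a b, I a -> I b -> I (a + b) & forall a b, I b -> I (a * b)].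

Definition is_prime_ideal (A : comPzRingType) (I : set A) : Prop :=
  [/\ is_ideal I, ~ I 1 & forall a b, I (a * b) -> I a \/ I b].

Definition ideal_span (A : comPzRingType) n (r : 'I_n -> A) : set A :=
  [set a | exists c : 'I_n -> A, a = \sum_i c i * r i].

Definition is_noetherian_ring (A : comPzRingType) : Prop :=
  forall I : set A, is_ideal I -> exists n (r : 'I_n -> A), I = ideal_span r.

Definition fg_module (A : comPzRingType) (M : lmodType A) : Prop :=
  exists n (e : 'I_n -> M), forall m, exists c : 'I_n -> A,
    m = \sum_i c i *: e i.

Definition is_bilinear (A : comPzRingType) (M N P : lmodType A)
    (b : M -> N -> P) : Prop :=
  (forall m, linear (b m)) /\ (forall n, linear (b^~ n)).

Definition is_tensor_product (A : comPzRingType) (M N P : lmodType A)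
    (b : M -> N -> P) : Prop :=
  is_bilinear b /\
  forall (Q : lmodType A) (c : M -> N -> Q), is_bilinear c ->
    exists! h : P -> Q, linear h /\ forall m n, h (b m n) = c m n.

(* [h] is the map [M (x) g] between the tensor products [P] and [P']. *)
Definition flat_module (A : comPzRingType) (M : lmodType A) : Prop :=
  forall (N N' : lmodType A) (g : {linear N -> N'}), injective g ->
  forall (P P' : lmodType A) (b : M -> N -> P) (b' : M -> N' -> P'),
    is_tensor_product b -> is_tensor_product b' ->
  forall h : {linear P -> P'}, (forall m n, h (b m n) = b' m (g n)) ->
    injective h.

Definition restr_scal (A B : comPzRingType) (phi : {rmorphism A -> B}) : Type :=
  B.

Section RestrScal.
Variables (A B : comPzRingType) (phi : {rmorphism A -> B}).

HB.instance Definition _ := GRing.Zmodule.on (restr_scal phi).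

Definition restr_scale (a : A) (x : restr_scal phi) : restr_scal phi :=
  phi a * (x : B).

Lemma restr_scaleA a b x :
  restr_scale a (restr_scale b x) = restr_scale (a * b) x.
Proof. by rewrite /restr_scale rmorphM mulrA. Qed.

Lemma restr_scale1 : left_id 1 restr_scale.
Proof. by move=> x; rewrite /restr_scale rmorph1 mul1r. Qed.

Lemma restr_scaleDr : right_distributive restr_scale +%R.
Proof. by move=> a x y; rewrite /restr_scale mulrDr. Qed.

Lemma restr_scaleDl x : {morph restr_scale^~ x : a b / a + b}.
Proof. by move=> a b; rewrite /restr_scale rmorphD mulrDl. Qed.

HB.instance Definition _ := GRing.Zmodule_isLmodule.Build A (restr_scal phi)
  restr_scaleA restr_scale1 restr_scaleDr restr_scaleDl.

End RestrScal.

Definition module_finite_hom (A B : comPzRingType) (phi : {rmorphism A -> B}) :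
  Prop := fg_module (restr_scal phi).

Definition flat_hom (A B : comPzRingType) (phi : {rmorphism A -> B}) : Prop :=
  flat_module (restr_scal phi).

(* [B] is the quotient of [A[X_1, ..., X_n]] by an ideal with finitely many
   generators. *)
Definition finitely_presented_hom (A B : comNzRingType)
    (phi : {rmorphism A -> B}) : Prop :=
  exists n (x : 'I_n -> B) m (r : 'I_m -> mpoly.mpoly n A),
    (forall y, exists f, mpoly.mmap phi x f = y) /\
    [set f | mpoly.mmap phi x f = 0] = ideal_span r.

Record prime_ideal (A : comPzRingType) := PrimeIdeal {
  prime_ideal_set :> A -> Prop;
  prime_idealP : is_prime_ideal prime_ideal_set }.

Section Localization.
Variables (A : comPzRingType) (p : prime_ideal A).

Lemma prime_not1 : ~ p 1. Proof. by have [] := prime_idealP p. Qed.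

Lemma prime_notM a b : ~ p a -> ~ p b -> ~ p (a * b).
Proof. by move=> pa pb; have [_ _ pM] := prime_idealP p => /pM []. Qed.

Record fraction := Fraction {
  numer : A; denom : A; denomP : ~ p denom }.

Arguments denomP : clear implicits.

HB.instance Definition _ := gen_eqMixin fraction.
HB.instance Definition _ := gen_choiceMixin fraction.

Definition fraction_equiv (x y : fraction) : bool :=
  `[< exists2 u, ~ p u & u * (numer x * denom y) = u * (numer y * denom x) >].

Lemma fraction_equiv_class : equiv_class_of fraction_equiv.
Proof.
split=> [x|x y|y x z].
- by apply/asboolP; exists 1 => //; exact: prime_not1.
- by apply/asboolP/asboolP => -[u pu e]; exists u.
move=> /asboolP[u pu e] /asboolP[v pv e']; apply/asboolP.
exists (u * v * denom y).
  by do 2?[apply: prime_notM => //]; exact: denomP.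
transitivity (v * denom z * (u * (numer x * denom y))); first by ring.
rewrite e.
transitivity (u * denom x * (v * (numer y * denom z))); first by ring.
by rewrite e'; ring.
Qed.

Canonical fraction_equiv_rel := EquivRelPack fraction_equiv_class.
Canonical fraction_enc := defaultEncModRel fraction_equiv.

Definition localization := {eq_quot fraction_equiv}.

HB.instance Definition _ : EqQuotient fraction fraction_equiv localization :=
  EqQuotient.on localization.
HB.instance Definition _ := Choice.on localization.

Definition frac (a b : A) (pb : ~ p b) : localization :=
  \pi_localization (Fraction a pb).

Lemma fracP a b (pb : ~ p b) c d (pd : ~ p d) :
  frac a pb = frac c pd <-> exists2 u, ~ p u & u * (a * d) = u * (c * b).
Proof.
rewrite /frac; split=> [/eqmodP/asboolP //|h].
by apply/eqmodP/asboolP.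
Qed.

Lemma frac_surj x : exists a b (pb : ~ p b), x = frac a pb.
Proof.
by exists (numer (repr x)), (denom (repr x)), (denomP (repr x));
  rewrite /frac -[LHS]reprK; case: (repr x).
Qed.

Definition loc_num (x : localization) := numer (repr x).
Definition loc_den (x : localization) := denom (repr x).
Definition loc_denP (x : localization) : ~ p (loc_den x) := denomP (repr x).
Arguments loc_denP : clear implicits.

Lemma loc_fracK x : frac (loc_num x) (loc_denP x) = x.
Proof.
by rewrite /frac /loc_num /loc_den /loc_denP -[RHS]reprK; case: (repr x).
Qed.

Definition loc_add x y := frac (loc_num x * loc_den y + loc_num y * loc_den x)
  (prime_notM (loc_denP x) (loc_denP y)).
Definition loc_mul x y :=
  frac (loc_num x * loc_num y) (prime_notM (loc_denP x) (loc_denP y)).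
Definition loc_opp x := frac (- loc_num x) (loc_denP x).
Definition loc_zero := frac 0 prime_not1.
Definition loc_one := frac 1 prime_not1.

Lemma loc_addE a b (pb : ~ p b) c d (pd : ~ p d) :
  loc_add (frac a pb) (frac c pd) = frac (a * d + c * b) (prime_notM pb pd).
Proof.
have /fracP[u pu e] := loc_fracK (frac a pb).
have /fracP[v pv e'] := loc_fracK (frac c pd).
apply/fracP; exists (u * v); first exact: prime_notM.
set x := frac a pb in e *; set y := frac c pd in e' *.
transitivity (v * d * loc_den y * (u * (loc_num x * b))
   + u * b * loc_den x * (v * (loc_num y * d))); first by ring.
by rewrite e e'; ring.
Qed.

Lemma loc_mulE a b (pb : ~ p b) c d (pd : ~ p d) :
  loc_mul (frac a pb) (frac c pd) = frac (a * c) (prime_notM pb pd).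
Proof.
have /fracP[u pu e] := loc_fracK (frac a pb).
have /fracP[v pv e'] := loc_fracK (frac c pd).
apply/fracP; exists (u * v); first exact: prime_notM.
set x := frac a pb in e *; set y := frac c pd in e' *.
transitivity ((u * (loc_num x * b)) * (v * (loc_num y * d))); first by ring.
by rewrite e e'; ring.
Qed.

Lemma loc_oppE a b (pb : ~ p b) : loc_opp (frac a pb) = frac (- a) pb.
Proof.
have /fracP[u pu e] := loc_fracK (frac a pb).
apply/fracP; exists u => //.
by rewrite !mulNr !mulrN e.
Qed.

Lemma frac_eq a b (pb : ~ p b) c d (pd : ~ p d) :
  a * d = c * b -> frac a pb = frac c pd.
Proof. by move=> e; apply/fracP; exists 1; [exact: prime_not1|rewrite e]. Qed.

Lemma loc_addA : associative loc_add.
Proof.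
move=> x y z; have [a [b [pb ->]]] := frac_surj x.
have [c [d [pd ->]]] := frac_surj y; have [e [f [pf ->]]] := frac_surj z.
by rewrite !loc_addE; apply: frac_eq; ring.
Qed.

Lemma loc_addC : commutative loc_add.
Proof.
move=> x y; have [a [b [pb ->]]] := frac_surj x.
have [c [d [pd ->]]] := frac_surj y.
by rewrite !loc_addE; apply: frac_eq; ring.
Qed.

Lemma loc_add0 : left_id loc_zero loc_add.
Proof.
move=> x; have [a [b [pb ->]]] := frac_surj x.
by rewrite /loc_zero loc_addE; apply: frac_eq; ring.
Qed.

Lemma loc_addN : left_inverse loc_zero loc_opp loc_add.
Proof.
move=> x; have [a [b [pb ->]]] := frac_surj x.
by rewrite /loc_zero loc_oppE loc_addE; apply: frac_eq; ring.
Qed.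

HB.instance Definition _ :=
  GRing.isZmodule.Build localization loc_addA loc_addC loc_add0 loc_addN.

Lemma loc_mulA : associative loc_mul.
Proof.
move=> x y z; have [a [b [pb ->]]] := frac_surj x.
have [c [d [pd ->]]] := frac_surj y; have [e [f [pf ->]]] := frac_surj z.
by rewrite !loc_mulE; apply: frac_eq; ring.
Qed.

Lemma loc_mulC : commutative loc_mul.
Proof.
move=> x y; have [a [b [pb ->]]] := frac_surj x.
have [c [d [pd ->]]] := frac_surj y.
by rewrite !loc_mulE; apply: frac_eq; ring.
Qed.

Lemma loc_mul1 : left_id loc_one loc_mul.
Proof.
move=> x; have [a [b [pb ->]]] := frac_surj x.
by rewrite /loc_one loc_mulE; apply: frac_eq; ring.
Qed.

Lemma loc_mulDl : left_distributive loc_mul loc_add.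
Proof.
move=> x y z; have [a [b [pb ->]]] := frac_surj x.
have [c [d [pd ->]]] := frac_surj y; have [e [f [pf ->]]] := frac_surj z.
by rewrite !(loc_addE, loc_mulE); apply: frac_eq; ring.
Qed.

Lemma loc_one_neq0 : loc_one != loc_zero.
Proof.
apply/eqP => /fracP[u pu]; rewrite !mulr1 mulr0 => u0.
by apply: pu; rewrite u0; have [[]] := prime_idealP p.
Qed.

HB.instance Definition _ := GRing.Zmodule_isComNzRing.Build localization
  loc_mulA loc_mulC loc_mul1 loc_mulDl loc_one_neq0.

Lemma frac0 : frac 0 prime_not1 = 0. Proof. by []. Qed.
Lemma frac1 : frac 1 prime_not1 = 1. Proof. by []. Qed.

Lemma fracD a b (pb : ~ p b) c d (pd : ~ p d) :
  frac a pb + frac c pd = frac (a * d + c * b) (prime_notM pb pd).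
Proof. exact: loc_addE. Qed.

Lemma fracM a b (pb : ~ p b) c d (pd : ~ p d) :
  frac a pb * frac c pd = frac (a * c) (prime_notM pb pd).
Proof. exact: loc_mulE. Qed.

Lemma fracN a b (pb : ~ p b) : - frac a pb = frac (- a) pb.
Proof. exact: loc_oppE. Qed.

Lemma frac_invertible a b (pb : ~ p b) : invertible (frac a pb) <-> ~ p a.
Proof.
have [[p0 pD pM] p1 pP] := prime_idealP p.
split=> [[x]|pa]; last first.
  exists (frac b pa); rewrite fracM -frac1; apply: frac_eq; ring.
have [c [d [pd ->]]] := frac_surj x; rewrite fracM -frac1.
move=> /fracP[u pu]; rewrite mulr1 mul1r => e pa.
have : p (u * (b * d)) by rewrite -e mulrA mulrAC; apply: pM.
by apply: prime_notM => //; apply: prime_notM.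
Qed.

Lemma localization_local : is_local_ring localization.
Proof.
move=> x y; have [a [b [pb ->]]] := frac_surj x.
have [c [d [pd ->]]] := frac_surj y; rewrite fracD !frac_invertible => h.
have [[p0 pD pM] p1 pP] := prime_idealP p.
apply: contrapT => /not_orP[/contrapT pa /contrapT pc]; apply: h.
by apply: pD; rewrite mulrC; apply: pM.
Qed.

End Localization.

Arguments denomP {A p} f.
Arguments frac {A p} a {b} pb.

(* A sheaf of rings is given as the sheaf of sections of its espace etale: the
   stalks, and for each open set [U] the families of germs that are sections
   over [U]. A family is indexed by all points, but only its values on [U]
   matter ([section_ext]). The last five axioms say that sections over [U]
   form a ring and that the stalk at [x] is the colimit of the sections over
   the neighbourhoods of [x]. *)
Record locally_ringed_space := LocallyRingedSpace {
  space :> topologicalType;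
  stalk : space -> comNzRingType;
  is_section : set space -> (forall x, stalk x) -> Prop;
  stalk_local : forall x, is_local_ring (stalk x);
  section_ext : forall U s t, open U -> (forall x, U x -> s x = t x) ->
    is_section U s -> is_section U t;
  section_restrict : forall U V s, open U -> open V -> V `<=` U ->
    is_section U s -> is_section V s;
  section_glue : forall U s, open U ->
    (forall x, U x -> exists V, [/\ open V, V x, V `<=` U & is_section V s]) ->
    is_section U s;
  section1 : forall U, open U -> is_section U (fun x => 1);
  sectionB : forall U s t, open U -> is_section U s -> is_section U t ->
    is_section U (fun x => s x - t x);
  sectionM : forall U s t, open U -> is_section U s -> is_section U t ->
    is_section U (fun x => s x * t x);
  germ_surj : forall x (a : stalk x), exists U s,
    [/\ open U, U x, is_section U s & s x = a];
  germ_eq0 : forall U s x, open U -> U x -> is_section U s -> s x = 0 ->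
    exists V, [/\ open V, V x, V `<=` U & forall y, V y -> s y = 0] }.

(* The comorphism of sheaves is given by its maps on stalks. *)
Record morphism (X Y : locally_ringed_space) := Morphism {
  mfun :> X -> Y;
  stalk_map : forall x, {rmorphism stalk (mfun x) -> stalk x};
  mfun_continuous : continuous mfun;
  stalk_map_local : forall x, is_local_hom (stalk_map x);
  section_pullback : forall U s, open U -> is_section U s ->
    is_section (mfun @^-1` U) (fun x => stalk_map x (s (mfun x))) }.

Definition id_morphism (X : locally_ringed_space) : morphism X X.
Proof.
exists (fun x : X => x) (fun x => idfun : {rmorphism stalk x -> stalk x}).
- by move=> x.
- by move=> x a.
- by move=> U s Uo.
Defined.

Definition comp_morphism (X Y Z : locally_ringed_space) (g : morphism Y Z)
  (f : morphism X Y) : morphism X Z.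
Proof.
exists (fun x => g (f x))
  (fun x => stalk_map f x \o stalk_map g (f x) :
     {rmorphism stalk (g (f x)) -> stalk x}).
- by move=> x; apply: continuous_comp; apply: mfun_continuous.
- by move=> x a /= /stalk_map_local /stalk_map_local.
- move=> U s Uo sU.
  have Vo : open (g @^-1` U).
    by have /continuousP := @mfun_continuous _ _ g; apply.
  exact: (@section_pullback _ _ f _ (fun y => stalk_map g y (s (g y))) Vo
    (section_pullback g Uo sU)).
Defined.

Definition open_immersion (X Y : locally_ringed_space) (j : morphism X Y) :
  Prop :=
  [/\ injective j, forall U : set X, open U -> open (j @` U)
    & forall x, bijective (stalk_map j x)].

Definition closed_immersion (X Y : locally_ringed_space) (j : morphism X Y) :
  Prop :=
  [/\ injective j, forall C : set X, closed C -> closed (j @` C)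
    & forall x (a : stalk x), exists b, stalk_map j x b = a].

Section Spec.
Variable A : comPzRingType.

HB.instance Definition _ := gen_eqMixin (prime_ideal A).
HB.instance Definition _ := gen_choiceMixin (prime_ideal A).

Definition zariski_closed_set (E : set A) : set (prime_ideal A) :=
  [set p | E `<=` p].

Definition zariski_open (U : set (prime_ideal A)) : Prop :=
  exists E : set A, U = ~` zariski_closed_set E.

Lemma zariski_openP (U : set (prime_ideal A)) : zariski_open U <->
  forall p, U p -> exists2 a, ~ p a &
    forall q : prime_ideal A, ~ q a -> U q.
Proof.
split=> [[E ->] p /existsNP[a /not_implyP[Ea pa]]|h].
  by exists a => // q qa /(_ a Ea).
exists [set a | forall q : prime_ideal A, ~ q a -> U q].
rewrite predeqE => p; split=> [/h[a pa aU] /(_ a aU) //|].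
by move=> /existsNP[a /not_implyP[aU pa]]; apply: aU.
Qed.

Lemma zariski_openT : zariski_open setT.
Proof.
by apply/zariski_openP => p _; exists 1 => //; exact: prime_not1.
Qed.

Lemma zariski_openI : setI_closed zariski_open.
Proof.
move=> U V /zariski_openP hU /zariski_openP hV; apply/zariski_openP => p [].
move=> /hU[a pa aU] /hV[b pb bV]; exists (a * b); first exact: prime_notM.
move=> q qab; have [[_ _ qM] _ _] := prime_idealP q; split.
  by apply: aU => qa; apply: qab; rewrite mulrC; apply: qM.
by apply: bV => qb; apply: qab; apply: qM.
Qed.

Lemma zariski_open_bigcup (I : Type) (f : I -> set (prime_ideal A)) :
  (forall i, zariski_open (f i)) -> zariski_open (\bigcup_i f i).
Proof.
move=> h; apply/zariski_openP => p [i _ fp].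
have /zariski_openP/(_ p fp)[a pa af] := h i.
by exists a => // q /af; exists i.
Qed.

HB.instance Definition _ :=
  isOpenTopological.Build (prime_ideal A) zariski_openT zariski_openI
    zariski_open_bigcup.

Definition spec_section (U : set (prime_ideal A))
    (s : forall p : prime_ideal A, localization p) : Prop :=
  forall p, U p -> exists (V : set (prime_ideal A)) (a b : A),
    [/\ open V, V p, V `<=` U
      & forall q, V q -> exists qb : ~ q b, s q = frac a qb].

Lemma spec_section_ext U s t : open U -> (forall x, U x -> s x = t x) ->
  spec_section U s -> spec_section U t.
Proof.
move=> _ e h p /h[V [a [b [Vo Vp VU sV]]]]; exists V, a, b; split=> // q Vq.
by rewrite -e; [exact: sV | exact: VU].
Qed.

Lemma spec_section_restrict U V s : open U -> open V -> V `<=` U ->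
  spec_section U s -> spec_section V s.
Proof.
move=> _ Vo VU h p Vp; have [W [a [b [Wo Wp WU sW]]]] := h p (VU p Vp).
exists (W `&` V), a, b; split=> //; first exact: zariski_openI.
by move=> q [/sW].
Qed.

Lemma spec_section_glue U s : open U ->
  (forall x, U x ->
     exists V, [/\ open V, V x, V `<=` U & spec_section V s]) ->
  spec_section U s.
Proof.
move=> _ h p /h[V [Vo Vp VU sV]].
have [W [a [b [Wo Wp WV sW]]]] := sV p Vp; exists W, a, b; split=> //.
exact: subset_trans WV VU.
Qed.

Lemma spec_section_const U a : open U ->
  spec_section U (fun p => frac a (@prime_not1 _ p)).
Proof.
by move=> Uo p Up; exists U, a, 1; split=> // q Uq; exists (@prime_not1 _ q).
Qed.

Lemma spec_sectionB U s t : open U -> spec_section U s -> spec_section U t ->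
  spec_section U (fun x => s x - t x).
Proof.
move=> _ hs ht p Up; have [V [a [b [Vo Vp VU sV]]]] := hs p Up.
have [W [c [d [Wo Wp WU tW]]]] := ht p Up.
exists (V `&` W), (a * d - c * b), (b * d); split=> //.
- exact: zariski_openI.
- by move=> q [/VU].
move=> q [/sV[qb ->] /tW[qd ->]]; exists (prime_notM qb qd).
by rewrite fracN fracD mulNr.
Qed.

Lemma spec_sectionM U s t : open U -> spec_section U s -> spec_section U t ->
  spec_section U (fun x => s x * t x).
Proof.
move=> _ hs ht p Up; have [V [a [b [Vo Vp VU sV]]]] := hs p Up.
have [W [c [d [Wo Wp WU tW]]]] := ht p Up.
exists (V `&` W), (a * c), (b * d); split=> //.
- exact: zariski_openI.
- by move=> q [/VU].
by move=> q [/sV[qb ->] /tW[qd ->]]; exists (prime_notM qb qd); rewrite fracM.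
Qed.

Definition basic_open (a : A) : set (prime_ideal A) := [set q | ~ q a].

Lemma open_basic (a : A) : open (basic_open a).
Proof. by apply/zariski_openP => p pa; exists a. Qed.

Lemma spec_section_germ (p : prime_ideal A) (x : localization p) : exists U s,
  [/\ open U, U p, spec_section U s & s p = x].
Proof.
have [a [b [pb ->]]] := frac_surj x.
pose s (q : prime_ideal A) : localization q :=
  if pselect (~ q b) is left qb then frac a qb else 0.
have sE (q : prime_ideal A) (qb : ~ q b) : s q = frac a qb.
  rewrite /s; case: pselect => // qb'.
  by rewrite (Prop_irrelevance qb' qb).
exists (basic_open b), s; split=> //; first exact: open_basic.
move=> q qb; exists (basic_open b), a, b; split=> //.
  exact: open_basic.
by move=> r rb; exists rb.
Qed.

Lemma spec_section_eq0 U s p : open U -> U p -> spec_section U s -> s p = 0 ->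
  exists V, [/\ open V, V p, V `<=` U & forall q, V q -> s q = 0].
Proof.
move=> Uo Up hs; have [V [a [b [Vo Vp VU sV]]]] := hs p Up.
have [pb ->] := sV p Vp; rewrite -frac0 => /fracP[u pu].
rewrite mulr1 mul0r mulr0 => ua0.
exists (V `&` basic_open u); split=> //.
- by apply: zariski_openI => //; exact: open_basic.
- by move=> q [/VU].
move=> q [Vq qu]; have [qb ->] := sV q Vq; rewrite -frac0.
by apply/fracP; exists u => //; rewrite mulr1 mul0r mulr0.
Qed.

Definition Spec_space : locally_ringed_space :=
  @LocallyRingedSpace (prime_ideal A) (fun p => localization p) spec_section
    (fun p => @localization_local A p) spec_section_ext
    spec_section_restrict spec_section_glue
    (fun U Uo => spec_section_const 1 Uo) spec_sectionB spec_sectionM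
    spec_section_germ spec_section_eq0.

End Spec.

Section SpecMorphism.
Variables (A B : comPzRingType) (phi : {rmorphism A -> B}).

Lemma comap_prime (q : prime_ideal B) : is_prime_ideal (phi @^-1` q).
Proof.
have [[q0 qD qM] q1 qP] := prime_idealP q; split.
- split; rewrite /preimage /=.
  + by rewrite rmorph0.
  + by move=> a b; rewrite rmorphD; apply: qD.
  + by move=> a b; rewrite rmorphM; apply: qM.
- by rewrite /preimage /= rmorph1.
- by move=> a b; rewrite /preimage /= rmorphM; apply: qP.
Qed.

Definition comap (q : prime_ideal B) : prime_ideal A :=
  PrimeIdeal (comap_prime q).

Definition localization_map (q : prime_ideal B) (x : localization (comap q)) :
    localization q :=
  @frac B q (phi (numer (repr x))) (phi (denom (repr x))) (denomP (repr x)).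

Lemma localization_mapE (q : prime_ideal B) a b (qb : ~ comap q b) :
  localization_map (frac a qb) = @frac B q (phi a) (phi b) qb.
Proof.
have : frac (numer (repr (frac a qb))) (denomP (repr (frac a qb))) = frac a qb.
  by rewrite /frac -[RHS]reprK; case: (repr _).
move=> /fracP[u qu e]; apply/fracP; exists (phi u) => //.
by rewrite -!rmorphM e.
Qed.

Section LocalizationMap.
Variable q : prime_ideal B.

Lemma localization_map_additive : zmod_morphism (@localization_map q).
Proof.
move=> x y; have [a [b [pb ->]]] := frac_surj x.
have [c [d [pd ->]]] := frac_surj y.
rewrite fracN fracD !localization_mapE fracN fracD; apply/fracP.
exists 1; first exact: prime_not1.
by rewrite !(rmorphD, rmorphM, rmorphN).
Qed.

Lemma localization_map_multiplicative : monoid_morphism (@localization_map q).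
Proof.
split=> [|x y].
  rewrite -frac1 localization_mapE -frac1; apply/fracP.
  by exists 1; [exact: prime_not1|rewrite rmorph1].
have [a [b [pb ->]]] := frac_surj x; have [c [d [pd ->]]] := frac_surj y.
rewrite fracM !localization_mapE fracM; apply/fracP.
by exists 1; [exact: prime_not1|rewrite !rmorphM].
Qed.

HB.instance Definition _ := GRing.isZmodMorphism.Build
  (localization (comap q)) (localization q) (@localization_map q)
  localization_map_additive.
HB.instance Definition _ := GRing.isMonoidMorphism.Build
  (localization (comap q)) (localization q) (@localization_map q)
  localization_map_multiplicative.

End LocalizationMap.

Lemma comap_preimage_open (U : set (prime_ideal A)) :
  open U -> open (comap @^-1` U).
Proof.
move=> /zariski_openP h; apply/zariski_openP => q /h[a qa aU].
by exists (phi a) => // r ra; apply: aU.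
Qed.

Definition Spec_map : morphism (Spec_space B) (Spec_space A).
Proof.
exists (comap : Spec_space B -> Spec_space A)
  (fun q : Spec_space B => @localization_map q :
     {rmorphism localization (comap q) -> localization q}).
- by apply/continuousP => U; apply: comap_preimage_open.
- move=> q x; have [a [b [pb ->]]] := frac_surj x.
  by rewrite /= localization_mapE => /frac_invertible h; apply/frac_invertible.
- move=> U s Uo sU q Uq; have [V [a [b [Vo Vp VU sV]]]] := sU _ Uq.
  exists (comap @^-1` V), (phi a), (phi b); split=> //.
  + exact: comap_preimage_open.
  + by move=> r; apply: VU.
  + by move=> r /sV[rb /= ->]; exists rb; exact: localization_mapE.
Defined.

End SpecMorphism.

Definition is_scheme (X : locally_ringed_space) : Prop :=
  forall x : X, exists (A : comPzRingType) (j : morphism (Spec_space A) X),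
    open_immersion j /\ range j x.

Record scheme := Scheme {
  scheme_space :> locally_ringed_space;
  schemeP : is_scheme scheme_space }.

Lemma Spec_is_scheme (A : comPzRingType) : is_scheme (Spec_space A).
Proof.
move=> x; exists A, (id_morphism _); split; last by exists x.
split; first by move=> p q.
  by move=> U Uo; rewrite image_id.
by move=> p; exists id.
Qed.

Definition Spec (A : comPzRingType) : scheme := Scheme (@Spec_is_scheme A).

Notation "g \om f" := (comp_morphism g f) (at level 50, format "g  \om  f").

Definition is_fibre_product (S X Y P : scheme) (f : morphism X S)
    (g : morphism Y S) (p1 : morphism P X) (p2 : morphism P Y) : Prop :=
  f \om p1 = g \om p2 /\
  forall (W : scheme) (a : morphism W X) (b : morphism W Y),
    f \om a = g \om b -> exists! h : morphism W P, p1 \om h = a /\ p2 \om h = b.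

Definition locally_noetherian (X : scheme) : Prop :=
  forall x : X, exists (A : comPzRingType) (j : morphism (Spec A) X),
    [/\ is_noetherian_ring A, open_immersion j & range j x].

Definition separated_morphism (X S : scheme) (f : morphism X S) : Prop :=
  forall (P : scheme) (p1 p2 : morphism P X), is_fibre_product f f p1 p2 ->
  forall d : morphism X P,
    p1 \om d = id_morphism X -> p2 \om d = id_morphism X ->
    closed_immersion d.

(* [Y] is covered by affine open subschemes [Spec A] whose inverse image in
   [X] is an affine open subscheme [Spec B] with [B] finite over [A]. *)
Definition finite_morphism (X Y : scheme) (f : morphism X Y) : Prop :=
  forall y : Y, exists (A B : comPzRingType) (phi : {rmorphism A -> B})
      (j : morphism (Spec A) Y) (i : morphism (Spec B) X),
    [/\ [/\ open_immersion j, range j y & open_immersion i],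
        range i = f @^-1` range j,
        f \om i = j \om Spec_map phi
      & module_finite_hom phi].

Definition flat_morphism (X Y : scheme) (f : morphism X Y) : Prop :=
  forall x : X, flat_hom (stalk_map f x).

Definition locally_finitely_presented (X Y : scheme) (f : morphism X Y) :
  Prop :=
  forall x : X, exists (A B : comNzRingType) (phi : {rmorphism A -> B})
      (j : morphism (Spec A) Y) (i : morphism (Spec B) X),
    [/\ [/\ open_immersion j, open_immersion i & range i x],
        f \om i = j \om Spec_map phi
      & finitely_presented_hom phi].

(* The infinitesimal lifting property for the first order thickenings
   [Spec C0] in [Spec C] of affine schemes over [Y]. *)
Definition formally_smooth (X Y : scheme) (f : morphism X Y) : Prop :=
  forall (C C0 : comPzRingType) (pi : {rmorphism C -> C0}),
    (forall c0, exists c, pi c = c0) ->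
    (forall a b, pi a = 0 -> pi b = 0 -> a * b = 0) ->
  forall (y : morphism (Spec C) Y) (x0 : morphism (Spec C0) X),
    f \om x0 = y \om Spec_map pi ->
  exists x : morphism (Spec C) X, f \om x = y /\ x \om Spec_map pi = x0.

(* The definition of EGA IV, 17.3.1. *)
Definition smooth_morphism (X Y : scheme) (f : morphism X Y) : Prop :=
  locally_finitely_presented f /\ formally_smooth f.

Definition irreducible_space (X : topologicalType) : Prop :=
  (exists x : X, True) /\
  forall C D : set X, closed C -> closed D -> C `|` D = setT ->
    C = setT \/ D = setT.

Definition generic_point (X : topologicalType) (x : X) : Prop :=
  closure [set x] = setT.

(* [g] is the canonical morphism from the spectrum of the residue field of
   [x], up to a unique isomorphism: the surjective local homomorphism from the
   local ring at [x] to the stalk [K] of [Spec K] identifies [K] with its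
   residue field. *)
Definition is_residue_field_point (X : scheme) (x : X) (K : fieldType)
    (g : morphism (Spec K) X) : Prop :=
  forall o : Spec K, g o = x /\
    forall a : stalk o, exists b, stalk_map g o b = a.

(* Schemes over a field are separated and locally Noetherian throughout. *)
Definition is_scheme_over (F : fieldType) (X : scheme)
    (sX : morphism X (Spec F)) : Prop :=
  separated_morphism sX /\ locally_noetherian X.

Definition is_finite_scheme_over (F : fieldType) (X : scheme)
    (sX : morphism X (Spec F)) : Prop :=
  is_scheme_over sX /\ finite_morphism sX.

(* [rho] and [i] exhibit [R] as the fibre of [f] at the rational point [t],
   and [W] with [w] is the fibre of [f] over the spectrum of the residue field
   of the generic point [eta]. *)
Definition smoothable (F : fieldType) (R : scheme) (rho : morphism R (Spec F)) :
  Prop :=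
  exists (T Z : scheme) (sT : morphism T (Spec F)) (f : morphism Z T),
    [/\ is_scheme_over sT /\ irreducible_space T, is_scheme_over (sT \om f),
        flat_morphism f /\ finite_morphism f,
        exists (t : morphism (Spec F) T) (i : morphism R Z),
          sT \om t = id_morphism (Spec F) /\ is_fibre_product f t i rho
      & exists (eta : T) (K : fieldType) (g : morphism (Spec K) T)
          (W : scheme) (v : morphism W Z) (w : morphism W (Spec K)),
          [/\ generic_point eta, is_residue_field_point eta g,
              is_fibre_product f g v w & smooth_morphism w]].

(* Main.v *)
(** A finite [F]-scheme is [Spec] of an algebra given by structure constants, that is, an
    [F]-point of the affine scheme [S] of algebra structures on a space of dimension [n],
    over which the discriminant [disc] of the trace form is a function.  The scheme is
    smoothable if and only if some prime of [F[S]] contained in the maximal ideal of this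
    point does not contain [disc].

    Given such a prime, the universal algebra over the corresponding integral closed
    subscheme of [S] is a smoothing, since an algebra over a field with nonzero
    discriminant is formally smooth.  Conversely, a flat finite family over [T] is free over
    the local ring of [T] at [t], hence pulled back from [S]; the kernel of [F[S] -> K], with
    [K] the residue field at the generic point of [T], is the required prime, since a
    formally smooth finite algebra over a field has nonzero discriminant.

    The criterion descends along [k -> kbar] by contracting primes.  It ascends because a
    relation [u * disc ^ N = sum_i c_i r_i] over [kbar], with [r_i] among the equations of
    [S], is carried to one over [k] by applying a [k]-linear functional [kbar -> k] to
    coefficients, and the functional can be chosen not to vanish on the value of [u] at the
    given point. *)

From HB Require Import structures.
From mathcomp Require Import all_boot all_order all_algebra.
From mathcomp Require Import(canonicals, coercions) mpoly.
From mathcomp Require Import boolp classical_sets functions topology.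
From mathcomp Require Import ring.
Require Import Defs.

Set Implicit Arguments.
Unset Strict Implicit.
Unset Printing Implicit Defensive.

Import GRing.Theory.
Local Open Scope quotient_scope.
Local Open Scope classical_set_scope.
Local Open Scope ring_scope.

(** * Ideals and quotients *)

(** The base [T] of a smoothing is not assumed to be of finite type, so a smoothing over [kbar] need
    not come from a finite extension of [k]. Passing to [S] removes [T]: all that survives is the
    kernel of a ring map to [K]. This kernel vanishes at the given point because the map factors
    through the local ring of [T] at [t]: a function that is nonzero at the point becomes a unit
    there, and a unit does not go to zero in [K]. As [T] may be non-reduced, only its residue field
    at the generic point yields a prime.

    Primes contract, but the ideal that a prime generates over [kbar] need not be prime. The ascent
    therefore starts afresh from the equations of [S] and looks for a prime that avoids all products
    [u * disc ^ N] with [u] nonzero at the point; the relation treated by the functional is the only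
    obstruction to such a prime.

    Flatness is defined by tensor products up to their universal property, over local rings of
    points. On one side this calls for explicit models of tensor products, on the other for the
    equational criterion, from which denominators can be cleared. *)

Lemma prime_ideal_ext (A : comPzRingType) (p q : prime_ideal A) :
  (forall a, p a <-> q a) -> p = q.
Proof.
move=> pq; case: p q pq => [p pP] [q qP] /= pq.
have e : p = q by apply/funext => a; apply/propext.
by subst q; rewrite (Prop_irrelevance pP qP).
Qed.

Section IdealFacts.
Variables (A : comPzRingType) (I : set A) (hI : is_ideal I).

Lemma ideal0 : I 0. Proof. by have [] := hI. Qed.
Lemma idealD a b : I a -> I b -> I (a + b). Proof. by have [_ h _] := hI; exact: h. Qed.
Lemma idealMl a b : I b -> I (a * b). Proof. by have [_ _ h] := hI; exact: h. Qed.
Lemma idealMr a b : I a -> I (a * b). Proof. by rewrite mulrC; exact: idealMl. Qed.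
Lemma idealN a : I a -> I (- a). Proof. by rewrite -mulN1r; exact: idealMl. Qed.
Lemma idealB a b : I a -> I b -> I (a - b).
Proof. by move=> Ia Ib; apply: idealD => //; exact: idealN. Qed.
Lemma ideal_sum (J : Type) (r : seq J) (P : pred J) (F : J -> A) :
  (forall j, P j -> I (F j)) -> I (\sum_(j <- r | P j) F j).
Proof. by move=> h; elim/big_ind: _ => //; [exact: ideal0 | exact: idealD]. Qed.

End IdealFacts.

Lemma annihilator_ideal (A : comPzRingType) (c : A) : is_ideal [set u | u * c = 0].
Proof.
split=> /=; first by rewrite mul0r.
  by move=> x y xc yc; rewrite mulrDl xc yc addr0.
by move=> x y yc; rewrite -mulrA yc mulr0.
Qed.

Lemma kernel_ideal (A B : comPzRingType) (f : {rmorphism A -> B}) :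
  is_ideal [set a | f a = 0].
Proof.
split=> [|a b|a b] /=; rewrite ?rmorph0 // ?rmorphD ?rmorphM.
  by move=> -> ->; rewrite addr0.
by move=> ->; rewrite mulr0.
Qed.

Lemma zero_ideal (A : comPzRingType) : is_ideal [set 0 : A].
Proof. exact: (kernel_ideal (idfun : {rmorphism A -> A})). Qed.

Definition prime_is_ideal (A : comPzRingType) (p : prime_ideal A) : is_ideal p :=
  let: And3 h _ _ := prime_idealP p in h.

Lemma prime_mul (A : comPzRingType) (p : prime_ideal A) a b :
  p (a * b) -> p a \/ p b.
Proof. by have [_ _] := prime_idealP p; apply. Qed.

Lemma prime_notX (A : comPzRingType) (p : prime_ideal A) a n :
  ~ p a -> ~ p (a ^+ n).
Proof.
by move=> pa; elim: n => [|n IH]; [exact: prime_not1 | rewrite exprS; exact: prime_notM].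
Qed.

Lemma prime_not_prod (A : comPzRingType) (p : prime_ideal A) (J : Type)
  (r : seq J) (F : J -> A) : (forall j, ~ p (F j)) -> ~ p (\prod_(j <- r) F j).
Proof. by move=> h; elim/big_ind: _ => //; [exact: prime_not1 | exact: prime_notM]. Qed.

(** An ideal maximal among those that contain [I] and miss [S] is prime: if [a] and [b] lie outside
    it, adjoining either one reaches [S], and the product of the two elements so reached would lie
    in the ideal if [a * b] did. *)
Lemma exists_prime_avoiding (A : comPzRingType) (I S : set A) :
  is_ideal I -> S 1 -> (forall a b, S a -> S b -> S (a * b)) ->
  (forall a, I a -> ~ S a) ->
  exists p : prime_ideal A, I `<=` p /\ forall a, p a -> ~ S a.
Proof.
move=> hI S1 SM IS.
pose good (X : set A) := [/\ is_ideal X, I `<=` X & forall a, X a -> ~ S a].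
have [F FP Ftot|X [PX Xmax]] := @Zorn_bigcup A [set X | X = set0 \/ good X].
  have [[Y FY gY]|nF] := pselect (exists2 Y, F Y & good Y); last first.
    left; rewrite -subset0 => a [Z FZ Za]; exfalso; apply: nF; exists Z => //.
    by have [Z0|//] := FP Z FZ; rewrite Z0 in Za.
  have gF Z a : F Z -> Z a -> good Z.
    by move=> FZ Za; have [Z0|//] := FP Z FZ; rewrite Z0 in Za.
  right; split.
  - split.
    + by exists Y => //; have [[]] := gY.
    + move=> a b [Z FZ Za] [W FW Wb].
      have [ZW|WZ] := Ftot _ _ FZ FW.
        exists W => //; have [[_ h _] _ _] := gF _ _ FW Wb.
        by apply: h => //; exact: ZW.
      exists Z => //; have [[_ h _] _ _] := gF _ _ FZ Za.
      by apply: h => //; exact: WZ.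
    + move=> a b [Z FZ Zb]; exists Z => //.
      by have [[_ _ h] _ _] := gF _ _ FZ Zb; exact: h.
  - by move=> a Ia; exists Y => //; have [_ h _] := gY; exact: h.
  - by move=> a [Z FZ Za]; have [_ _ h] := gF _ _ FZ Za; exact: h.
have {PX} gX : good X.
  case: PX => // X0; exfalso; apply: (Xmax I); last by right; split.
  by rewrite X0; split => // /(_ 0); apply; case: hI.
have [hX IX XS] := gX.
have max a : ~ X a -> exists x b, X x /\ S (x + a * b).
  move=> Xa.
  pose J := [set y | exists x b, X x /\ y = x + a * b].
  have hJ : is_ideal J.
    split.
    + by exists 0, 0; split; [exact: ideal0 | rewrite mulr0 addr0].
    + move=> _ _ [x [b [Xx ->]]] [x' [b' [Xx' ->]]].
      by exists (x + x'), (b + b'); split; [exact: idealD | ring].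
    + move=> c _ [x [b [Xx ->]]].
      by exists (c * x), (c * b); split; [exact: idealMl | ring].
  have XJ : X `<=` J by move=> x Xx; exists x, 0; split=> //; ring.
  apply: contrapT => nS; apply: (Xmax J); last first.
    right; split=> //; first by move=> x /IX /XJ.
    by move=> _ [x [b [Xx ->]]] h; apply: nS; exists x, b.
  split=> // JX; apply: Xa; apply: JX; exists 0, 1.
  by split; [exact: ideal0 | ring].
have pX : is_prime_ideal X.
  split=> //; first by move=> /XS.
  move=> a b Xab; apply: contrapT => /not_orP[/max[x [c [Xx Sx]]] /max[y [d [Xy Sy]]]].
  apply: XS (SM _ _ Sx Sy).
  have -> : (x + a * c) * (y + b * d) = x * (y + b * d) + (a * c * y + c * d * (a * b)) by ring.
  by apply: idealD => //; [exact: idealMr | apply: idealD => //; exact: idealMl].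
by exists (PrimeIdeal pX).
Qed.

(** Quotient modules and quotient rings are both built on this quotient of abelian groups, adding a
    scaling or a product to the same carrier. *)
Record subgroup (V : zmodType) := Subgroup {
  subgroup_set :> V -> Prop;
  subgroup0 : subgroup_set 0;
  subgroupB : forall a b, subgroup_set a -> subgroup_set b -> subgroup_set (a - b) }.

Section ZQuotient.
Variables (V : zmodType) (U : subgroup V).

Definition zquot_equiv (x y : V) : bool := `[< U (x - y) >].

Lemma zquot_equiv_class : equiv_class_of zquot_equiv.
Proof.
split=> [x|x y|y x z].
- by apply/asboolP; rewrite subrr; exact: subgroup0.
- apply/asboolP/asboolP => /(subgroupB (subgroup0 U));
  by rewrite sub0r opprB.
- move=> /asboolP h1 /asboolP h2; apply/asboolP.
  have h3 := subgroupB (subgroup0 U) h2; rewrite sub0r opprB in h3.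
  by have := subgroupB h1 h3; rewrite opprB addrA subrK.
Qed.

Canonical zquot_equiv_rel := EquivRelPack zquot_equiv_class.
Canonical zquot_enc := defaultEncModRel zquot_equiv.

Definition zquot := {eq_quot zquot_equiv}.

HB.instance Definition _ : EqQuotient V zquot_equiv zquot := EqQuotient.on zquot.
HB.instance Definition _ := Choice.on zquot.

Definition zproj (x : V) : zquot := \pi_zquot x.

Lemma zproj_eq x y : zproj x = zproj y <-> U (x - y).
Proof.
rewrite /zproj; split=> [/eqmodP/asboolP //|h].
by apply/eqmodP/asboolP.
Qed.

Definition zlift (x : zquot) : V := repr x.

Lemma zliftK x : zproj (zlift x) = x. Proof. exact: reprK. Qed.

Lemma zproj_surj x : exists y, x = zproj y.
Proof. by exists (zlift x); rewrite zliftK. Qed.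

Lemma subgroupN x : U x -> U (- x).
Proof. by move=> h; rewrite -sub0r; apply: subgroupB => //; exact: subgroup0. Qed.

Lemma subgroupD x y : U x -> U y -> U (x + y).
Proof. by move=> hx hy; rewrite -[y]opprK; apply: subgroupB => //; exact: subgroupN. Qed.

Lemma zlift_proj x : U (zlift (zproj x) - x).
Proof. by apply/zproj_eq; rewrite zliftK. Qed.

Definition zquot_add x y := zproj (zlift x + zlift y).
Definition zquot_opp x := zproj (- zlift x).

Lemma zquot_addE x y : zquot_add (zproj x) (zproj y) = zproj (x + y).
Proof. by apply/zproj_eq; rewrite opprD addrACA; apply: subgroupD; exact: zlift_proj. Qed.

Lemma zquot_oppE x : zquot_opp (zproj x) = zproj (- x).
Proof. by apply/zproj_eq; rewrite -opprD; apply: subgroupN; exact: zlift_proj. Qed.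

Lemma zquot_addA : associative zquot_add.
Proof.
move=> x y z; have [x' ->] := zproj_surj x; have [y' ->] := zproj_surj y.
by have [z' ->] := zproj_surj z; rewrite !zquot_addE addrA.
Qed.
Lemma zquot_addC : commutative zquot_add.
Proof.
move=> x y; have [x' ->] := zproj_surj x; have [y' ->] := zproj_surj y.
by rewrite !zquot_addE addrC.
Qed.
Lemma zquot_add0 : left_id (zproj 0) zquot_add.
Proof. by move=> x; have [x' ->] := zproj_surj x; rewrite zquot_addE add0r. Qed.
Lemma zquot_addN : left_inverse (zproj 0) zquot_opp zquot_add.
Proof.
by move=> x; have [x' ->] := zproj_surj x; rewrite zquot_oppE zquot_addE addNr.
Qed.

HB.instance Definition _ :=
  GRing.isZmodule.Build zquot zquot_addA zquot_addC zquot_add0 zquot_addN.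

Lemma zproj_is_additive : zmod_morphism zproj.
Proof. by move=> x y; rewrite -zquot_addE -zquot_oppE. Qed.

HB.instance Definition _ := GRing.isZmodMorphism.Build V zquot zproj zproj_is_additive.

Lemma zproj_eq0 x : zproj x = 0 <-> U x.
Proof. by have := zproj_eq x 0; rewrite subr0. Qed.

End ZQuotient.

Arguments zproj {V} U.

Record submodule (A : comPzRingType) (V : lmodType A) := Submodule {
  submodule_group :> subgroup V;
  submoduleZ : forall a x, submodule_group x -> submodule_group (a *: x) }.

Definition mquot (A : comPzRingType) (V : lmodType A) (U : submodule V) : Type :=
  zquot U.

Section ModuleQuotient.
Variables (A : comPzRingType) (V : lmodType A) (U : submodule V).

HB.instance Definition _ := GRing.Zmodule.on (mquot U).

Definition mproj (x : V) : mquot U := zproj U x.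

Definition mquot_scale (a : A) (x : mquot U) : mquot U := mproj (a *: zlift x).

Lemma mquot_scaleE a x : mquot_scale a (mproj x) = mproj (a *: x).
Proof. by apply/zproj_eq; rewrite -scalerBr; apply: submoduleZ; exact: zlift_proj. Qed.

Lemma mproj_is_additive : zmod_morphism mproj.
Proof. exact: zproj_is_additive. Qed.

HB.instance Definition _ :=
  GRing.isZmodMorphism.Build V (mquot U) mproj mproj_is_additive.

Lemma mproj_surj (x : mquot U) : exists y, x = mproj y.
Proof. exact: zproj_surj. Qed.

Lemma mquot_scaleA a b x : mquot_scale a (mquot_scale b x) = mquot_scale (a * b) x.
Proof. by have [y ->] := mproj_surj x; rewrite !mquot_scaleE scalerA. Qed.
Lemma mquot_scale1 : left_id 1 mquot_scale.
Proof. by move=> x; have [y ->] := mproj_surj x; rewrite mquot_scaleE scale1r. Qed.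
Lemma mquot_scaleDr : right_distributive mquot_scale +%R.
Proof.
move=> a x y; have [x' ->] := mproj_surj x; have [y' ->] := mproj_surj y.
by rewrite -raddfD !mquot_scaleE scalerDr raddfD.
Qed.
Lemma mquot_scaleDl x : {morph mquot_scale^~ x : a b / a + b}.
Proof.
by move=> a b; have [y ->] := mproj_surj x; rewrite !mquot_scaleE scalerDl raddfD.
Qed.

HB.instance Definition _ := GRing.Zmodule_isLmodule.Build A (mquot U)
  mquot_scaleA mquot_scale1 mquot_scaleDr mquot_scaleDl.

Lemma mproj_is_linear : linear mproj.
Proof. by move=> a x y; rewrite raddfD /= -[mproj (a *: x)]mquot_scaleE. Qed.

Lemma mproj_eq0 x : mproj x = 0 <-> U x.
Proof. exact: zproj_eq0. Qed.

End ModuleQuotient.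

Record ideal (A : comPzRingType) := Ideal {
  ideal_set :> A -> Prop;
  idealP : is_ideal ideal_set }.

Definition ideal_subgroup (A : comPzRingType) (I : ideal A) : subgroup A :=
  Subgroup (ideal0 (idealP I)) (idealB (idealP I)).

Definition rquot (A : comPzRingType) (I : ideal A) : Type := zquot (ideal_subgroup I).

Section RingQuotient.
Variables (A : comPzRingType) (I : ideal A).

HB.instance Definition _ := GRing.Zmodule.on (rquot I).

Definition rproj (x : A) : rquot I := zproj (ideal_subgroup I) x.

Lemma rproj_surj (x : rquot I) : exists y, x = rproj y.
Proof. exact: zproj_surj. Qed.

Lemma rproj_eq x y : rproj x = rproj y <-> I (x - y).
Proof. exact: zproj_eq. Qed.

Lemma rproj_eq0 x : rproj x = 0 <-> I x.
Proof. exact: (zproj_eq0 (ideal_subgroup I)). Qed.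

Definition rquot_mul (x y : rquot I) : rquot I := rproj (zlift x * zlift y).

Lemma rquot_mulE x y : rquot_mul (rproj x) (rproj y) = rproj (x * y).
Proof.
apply/rproj_eq; set x' := zlift _; set y' := zlift _.
have -> : x' * y' - x * y = (x' - x) * y' + x * (y' - y) by ring.
apply: idealD; first exact: idealP.
  by apply: idealMr; [exact: idealP | exact: (zlift_proj (ideal_subgroup I))].
by apply: idealMl; [exact: idealP | exact: (zlift_proj (ideal_subgroup I))].
Qed.

Lemma rproj_is_additive : zmod_morphism rproj.
Proof. exact: zproj_is_additive. Qed.

HB.instance Definition _ :=
  GRing.isZmodMorphism.Build A (rquot I) rproj rproj_is_additive.

Lemma rquot_mulA : associative rquot_mul.
Proof.
move=> x y z; have [x' ->] := rproj_surj x; have [y' ->] := rproj_surj y.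
by have [z' ->] := rproj_surj z; rewrite !rquot_mulE mulrA.
Qed.
Lemma rquot_mulC : commutative rquot_mul.
Proof.
move=> x y; have [x' ->] := rproj_surj x; have [y' ->] := rproj_surj y.
by rewrite !rquot_mulE mulrC.
Qed.
Lemma rquot_mul1 : left_id (rproj 1) rquot_mul.
Proof. by move=> x; have [x' ->] := rproj_surj x; rewrite rquot_mulE mul1r. Qed.
Lemma rquot_mulDl : left_distributive rquot_mul +%R.
Proof.
move=> x y z; have [x' ->] := rproj_surj x; have [y' ->] := rproj_surj y.
by have [z' ->] := rproj_surj z; rewrite -raddfD !rquot_mulE mulrDl raddfD.
Qed.

HB.instance Definition _ := GRing.Zmodule_isComPzRing.Build (rquot I)
  rquot_mulA rquot_mulC rquot_mul1 rquot_mulDl.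

Lemma rproj_is_multiplicative : monoid_morphism rproj.
Proof. by split=> // x y; rewrite -rquot_mulE. Qed.

HB.instance Definition _ :=
  GRing.isMonoidMorphism.Build A (rquot I) rproj rproj_is_multiplicative.

End RingQuotient.

Arguments rproj {A} I.
Arguments mproj {A V} U.

(** * Localizations and residue fields *)

Lemma rmorphism_of (A B : pzRingType) (f : A -> B) :
  zmod_morphism f -> monoid_morphism f -> exists g : {rmorphism A -> B}, g =1 f.
Proof.
move=> fA fM.
pose g : {rmorphism A -> B} := HB.pack f
  (GRing.isZmodMorphism.Build A B f fA) (GRing.isMonoidMorphism.Build A B f fM).
by exists g.
Qed.

Section Invertible.
Variable A : comPzRingType.
Implicit Types a b : A.

Lemma invertible1 : invertible (1 : A). Proof. by exists 1; rewrite mulr1. Qed.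

Lemma invertibleM a b : invertible (a * b) <-> invertible a /\ invertible b.
Proof.
split=> [[c abc]|[[c ac] [d bd]]].
  by split; [exists (b * c) | exists (a * c)]; rewrite -abc; ring.
by exists (c * d); rewrite mulrACA ac bd mulr1.
Qed.

Lemma invertible_mulI a b c : invertible a -> a * b = a * c -> b = c.
Proof.
move=> [d ad] e; transitivity (d * (a * b)); first by rewrite mulrA (mulrC d) ad mul1r.
by rewrite e mulrA (mulrC d) ad mul1r.
Qed.

Definition inverse a : A := if pselect (invertible a) is left h then sval (cid h) else 0.

Lemma mul_inverse a : invertible a -> a * inverse a = 1.
Proof. by rewrite /inverse; case: pselect => // h _; case: cid. Qed.

End Invertible.

Lemma invertible_morph (A B : comPzRingType) (f : {rmorphism A -> B}) a :
  invertible a -> invertible (f a).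
Proof. by move=> [b ab]; exists (f b); rewrite -rmorphM ab rmorph1. Qed.

Lemma invertible_field (K : fieldType) (x : K) : invertible x <-> x != 0.
Proof.
split=> [[y xy]|x0]; last by exists x^-1; rewrite mulfV.
by apply: contra_eqN xy => /eqP ->; rewrite mul0r eq_sym oner_eq0.
Qed.

Section LocalizationLift.
Variables (A : comPzRingType) (p : prime_ideal A).

Definition loc_map (a : A) : localization p := frac a (@prime_not1 _ p).

Lemma loc_map_additive : zmod_morphism loc_map.
Proof. by move=> a b; rewrite /loc_map fracN fracD; apply: frac_eq; ring. Qed.

Lemma loc_map_multiplicative : monoid_morphism loc_map.
Proof. by split=> [|a b]; rewrite /loc_map ?fracM //; apply: frac_eq; ring. Qed.

HB.instance Definition _ :=
  GRing.isZmodMorphism.Build A (localization p) loc_map loc_map_additive.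
HB.instance Definition _ :=
  GRing.isMonoidMorphism.Build A (localization p) loc_map loc_map_multiplicative.

Lemma loc_map_invertible a : invertible (loc_map a) <-> ~ p a.
Proof. exact: frac_invertible. Qed.

Lemma frac_loc_map a b (pb : ~ p b) : loc_map b * frac a pb = loc_map a.
Proof. by rewrite /loc_map fracM; apply: frac_eq; ring. Qed.

Lemma loc_map_eq a b : loc_map a = loc_map b <-> exists2 u, ~ p u & u * a = u * b.
Proof.
rewrite /loc_map; split=> [/fracP|] [u pu]; rewrite ?mulr1 => e.
  by exists u.
by apply/fracP; exists u => //; rewrite !mulr1.
Qed.

Lemma loc_map_eq0 a : loc_map a = 0 <-> exists2 u, ~ p u & u * a = 0.
Proof.
rewrite -(rmorph0 loc_map); split=> [/loc_map_eq [u pu e]|[u pu e]].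
  by exists u => //; rewrite e mulr0.
by apply/loc_map_eq; exists u => //; rewrite e mulr0.
Qed.

Lemma loc_surj (x : localization p) : exists a b, ~ p b /\ loc_map b * x = loc_map a.
Proof.
by have [a [b [pb ->]]] := frac_surj x; exists a, b; rewrite frac_loc_map.
Qed.

Variables (G : comPzRingType).

Lemma loc_hom_ext (f g : {rmorphism localization p -> G}) :
  (forall a, f (loc_map a) = g (loc_map a)) -> f =1 g.
Proof.
move=> fg x; have [a [b [pb e]]] := loc_surj x.
apply: (@invertible_mulI _ (f (loc_map b))).
  by apply: invertible_morph; apply/loc_map_invertible.
by rewrite -rmorphM e fg -e rmorphM fg.
Qed.

Lemma loc_lift (f : {rmorphism A -> G}) : (forall a, ~ p a -> invertible (f a)) ->
  exists g : {rmorphism localization p -> G}, forall a, g (loc_map a) = f a.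
Proof.
move=> finv; pose h (x : localization p) := f (loc_num x) * inverse (f (loc_den x)).
(* [h] is defined on chosen representatives; this frees it from the choice. Each ring law is then
   checked after multiplication by a denominator. *)
have hE x a b : ~ p b -> loc_map b * x = loc_map a -> f b * h x = f a.
  have pd : ~ p (loc_den x) by exact: loc_denP.
  have e : loc_map (loc_den x) * x = loc_map (loc_num x).
    by have := frac_loc_map (loc_num x) (@loc_denP _ _ x); rewrite loc_fracK.
  move=> pb ea.
  have /loc_map_eq[u pu eu] : loc_map (loc_den x * a) = loc_map (b * loc_num x).
    by rewrite !rmorphM /= -ea -e; ring.
  rewrite /h; apply: (@invertible_mulI _ (f u)); first exact: finv.
  apply: (@invertible_mulI _ (f (loc_den x))); first exact: finv.
  transitivity (f (u * (b * loc_num x)) * (f (loc_den x) * inverse (f (loc_den x)))).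
    by rewrite !rmorphM; ring.
  rewrite mul_inverse; last exact: finv.
  by rewrite -eu !rmorphM; ring.
have [||g gh] := @rmorphism_of _ _ h.
- move=> x y; have [a [b [pb ex]]] := loc_surj x; have [c [d [pd ey]]] := loc_surj y.
  apply: (@invertible_mulI _ (f (b * d))); first exact/finv/prime_notM.
  rewrite (hE _ (a * d - c * b) _ (prime_notM pb pd)); last first.
    by rewrite rmorphB !rmorphM /= -ex -ey; ring.
  rewrite rmorphB !rmorphM -(hE x _ _ pb ex) -(hE y _ _ pd ey); ring.
- split=> [|x y].
    apply: (@invertible_mulI _ (f 1)); first by rewrite rmorph1; exact: invertible1.
    by rewrite (hE _ 1 _ (@prime_not1 _ p)) ?mulr1 // rmorph1.
  have [a [b [pb ex]]] := loc_surj x; have [c [d [pd ey]]] := loc_surj y.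
  apply: (@invertible_mulI _ (f (b * d))); first exact/finv/prime_notM.
  rewrite (hE _ (a * c) _ (prime_notM pb pd)); last first.
    by rewrite !rmorphM /= -ex -ey; ring.
  by rewrite !rmorphM -(hE x _ _ pb ex) -(hE y _ _ pd ey); ring.
exists g => a; rewrite gh -[LHS]mul1r -(rmorph1 f).
by apply: hE; [exact: prime_not1 | rewrite rmorph1 mul1r].
Qed.

End LocalizationLift.

Arguments loc_map {A} p a.

Section ResidueField.
Variables (A : comPzRingType) (p : prime_ideal A).

Lemma nonunit_ideal : is_ideal [set x : localization p | ~ invertible x].
Proof.
split=> /=.
- by rewrite -(rmorph0 (loc_map p)) loc_map_invertible => /(_ (ideal0 (prime_is_ideal p))).
- by move=> x y hx hy /(@localization_local _ p) [].
- by move=> x y hy /invertibleM [].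
Qed.

Definition residue : Type := rquot (Ideal nonunit_ideal).

HB.instance Definition _ := GRing.ComPzRing.on residue.

Lemma residue_neq0 : (1 : residue) != 0.
Proof.
apply/eqP => e; have /rproj_eq0 : rproj (Ideal nonunit_ideal) 1 = 0.
  by rewrite rmorph1.
by apply; exact: invertible1.
Qed.

HB.instance Definition _ := GRing.PzSemiRing_isNonZero.Build residue residue_neq0.

Definition residue_inv (x : residue) : residue := if x == 0 then 0 else inverse x.

Lemma residue_mulV (x : residue) : x != 0 -> residue_inv x * x = 1.
Proof.
rewrite /residue_inv => x0; rewrite (negbTE x0) mulrC; apply: mul_inverse.
have [y yx] := rproj_surj x; have : ~ ~ invertible y.
  move=> /(rproj_eq0 (Ideal nonunit_ideal)) h.
  by move/eqP: x0; apply; rewrite yx.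
move=> /contrapT; rewrite yx; exact: (invertible_morph (rproj (Ideal nonunit_ideal))).
Qed.

Lemma residue_inv0 : residue_inv 0 = 0.
Proof. by rewrite /residue_inv eqxx. Qed.

HB.instance Definition _ := GRing.ComNzRing_isField.Build residue residue_mulV residue_inv0.

(** The two clauses characterize [K] as the fraction field of [A / p] by a map out of [A], so that
    later arguments can ignore how [K] is built. *)
Lemma residue_field : exists (K : fieldType) (f : {rmorphism A -> K}),
  (forall a, f a = 0 <-> p a) /\
  (forall x, exists a b, ~ p b /\ f b * x = f a).
Proof.
exists residue, (rproj (Ideal nonunit_ideal) \o loc_map p :
  {rmorphism A -> rquot (Ideal nonunit_ideal)}); split=> [a|x].
  apply: (iff_trans (rproj_eq0 (Ideal nonunit_ideal) (loc_map p a))).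
  split=> [/= h|pa /= /loc_map_invertible //].
  by apply: contrapT => /loc_map_invertible.
have [y yx] := rproj_surj x; have [a [b [pb e]]] := loc_surj y.
exists a, b; split=> //=; rewrite yx -e; apply/esym.
exact: (rmorphM (rproj (Ideal nonunit_ideal))).
Qed.

End ResidueField.

(** * Algebras given by structure constants *)

(** The left summand indexes the structure constants, the right one the coordinates of the unit.
    Recording the unit turns its existence into equations, so algebra structures are the zeros of
    polynomials. *)
Definition sidx (n : nat) : finType := ('I_n * 'I_n * 'I_n + 'I_n)%type.

Definition sc n (A : Type) (x : sidx n -> A) i j l : A := x (inl (i, j, l)).
Definition su n (A : Type) (x : sidx n -> A) i : A := x (inr i).

(* The vanishing of these elements says that [e_i * e_j = sum_l sc x i j l e_l]
   is an associative commutative product with unit [sum_i su x i e_i]. *)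
Definition alg_rel n (A : comPzRingType) (x : sidx n -> A) : set A :=
  [set a | [\/ exists i j k l,
       a = \sum_m sc x i j m * sc x m k l - \sum_m sc x j k m * sc x i m l,
     exists i j l, a = sc x i j l - sc x j i l
   | exists j l, a = \sum_i su x i * sc x i j l - (j == l)%:R]].

Record algdata n (A : comPzRingType) := AlgData {
  adata :> sidx n -> A;
  adataP : forall a, alg_rel adata a -> a = 0 }.

(** The relations are polynomials with integer coefficients in the structure constants and the unit,
    so ring morphisms carry them to each other. *)
Lemma alg_rel_map n (A B : comPzRingType) (f : {rmorphism A -> B})
    (x : sidx n -> A) b :
  alg_rel (f \o x) b <-> exists2 a, alg_rel x a & b = f a.
Proof.
split=> [[[i [j [k [l ->]]]]|[i [j [l ->]]]|[j [l ->]]]|[a]].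
- eexists; first by constructor 1; exists i, j, k, l; reflexivity.
  by rewrite rmorphB !rmorph_sum; congr (_ - _); apply: eq_bigr => m _; rewrite rmorphM.
- eexists; first by constructor 2; exists i, j, l; reflexivity.
  by rewrite rmorphB.
- eexists; first by constructor 3; exists j, l; reflexivity.
  rewrite rmorphB rmorph_nat rmorph_sum; congr (_ - _).
  by apply: eq_bigr => m _; rewrite rmorphM.
case=> [[i [j [k [l ->]]]]|[i [j [l ->]]]|[j [l ->]]] ->.
- constructor 1; exists i, j, k, l; rewrite rmorphB !rmorph_sum.
  by congr (_ - _); apply: eq_bigr => m _; rewrite rmorphM.
- by constructor 2; exists i, j, l; rewrite rmorphB.
- constructor 3; exists j, l; rewrite rmorphB rmorph_nat rmorph_sum; congr (_ - _).
  by apply: eq_bigr => m _; rewrite rmorphM.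
Qed.

Lemma map_dataP n (A B : comPzRingType) (f : {rmorphism A -> B})
  (d : algdata n A) b : alg_rel (f \o d) b -> b = 0.
Proof. by move=> /alg_rel_map[a /adataP -> ->]; rewrite rmorph0. Qed.

Definition map_data n (A B : comPzRingType) (f : {rmorphism A -> B})
  (d : algdata n A) : algdata n B := AlgData (@map_dataP n A B f d).

Definition alg n (A : comPzRingType) (d : algdata n A) : Type := 'rV[A]_n.

Section Alg.
Variables (n : nat) (A : comPzRingType) (d : algdata n A).

HB.instance Definition _ := GRing.Lmodule.on (alg d).

Local Notation c := (sc d).
Local Notation u := (su d).

Lemma scA i j k l : \sum_m c i j m * c m k l = \sum_m c j k m * c i m l.
Proof. by apply/eqP; rewrite -subr_eq0; apply/eqP/(@adataP _ _ d); constructor 1; exists i, j, k, l. Qed.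
Lemma scC i j l : c i j l = c j i l.
Proof. by apply/eqP; rewrite -subr_eq0; apply/eqP/(@adataP _ _ d); constructor 2; exists i, j, l. Qed.
Lemma sc1 j l : \sum_i u i * c i j l = (j == l)%:R.
Proof. by apply/eqP; rewrite -subr_eq0; apply/eqP/(@adataP _ _ d); constructor 3; exists j, l. Qed.

Definition alg_mul (x y : alg d) : alg d :=
  \row_l \sum_i \sum_j x 0 i * y 0 j * c i j l.
Definition alg_one : alg d := \row_l u l.

Lemma alg_mulC : commutative alg_mul.
Proof.
move=> x y; apply/rowP => l; rewrite !mxE exchange_big /=.
by apply: eq_bigr => i _; apply: eq_bigr => j _; rewrite scC; ring.
Qed.

Lemma alg_mulA : associative alg_mul.
Proof.
move=> x y z; apply/rowP => l; rewrite !mxE.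
transitivity (\sum_i \sum_j \sum_k x 0 i * y 0 j * z 0 k * \sum_m c j k m * c i m l).
  apply: eq_bigr => i _.
  under eq_bigr => m _ do rewrite mxE mulrAC mulr_sumr.
  rewrite exchange_big /=; apply: eq_bigr => j _.
  under eq_bigr => m _ do rewrite mulr_sumr.
  rewrite exchange_big /=; apply: eq_bigr => k _.
  by rewrite mulr_sumr; apply: eq_bigr => m _; ring.
symmetry; under eq_bigr => m _ do under eq_bigr => k _ do
  rewrite mxE mulr_suml mulr_suml.
rewrite exchange_big /=; under eq_bigr => k _ do rewrite exchange_big /=.
rewrite exchange_big /=; apply: eq_bigr => i _.
under eq_bigr => k _ do under eq_bigr => m _ do rewrite mulr_suml mulr_suml.
under eq_bigr => k _ do rewrite exchange_big /=.
rewrite exchange_big /=; apply: eq_bigr => j _; apply: eq_bigr => k _.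
by rewrite -scA mulr_sumr; apply: eq_bigr => m _; ring.
Qed.

Lemma alg_mul1 : left_id alg_one alg_mul.
Proof.
move=> x; apply/rowP => l; rewrite mxE exchange_big /= (bigD1 l) //=.
rewrite [X in _ + X]big1 ?addr0 => [|j jl].
  under eq_bigr => i _ do rewrite mxE mulrAC.
  by rewrite -mulr_suml sc1 eqxx mul1r.
under eq_bigr => i _ do rewrite mxE mulrAC.
by rewrite -mulr_suml sc1 (negbTE jl) mul0r.
Qed.

Lemma alg_mulDl : left_distributive alg_mul +%R.
Proof.
move=> x y z; apply/rowP => l; rewrite !mxE -big_split /=; apply: eq_bigr => i _.
by rewrite -big_split /=; apply: eq_bigr => j _; rewrite !mxE; ring.
Qed.

HB.instance Definition _ := GRing.Zmodule_isComPzRing.Build (alg d)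
  alg_mulA alg_mulC alg_mul1 alg_mulDl.

Definition alg_e (i : 'I_n) : alg d := delta_mx 0 i.

Lemma alg_mulE (x y : alg d) l : (x * y) 0 l = \sum_i \sum_j x 0 i * y 0 j * c i j l.
Proof. by rewrite /GRing.mul /= mxE. Qed.

Lemma alg_oneE l : (1 : alg d) 0 l = u l.
Proof. by rewrite /GRing.one /= mxE. Qed.

Lemma alg_eE i l : alg_e i 0 l = (i == l)%:R.
Proof. by rewrite /alg_e mxE eqxx /= eq_sym. Qed.

Lemma alg_basis (x : alg d) : x = \sum_i x 0 i *: alg_e i.
Proof. exact: row_sum_delta. Qed.

Lemma alg_e_mulE i (x : alg d) l : (alg_e i * x) 0 l = \sum_j x 0 j * c i j l.
Proof.
rewrite alg_mulE (bigD1 i) //= [X in _ + X]big1 ?addr0 => [|k ki].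
  by apply: eq_bigr => j _; rewrite alg_eE eqxx mul1r.
by apply: big1 => j _; rewrite alg_eE eq_sym (negbTE ki) !mul0r.
Qed.

Lemma alg_e_mul i j : alg_e i * alg_e j = \sum_l c i j l *: alg_e l.
Proof.
rewrite [LHS]alg_basis; apply: eq_bigr => l _; congr (_ *: _).
rewrite alg_e_mulE (bigD1 j) //= [X in _ + X]big1 ?addr0 => [|k kj].
  by rewrite alg_eE eqxx mul1r.
by rewrite alg_eE eq_sym (negbTE kj) mul0r.
Qed.

Lemma alg_one_e : (1 : alg d) = \sum_i u i *: alg_e i.
Proof. by rewrite [LHS]alg_basis; apply: eq_bigr => i _; rewrite alg_oneE. Qed.

Lemma alg_scaleAl a (x y : alg d) : a *: (x * y) = a *: x * y.
Proof.
apply/rowP => l; rewrite mxE !alg_mulE mulr_sumr; apply: eq_bigr => i _.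
by rewrite mulr_sumr; apply: eq_bigr => j _; rewrite mxE; ring.
Qed.

Definition alg_C (a : A) : alg d := a *: (1 : alg d).

Lemma alg_CE a x : alg_C a * x = a *: x.
Proof. by rewrite /alg_C -alg_scaleAl mul1r. Qed.

Lemma alg_C_coef a i : alg_C a 0 i = a * u i.
Proof. by rewrite mxE alg_oneE. Qed.

Lemma alg_C_additive : zmod_morphism alg_C.
Proof. by move=> a b; rewrite /alg_C scalerBl. Qed.
Lemma alg_C_multiplicative : monoid_morphism alg_C.
Proof. by split=> [|a b]; rewrite ?alg_CE /alg_C ?scale1r ?scalerA. Qed.

HB.instance Definition _ := GRing.isZmodMorphism.Build A (alg d) alg_C alg_C_additive.
HB.instance Definition _ :=
  GRing.isMonoidMorphism.Build A (alg d) alg_C alg_C_multiplicative.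

Lemma alg_basisC (x : alg d) : x = \sum_i alg_C (x 0 i) * alg_e i.
Proof. by rewrite [LHS]alg_basis; apply: eq_bigr => i _; rewrite alg_CE. Qed.

Lemma alg_sum_row (y : 'I_n -> A) : \sum_i alg_C (y i) * alg_e i = (\row_i y i : alg d).
Proof. by rewrite [RHS]alg_basisC; apply: eq_bigr => i _; rewrite mxE. Qed.

Variable (G : comPzRingType).

Lemma alg_homE (h : {rmorphism alg d -> G}) x :
  h x = \sum_i h (alg_C (x 0 i)) * h (alg_e i).
Proof.
by rewrite {1}[x]alg_basisC rmorph_sum; apply: eq_bigr => i _; rewrite rmorphM.
Qed.

Lemma alg_hom_ext (h h' : {rmorphism alg d -> G}) :
  (forall a, h (alg_C a) = h' (alg_C a)) -> (forall i, h (alg_e i) = h' (alg_e i)) ->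
  h =1 h'.
Proof.
by move=> hC he x; rewrite alg_homE [RHS]alg_homE; apply: eq_bigr => i _; rewrite hC he.
Qed.

Lemma alg_lift (f : {rmorphism A -> G}) (g : 'I_n -> G) :
  (forall i j, g i * g j = \sum_l f (c i j l) * g l) ->
  \sum_i f (u i) * g i = 1 ->
  exists h : {rmorphism alg d -> G},
    [/\ forall x, h x = \sum_i f (x 0 i) * g i,
        forall a, h (alg_C a) = f a & forall i, h (alg_e i) = g i].
Proof.
move=> gM g1; pose h (x : alg d) := \sum_i f (x 0 i) * g i.
have hZ a x : h (a *: x) = f a * h x.
  by rewrite /h mulr_sumr; apply: eq_bigr => i _; rewrite mxE rmorphM mulrA.
have h1 : h 1 = 1.
  by rewrite -[RHS]g1; apply: eq_bigr => i _; rewrite alg_oneE.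
have [||H hE] := @rmorphism_of _ _ h.
- move=> x y; rewrite /h -sumrB; apply: eq_bigr => i _.
  by rewrite !mxE rmorphB mulrBl.
- split=> // x y; rewrite /h mulr_suml.
  under eq_bigr => l _ do rewrite alg_mulE rmorph_sum mulr_suml.
  rewrite exchange_big /=; apply: eq_bigr => i _; rewrite mulr_sumr.
  under eq_bigr => l _ do rewrite rmorph_sum mulr_suml.
  rewrite exchange_big /=; apply: eq_bigr => j _.
  rewrite [RHS]mulrACA gM mulr_sumr; apply: eq_bigr => l _.
  by rewrite !rmorphM mulrA.
exists H; split=> [x|a|i]; rewrite hE //.
  by rewrite /alg_C hZ h1 mulr1.
rewrite /h (bigD1 i) //= [X in _ + X]big1 ?addr0 => [|j ji].
  by rewrite alg_eE eqxx rmorph1 mul1r.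
by rewrite alg_eE eq_sym (negbTE ji) rmorph0 mul0r.
Qed.

End Alg.

Section AlgMap.
Variables (n : nat) (A B : comPzRingType) (f : {rmorphism A -> B}) (d : algdata n A).

Definition alg_map (x : alg d) : alg (map_data f d) := map_mx f x.

Lemma alg_map_additive : zmod_morphism alg_map.
Proof. by move=> x y; apply/rowP => i; rewrite !mxE rmorphB. Qed.

Lemma alg_map_multiplicative : monoid_morphism alg_map.
Proof.
split=> [|x y]; apply/rowP => l; rewrite [LHS]mxE.
  by rewrite !alg_oneE.
rewrite !alg_mulE rmorph_sum; apply: eq_bigr => i _.
by rewrite rmorph_sum; apply: eq_bigr => j _; rewrite !mxE !rmorphM.
Qed.

HB.instance Definition _ :=
  GRing.isZmodMorphism.Build (alg d) (alg (map_data f d)) alg_map alg_map_additive.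
HB.instance Definition _ := GRing.isMonoidMorphism.Build
  (alg d) (alg (map_data f d)) alg_map alg_map_multiplicative.

Lemma alg_map_C a : alg_map (alg_C d a) = alg_C (map_data f d) (f a).
Proof.
by apply/rowP => i; rewrite mxE !alg_C_coef rmorphM.
Qed.

Lemma alg_map_e i : alg_map (alg_e d i) = alg_e (map_data f d) i.
Proof. by apply/rowP => j; rewrite mxE !alg_eE rmorph_nat. Qed.

(** Together with [alg_map_hom_ext] this makes [alg (map_data f d)] the tensor product of [B] and
    [alg d] over [A]: the images of the basis obey the same multiplication table. *)
Lemma alg_pushout (G : comPzRingType) (a : {rmorphism alg d -> G})
    (b : {rmorphism B -> G}) : (forall x, a (alg_C d x) = b (f x)) ->
  exists h : {rmorphism alg (map_data f d) -> G},
    (forall x, h (alg_map x) = a x) /\ (forall y, h (alg_C _ y) = b y).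
Proof.
move=> ab; have [||h [hE hC he]] :=
  @alg_lift _ _ (map_data f d) G b (fun i => a (alg_e d i)).
- move=> i j; rewrite -rmorphM alg_e_mul rmorph_sum; apply: eq_bigr => l _.
  by rewrite -alg_CE rmorphM ab.
- rewrite -(rmorph1 a) alg_one_e rmorph_sum; apply: eq_bigr => l _.
  by rewrite -alg_CE rmorphM ab.
exists h; split=> // x; apply: (@alg_hom_ext _ _ d G (h \o alg_map) a) => [y|i] /=.
  by rewrite alg_map_C hC ab.
by rewrite alg_map_e he.
Qed.

End AlgMap.

Lemma alg_map_hom_ext n (A B G : comPzRingType) (f : {rmorphism A -> B})
    (d : algdata n A) (h h' : {rmorphism alg (map_data f d) -> G}) :
  (forall x, h (alg_map f x) = h' (alg_map f x)) ->
  (forall y, h (alg_C _ y) = h' (alg_C _ y)) -> h =1 h'.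
Proof.
move=> hm hC; apply: alg_hom_ext => // i.
by rewrite -(alg_map_e f d) hm.
Qed.

(** * Sections and morphisms to affine schemes *)

Lemma rmorphism_eq (A B : pzRingType) (f g : {rmorphism A -> B}) : f =1 g -> f = g.
Proof.
case: f g => [f [[fA] [fM]]] [g [[gA] [gM]]] /= /funext fg.
by subst g; rewrite (Prop_irrelevance fA gA) (Prop_irrelevance fM gM).
Qed.

Section DependentFunctions.
Variables (X : Type) (S : X -> Type).

Definition stalk_cast x y (e : x = y) (a : S x) : S y := ecast z (S z) e a.

Lemma extend_point (d : forall z, S z) x (a : S x) : exists s : forall z, S z, s x = a.
Proof.
pose s z := if pselect (x = z) is left e then stalk_cast e a else d z.
exists s; rewrite /s; case: pselect => // e.
by rewrite (Prop_irrelevance e erefl).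
Qed.

End DependentFunctions.

(** The stalks at [f x] and [g x] are different types until the points are identified. Evaluating
    one family [s] at both points compares the stalk maps without a transport; by [extend_point]
    every germ is a value of such a family. *)
Lemma morphism_ext (X Y : locally_ringed_space) (f g : morphism X Y) :
  (forall x, f x = g x) ->
  (forall x (s : forall y : Y, stalk y),
     stalk_map f x (s (f x)) = stalk_map g x (s (g x))) ->
  f = g.
Proof.
case: f g => [f fs fc fl fp] [g gs gc gl gp] /= /funext fg; subst g => h.
have e : fs = gs.
  apply: functional_extensionality_dep => x; apply: rmorphism_eq => a.
  have [s sa] := @extend_point Y (fun y => stalk y) (fun _ => 0) (f x) a.
  by rewrite -sa h.
subst gs; congr Morphism; exact: Prop_irrelevance.
Qed.

Lemma open_preimage (X Y : locally_ringed_space) (f : morphism X Y) (U : set Y) :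
  open U -> open (f @^-1` U).
Proof. by have /continuousP := @mfun_continuous _ _ f; apply. Qed.

Lemma open_local (X : topologicalType) (U : set X) :
  (forall x, U x -> exists O, [/\ open O, O x & O `<=` U]) -> open U.
Proof.
move=> h; rewrite openE => x /h [O [Oo Ox OU]]; rewrite /interior nbhsE.
by exists O.
Qed.

Section Sections.
Variable W : locally_ringed_space.
Implicit Types s t : forall x : W, stalk x.

Lemma section0 (U : set W) : open U -> is_section U (fun x => 0).
Proof.
move=> Uo; apply: (section_ext Uo _ (sectionB Uo (section1 Uo) (section1 Uo))).
by move=> x _; rewrite subrr.
Qed.

Lemma sectionN (U : set W) s : open U -> is_section U s -> is_section U (fun x => - s x).
Proof.
move=> Uo sU; apply: (section_ext Uo _ (sectionB Uo (section0 Uo) sU)).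
by move=> x _; rewrite sub0r.
Qed.

Lemma sectionD (U : set W) s t : open U -> is_section U s -> is_section U t ->
  is_section U (fun x => s x + t x).
Proof.
move=> Uo sU tU; apply: (section_ext Uo _ (sectionB Uo sU (sectionN Uo tU))).
by move=> x _; rewrite opprK.
Qed.

Lemma germ_eq (U V : set W) s t x : open U -> open V -> U x -> V x ->
  is_section U s -> is_section V t -> s x = t x ->
  exists O, [/\ open O, O x, O `<=` U, O `<=` V & forall y, O y -> s y = t y].
Proof.
move=> Uo Vo Ux Vx sU tV e.
have Io : open (U `&` V) by exact: openI.
have sI := section_restrict Uo Io (@subIsetl _ U V) sU.
have tI := section_restrict Vo Io (@subIsetr _ U V) tV.
have [|O [Oo Ox OI h]] := germ_eq0 Io (conj Ux Vx) (sectionB Io sI tI).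
  by rewrite e subrr.
exists O; split=> //.
- by move=> y /OI [].
- by move=> y /OI [].
by move=> y /h /eqP; rewrite subr_eq0 => /eqP.
Qed.

(** The inverse germ at [x] extends to a section nearby whose product with [s] is 1 on a smaller
    neighbourhood; uniqueness of inverses identifies it with the pointwise inverse there. *)
Lemma section_inverse (U : set W) s : open U -> is_section U s ->
  (forall x, U x -> invertible (s x)) -> is_section U (fun x => inverse (s x)).
Proof.
move=> Uo sU inv; apply: section_glue => // x Ux.
have [V [t [Vo Vx tV tx]]] := germ_surj (inverse (s x)).
have Io : open (U `&` V) by exact: openI.
have sI := section_restrict Uo Io (@subIsetl _ U V) sU.
have tI := section_restrict Vo Io (@subIsetr _ U V) tV.
have [|O [Oo Ox OI OU h]] := germ_eq Io Uo (conj Ux Vx) Ux (sectionM Io sI tI) (section1 Uo).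
  by rewrite tx mul_inverse //; exact: inv.
exists O; split=> //.
apply: (section_ext Oo _ (section_restrict Vo Oo _ tV)); last by move=> y /OI [].
move=> y Oy; apply: (@invertible_mulI _ (s y)); first exact/inv/OU.
by rewrite h // mul_inverse //; exact/inv/OU.
Qed.

Lemma open_invertible (U : set W) s : open U -> is_section U s ->
  open (U `&` [set x | invertible (s x)]).
Proof.
move=> Uo sU; apply: open_local => x [Ux [b sb]].
have [V [t [Vo Vx tV tx]]] := germ_surj b.
have Io : open (U `&` V) by exact: openI.
have sI := section_restrict Uo Io (@subIsetl _ U V) sU.
have tI := section_restrict Vo Io (@subIsetr _ U V) tV.
have [|O [Oo Ox OI OU h]] := germ_eq Io Uo (conj Ux Vx) Ux (sectionM Io sI tI) (section1 Uo).
  by rewrite tx.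
exists O; split=> // y Oy; split; first exact: OU.
by exists (t y); rewrite h.
Qed.

Definition global_section : Type :=
  {s : forall x : W, stalk x | is_section setT s}.

HB.instance Definition _ := gen_eqMixin global_section.
HB.instance Definition _ := gen_choiceMixin global_section.

Definition germ_at (x : W) (s : global_section) : stalk x := sval s x.

Lemma global_section_eq (s t : global_section) :
  (forall x, germ_at x s = germ_at x t) -> s = t.
Proof.
case: s t => [s sT] [t tT]; rewrite /germ_at /= => e.
have {}e : s = t by exact: functional_extensionality_dep.
by subst t; rewrite (Prop_irrelevance sT tT).
Qed.

Definition gs0 : global_section := exist _ _ (section0 openT).
Definition gs1 : global_section := exist _ _ (section1 openT).
Definition gsN (s : global_section) : global_section :=
  exist _ _ (sectionN openT (svalP s)).
Definition gsD (s t : global_section) : global_section :=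
  exist _ _ (sectionD openT (svalP s) (svalP t)).
Definition gsM (s t : global_section) : global_section :=
  exist _ _ (sectionM openT (svalP s) (svalP t)).

Lemma gsDA : associative gsD.
Proof. by move=> *; apply: global_section_eq => x; rewrite /germ_at /= addrA. Qed.
Lemma gsDC : commutative gsD.
Proof. by move=> *; apply: global_section_eq => x; rewrite /germ_at /= addrC. Qed.
Lemma gsD0 : left_id gs0 gsD.
Proof. by move=> *; apply: global_section_eq => x; rewrite /germ_at /= add0r. Qed.
Lemma gsDN : left_inverse gs0 gsN gsD.
Proof. by move=> *; apply: global_section_eq => x; rewrite /germ_at /= addNr. Qed.

HB.instance Definition _ := GRing.isZmodule.Build global_section gsDA gsDC gsD0 gsDN.

Lemma gsMA : associative gsM.
Proof. by move=> *; apply: global_section_eq => x; rewrite /germ_at /= mulrA. Qed.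
Lemma gsMC : commutative gsM.
Proof. by move=> *; apply: global_section_eq => x; rewrite /germ_at /= mulrC. Qed.
Lemma gsM1 : left_id gs1 gsM.
Proof. by move=> *; apply: global_section_eq => x; rewrite /germ_at /= mul1r. Qed.
Lemma gsMDl : left_distributive gsM gsD.
Proof. by move=> *; apply: global_section_eq => x; rewrite /germ_at /= mulrDl. Qed.

HB.instance Definition _ := GRing.Zmodule_isComPzRing.Build global_section
  gsMA gsMC gsM1 gsMDl.

Lemma germ_at_additive x : zmod_morphism (germ_at x). Proof. by []. Qed.
Lemma germ_at_multiplicative x : monoid_morphism (germ_at x). Proof. by []. Qed.

HB.instance Definition _ x := GRing.isZmodMorphism.Build global_section (stalk x)
  (germ_at x) (germ_at_additive x).
HB.instance Definition _ x := GRing.isMonoidMorphism.Build global_section (stalk x)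
  (germ_at x) (germ_at_multiplicative x).

End Sections.

Section MorphismsToSpec.
Variables (W : locally_ringed_space) (A : comPzRingType).

(** The germ at [x] of the function [a] pulled back along [f]. These germs determine [f], including
    its effect on points, since [a] lies in the prime [f x] exactly when the germ is not a unit. *)
Definition pull (f : morphism W (Spec_space A)) (x : W) (a : A) : stalk x :=
  stalk_map f x (loc_map (f x) a : @stalk (Spec_space A) (f x)).

Lemma pull_invertible f x a : invertible (pull f x a) <-> ~ (f x : prime_ideal A) a.
Proof.
rewrite -loc_map_invertible; split=> [|h]; first exact: stalk_map_local.
exact: invertible_morph.
Qed.

Lemma spec_hom_ext (f g : morphism W (Spec_space A)) :
  (forall x a, pull f x a = pull g x a) -> f = g.
Proof.
move=> fg; have e x : f x = g x.
  apply: prime_ideal_ext => a; apply: contrapT => h.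
  have := pull_invertible f x a; rewrite fg pull_invertible => e; apply: h.
  by split=> [p|p]; apply: contrapT => /e; exact.
apply: morphism_ext => // x s; move: {e fg}(e x) (fg x); rewrite /pull.
move: (stalk_map f x) (stalk_map g x); move: (f x) (g x) => p q ff gg pq.
case: q / pq gg => gg fg; exact: (@loc_hom_ext A p (stalk x) ff gg fg).
Qed.

Variable h : {rmorphism A -> global_section W}.

Definition gamma_point_set (x : W) : set A := [set a | ~ invertible (germ_at x (h a))].

Lemma gamma_point_prime x : is_prime_ideal (gamma_point_set x).
Proof.
split; first split; rewrite /gamma_point_set /=.
- rewrite !rmorph0 => -[b]; rewrite mul0r => /eqP.
  by rewrite eq_sym oner_eq0.
- by move=> a b ha hb; rewrite !rmorphD => /(@stalk_local W x) [].
- by move=> a b hb; rewrite !rmorphM => /invertibleM [].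
- by apply; rewrite !rmorph1; exact: invertible1.
- move=> a b; rewrite !rmorphM => hab; apply: contrapT => /not_orP[].
  by move=> /contrapT ha /contrapT hb; apply: hab; apply/invertibleM.
Qed.

Definition gamma_point (x : W) : prime_ideal A := PrimeIdeal (gamma_point_prime x).

Lemma gamma_stalk_ex x : exists g : {rmorphism localization (gamma_point x) -> stalk x},
  forall a, g (loc_map (gamma_point x) a) = germ_at x (h a).
Proof.
apply: (@loc_lift A (gamma_point x) _ (@germ_at W x \o h : {rmorphism A -> stalk x})).
by move=> a /= /contrapT.
Qed.

Definition gamma_stalk x := sval (cid (gamma_stalk_ex x)).
Definition gamma_stalkP x : forall a, gamma_stalk x (loc_map (gamma_point x) a) = germ_at x (h a) :=
  svalP (cid (gamma_stalk_ex x)).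

Lemma gamma_stalk_frac x a b (pb : ~ gamma_point x b) :
  gamma_stalk x (frac a pb) = germ_at x (h a) * inverse (germ_at x (h b)).
Proof.
have hb : invertible (germ_at x (h b)) by apply: contrapT.
apply: (@invertible_mulI _ (germ_at x (h b))) => //.
rewrite mulrCA mul_inverse // mulr1 -gamma_stalkP -rmorphM frac_loc_map.
exact: gamma_stalkP.
Qed.

Lemma gamma_preimage_open (U : set (prime_ideal A)) : open U -> open (gamma_point @^-1` U).
Proof.
move=> /zariski_openP hU; apply: open_local => x /hU [a pa aU].
exists (setT `&` [set x | invertible (germ_at x (h a))]); split.
- by apply: open_invertible; [exact: openT | exact: (svalP (h a))].
- by split=> //; exact: contrapT.
by move=> y [_ hy]; apply: aU => /=.
Qed.

(** With [spec_hom_ext] and [pull_hom], this is the adjunction between [Spec] and global sections. A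
    point goes to the functions that are not units in its stalk, and a local fraction [a / b] pulls
    back to [h a] times the inverse of [h b]. *)
Lemma spec_hom_exists : exists f : morphism W (Spec_space A),
  forall x a, pull f x a = germ_at x (h a).
Proof.
unshelve eexists.
  exists (gamma_point : W -> Spec_space A)
   (fun x => gamma_stalk x : {rmorphism @stalk (Spec_space A) (gamma_point x) -> stalk x}).
  - by apply/continuousP => U; exact: gamma_preimage_open.
  - move=> x y; have [a [b [pb ->]]] := frac_surj (y : localization _).
    move=> hx; apply/frac_invertible => /= pa; apply: pa.
    move: hx; rewrite [gamma_stalk x _]gamma_stalk_frac => /invertibleM [] //.
  - move=> U s Uo sU.
    have Po := gamma_preimage_open Uo; apply: section_glue => // x Ux.
    have [V [a [b [Vo Vp VU sV]]]] := sU _ Ux.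
    have Qo := gamma_preimage_open Vo.
    exists (gamma_point @^-1` V); split=> //; first by move=> y; exact: VU.
    have secT c : is_section (gamma_point @^-1` V) (fun x => germ_at x (h c)).
      by apply: (section_restrict openT Qo) => //; exact: (svalP (h c)).
    apply: (section_ext Qo _ (sectionM Qo (secT a) (section_inverse Qo (secT b) _))).
      by move=> y Vy /=; have [qb ->] := sV _ Vy; rewrite [RHS]gamma_stalk_frac.
    by move=> y Vy /=; have [qb _] := sV _ Vy; exact: contrapT.
by move=> x a; exact: gamma_stalkP.
Qed.

End MorphismsToSpec.

Lemma proper_ideal_prime (A : comPzRingType) (I : set A) : is_ideal I -> ~ I 1 ->
  exists p : prime_ideal A, I `<=` p.
Proof.
move=> hI I1; have [|||p [Ip _]] := @exists_prime_avoiding A I [set 1] hI.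
- by [].
- by move=> _ _ -> ->; rewrite mulr1.
- by move=> a Ia /= a1; apply: I1; rewrite -a1.
by exists p.
Qed.

Lemma ideal_span_ideal (A : comPzRingType) n (r : 'I_n -> A) : is_ideal (ideal_span r).
Proof.
split.
- by exists (fun _ => 0); rewrite big1 // => i _; rewrite mul0r.
- move=> _ _ [c ->] [c' ->]; exists (fun i => c i + c' i).
  by rewrite -big_split; apply: eq_bigr => i _; rewrite mulrDl.
- move=> a _ [c ->]; exists (fun i => a * c i).
  by rewrite mulr_sumr; apply: eq_bigr => i _; rewrite mulrA.
Qed.

Lemma ideal_span_mem (A : comPzRingType) n (r : 'I_n -> A) i : ideal_span r (r i).
Proof.
exists (fun j => (j == i)%:R); rewrite (bigD1 i) //= eqxx mul1r big1 ?addr0 // => j.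
by move/negbTE ->; rewrite mul0r.
Qed.

(** A prime that contains all the powers contains all the [f i], hence 1. *)
Lemma partition_unity_pow (A : comPzRingType) n (f : 'I_n -> A) N :
  ideal_span f 1 -> ideal_span (fun i => f i ^+ N) 1.
Proof.
move=> h; apply: contrapT => h'.
have [p pI] := proper_ideal_prime (ideal_span_ideal _) h'.
have [c c1] := h; apply: (@prime_not1 _ p); rewrite c1.
apply: ideal_sum => [|i _]; first exact: prime_is_ideal.
apply: idealMl; first exact: prime_is_ideal.
apply: contrapT => /(@prime_notX _ p _ N); apply; apply: pI.
exact: (ideal_span_mem (fun i => f i ^+ N)).
Qed.

Definition ideal_gen (A : comPzRingType) (E : set A) : set A :=
  [set a | exists n (r : 'I_n -> A), (forall i, E (r i)) /\ ideal_span r a].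

Lemma ideal_gen_ideal (A : comPzRingType) (E : set A) : is_ideal (ideal_gen E).
Proof.
split.
- exists 0, (fun _ => 0); split=> [[]//|]; exact: ideal0 (ideal_span_ideal _).
- move=> a b [n [r [Er [c ->]]]] [m [s [Es [d ->]]]].
  pose glue T (x : 'I_n -> T) (y : 'I_m -> T) (i : 'I_(n + m)) :=
    match fintype.split i with inl j => x j | inr j => y j end.
  exists (n + m)%N, (glue _ r s); split=> [i|]; first by rewrite /glue; case: fintype.split.
  exists (glue _ c d); rewrite big_split_ord /=; congr (_ + _); apply: eq_bigr => i _.
    by rewrite /glue (unsplitK (inl i)).
  by rewrite /glue (unsplitK (inr i)).
- by move=> a b [n [r [Er rb]]]; exists n, r; split=> //; apply: idealMl => //; exact: ideal_span_ideal.
Qed.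

Lemma ideal_gen_mem (A : comPzRingType) (E : set A) a : E a -> ideal_gen E a.
Proof. by exists 1%N, (fun _ => a); split=> //; exact: (ideal_span_mem (fun _ => a) ord0). Qed.

(** * Global sections of an affine scheme and full faithfulness of [Spec] *)

Section GlobalSectionsOfSpec.
Variable A : comPzRingType.

Lemma loc_map_inj (a b : A) :
  (forall p : prime_ideal A, loc_map p a = loc_map p b) -> a = b.
Proof.
move=> h; pose I := [set u | u * (a - b) = 0].
have hI : is_ideal I by exact: annihilator_ideal.
apply: contrapT => ab.
have [|p pI] := proper_ideal_prime hI.
  by rewrite /I /= mul1r => /eqP; rewrite subr_eq0 => /eqP.
have /loc_map_eq[u pu e] := h p; apply: pu; apply: pI.
by rewrite /I /= mulrBr e subrr.
Qed.

Lemma spec_global (s : forall p : prime_ideal A, localization p) :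
  spec_section setT s -> exists a, forall p, s p = loc_map p a.
Proof.
move=> sec.
(* [E] consists of the [f] such that [s] is a single fraction [g / f] on the basic open set of [f].
   It generates the unit ideal because these sets cover the spectrum. *)
pose E := [set f | exists g, forall q : prime_ideal A, ~ q f ->
  loc_map q f * s q = loc_map q g].
have [n [f [Ef fspan]]] : ideal_gen E 1.
  apply: contrapT => h1.
  have [p pE] := proper_ideal_prime (ideal_gen_ideal E) h1.
  have [V [a [b [Vo Vp _ sV]]]] := sec p I.
  have /zariski_openP/(_ p Vp) [c pc cV] := Vo.
  have [pb _] := sV p Vp.
  apply: (prime_notM pc pb); apply: pE; apply: ideal_gen_mem.
  exists (c * a) => q qcb; have qc : ~ q c.
    by move=> qc; apply: qcb; apply: idealMr => //; exact: prime_is_ideal.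
  by have [qb ->] := sV q (cV q qc); rewrite !rmorphM -mulrA frac_loc_map.
have /choice[g gE] : forall i, exists g, forall q : prime_ideal A, ~ q (f i) ->
  loc_map q (f i) * s q = loc_map q g by move=> i; exact: Ef.
(* The two fractions agree wherever [f i * f j] is invertible. If no power of it killed the
   difference, a prime containing the annihilator and missing the powers would contradict this. *)
have cross i j : exists N, (f i * f j) ^+ N * (g i * f j - g j * f i) = 0.
  apply: contrapT => h.
  have [||||p [pI pS]] := @exists_prime_avoiding A
      [set u | u * (g i * f j - g j * f i) = 0] [set x | exists N, x = (f i * f j) ^+ N].
  - exact: annihilator_ideal.
  - by exists 0%N.
  - by move=> _ _ [N ->] [M ->]; exists (N + M)%N; rewrite exprD.
  - by move=> u /= u0 [N uN]; apply: h; exists N; rewrite -uN.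
  have pij : ~ p (f i * f j) by move=> /pS; apply; exists 1%N.
  have [pi pj] : ~ p (f i) /\ ~ p (f j).
    by split=> hp; apply: pij; [apply: idealMr|apply: idealMl] => //; exact: prime_is_ideal.
  have /loc_map_eq[u pu eu] : loc_map p (g i * f j) = loc_map p (g j * f i).
    by rewrite !rmorphM /= -!gE //; ring.
  by apply: pu; apply: pI => /=; rewrite mulrBr eu subrr.
have /choice[N0 crossN0] : forall ij : 'I_n * 'I_n, exists N,
    (f ij.1 * f ij.2) ^+ N * (g ij.1 * f ij.2 - g ij.2 * f ij.1) = 0.
  by move=> [i j]; exact: cross.
pose N := (\max_ij N0 ij)%N.
have crossN i j : (f i * f j) ^+ N * (g i * f j) = (f i * f j) ^+ N * (g j * f i).
  apply/eqP; rewrite -subr_eq0 -mulrBr.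
  have le : (N0 (i, j) <= N)%N by exact: leq_bigmax.
  by rewrite -(subnK le) exprD -mulrA (crossN0 (i, j)) mulr0.
have [c c1] := partition_unity_pow N.+1 fspan.
have key j : f j ^+ N.+1 * (\sum_i c i * (f i ^+ N * g i)) = f j ^+ N * g j.
  rewrite -[RHS]mul1r c1 mulr_sumr mulr_suml; apply: eq_bigr => i _.
  transitivity (c i * ((f i * f j) ^+ N * (g i * f j))).
    by rewrite exprMn exprS; ring.
  by rewrite crossN exprMn exprS; ring.
exists (\sum_i c i * (f i ^+ N * g i)) => q.
have [j qj] : exists j, ~ q (f j).
  apply: contrapT => h; have [d d1] := fspan; apply: (@prime_not1 _ q); rewrite d1.
  apply: ideal_sum => [|i _]; first exact: prime_is_ideal.
  apply: idealMl; first exact: prime_is_ideal.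
  by apply: contrapT => qi; apply: h; exists i.
apply: (@invertible_mulI _ (loc_map q (f j ^+ N.+1))).
  by apply/loc_map_invertible; exact: prime_notX.
transitivity (loc_map q (f j ^+ N) * (loc_map q (f j) * s q)).
  by rewrite exprSr rmorphM mulrA.
by rewrite gE // -!rmorphM key.
Qed.

End GlobalSectionsOfSpec.

Lemma pull_Spec_map (A B : comPzRingType) (f : {rmorphism A -> B})
  (q : prime_ideal B) a :
  pull (Spec_map f) q a = loc_map q (f a) :> localization q.
Proof.
rewrite /pull /=; apply: etrans (localization_mapE _ _) _.
by apply/fracP; exists 1; [exact: prime_not1 | rewrite rmorph1].
Qed.

Lemma pull_comp (X Y : locally_ringed_space) (A : comPzRingType)
    (f : morphism X Y) (g : morphism Y (Spec_space A)) x a :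
  pull (comp_morphism g f) x a = stalk_map f x (pull g (f x) a).
Proof. by []. Qed.

Lemma pull_hom (W : locally_ringed_space) (A : comPzRingType)
    (m : morphism W (Spec_space A)) : exists h : {rmorphism A -> global_section W},
  forall x a, germ_at x (h a) = pull m x a.
Proof.
have sT a : is_section setT (fun w => pull m w a).
  apply: (section_pullback m (U := setT)
    (s := fun p : Spec_space A => loc_map p a : @stalk (Spec_space A) p)).
    exact: openT.
  by apply: spec_section_const; exact: openT.
have [||h hE] := @rmorphism_of A (global_section W) (fun a => exist _ _ (sT a)).
- move=> a b; apply: global_section_eq => x; rewrite rmorphB /germ_at /= /pull.
  by rewrite -rmorphB -[in RHS]rmorphB.
- split=> [|a b]; apply: global_section_eq => x.
    rewrite rmorph1 /germ_at /= /pull -[RHS](rmorph1 (stalk_map m x)).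
    by congr (stalk_map m x _); exact: (rmorph1 (loc_map _)).
  rewrite rmorphM /germ_at /= /pull.
  by rewrite -rmorphM -[in RHS]rmorphM.
by exists h => x a; rewrite hE.
Qed.

Lemma spec_full (A B : comPzRingType) (f : morphism (Spec_space B) (Spec_space A)) :
  exists phi : {rmorphism A -> B}, f = Spec_map phi.
Proof.
have [h hE] := pull_hom f.
have /choice[phi phiE] : forall a, exists b, forall q : prime_ideal B,
    germ_at (q : Spec_space B) (h a) = loc_map q b.
  by move=> a; apply: (@spec_global B (fun q => germ_at (q : Spec_space B) (h a))); exact: svalP (h a).
have [||g gE] := @rmorphism_of _ _ phi.
- move=> a b; apply: loc_map_inj => q.
  by rewrite [RHS]rmorphB /= -!phiE !rmorphB.
- split=> [|a b]; apply: loc_map_inj => q.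
    by rewrite -phiE !rmorph1.
  by rewrite [RHS]rmorphM /= -!phiE !rmorphM.
exists g; apply: spec_hom_ext => q a.
by rewrite [RHS]pull_Spec_map gE -phiE hE.
Qed.

Lemma spec_faithful (A B : comPzRingType) (f g : {rmorphism A -> B}) :
  Spec_map f = Spec_map g -> f =1 g.
Proof.
move=> e a; apply: loc_map_inj => q.
by rewrite -(pull_Spec_map f) e pull_Spec_map.
Qed.

Lemma Spec_map_eq (A B : comPzRingType) (f g : {rmorphism A -> B}) :
  f =1 g -> Spec_map f = Spec_map g.
Proof. by move=> /rmorphism_eq ->. Qed.

Lemma Spec_map_comp (A B C : comPzRingType) (f : {rmorphism A -> B})
    (g : {rmorphism B -> C}) :
  Spec_map (g \o f : {rmorphism A -> C}) = comp_morphism (Spec_map f) (Spec_map g).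
Proof.
apply: spec_hom_ext => q a; rewrite pull_comp !pull_Spec_map /=.
exact/esym/(pull_Spec_map g q (f a)).
Qed.

Lemma Spec_map_id (A : comPzRingType) (f : {rmorphism A -> A}) :
  f =1 id -> Spec_map f = id_morphism (Spec_space A).
Proof. by move=> fid; apply: spec_hom_ext => q a; rewrite pull_Spec_map fid. Qed.

Lemma comp_morphismA (X Y Z W : locally_ringed_space) (h : morphism Z W)
    (g : morphism Y Z) (f : morphism X Y) :
  comp_morphism h (comp_morphism g f) = comp_morphism (comp_morphism h g) f.
Proof. exact: morphism_ext. Qed.

Lemma comp_morphism1 (X Y : locally_ringed_space) (f : morphism X Y) :
  comp_morphism f (id_morphism X) = f.
Proof. exact: morphism_ext. Qed.

Lemma comp_1morphism (X Y : locally_ringed_space) (f : morphism X Y) :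
  comp_morphism (id_morphism Y) f = f.
Proof. exact: morphism_ext. Qed.

(** * Open immersions, fibre products and separatedness *)

Lemma stalk_map_eq (X Y : locally_ringed_space) (f g : morphism X Y) :
  f = g -> forall x (s : forall y : Y, stalk y),
  stalk_map f x (s (f x)) = stalk_map g x (s (g x)).
Proof. by move=> ->. Qed.

Lemma mfun_eq (X Y : locally_ringed_space) (f g : morphism X Y) :
  f = g -> forall x, f x = g x.
Proof. by move=> ->. Qed.

Lemma extend_germ (Y : locally_ringed_space) (y : Y) (a : stalk y) :
  exists s : forall z : Y, stalk z, s y = a.
Proof. exact: (@extend_point Y (fun z => stalk z) (fun _ => 0)). Qed.

Lemma rmorphism_inv (A B : pzRingType) (f : {rmorphism A -> B}) : bijective f ->
  exists g : {rmorphism B -> A}, cancel f g /\ cancel g f.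
Proof.
move=> [g fg gf]; have [||h hg] := @rmorphism_of _ _ g.
- by move=> x y; apply: (can_inj fg); rewrite rmorphB !gf.
- split=> [|x y]; apply: (can_inj fg); first by rewrite gf rmorph1.
  by rewrite rmorphM !gf.
by exists h; split=> x; rewrite hg.
Qed.

Lemma open_immersion_mono (W U Y : locally_ringed_space) (j : morphism U Y)
    (h h' : morphism W U) : open_immersion j -> j \om h = j \om h' -> h = h'.
Proof.
move=> [jinj _ jbij] e.
have hh x : h x = h' x by apply: jinj; exact: (mfun_eq e x).
apply: morphism_ext => // x s.
have [g gK Kg] := jbij (h x); have [t tE] := extend_germ (g (s (h x))).
have P : stalk_map j (h x) (t (j (h x))) = s (h x) by rewrite tE Kg.
have P' : stalk_map j (h' x) (t (j (h' x))) = s (h' x) by rewrite -hh.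
have := stalk_map_eq e x t; rewrite /= -/(mfun j) -/(mfun h).
by rewrite P P'.
Qed.

Lemma open_immersion_factor (X U Y : locally_ringed_space) (j : morphism U Y)
    (f : morphism X Y) : open_immersion j -> (forall x, range j (f x)) ->
  exists h : morphism X U, j \om h = f.
Proof.
move=> [jinj jopen jbij] jf.
have /choice[h0 he] : forall x, exists u, j u = f x.
  by move=> x; have [u _ <-] := jf x; exists u.
(* The stalk map of the factor is that of [f] after the inverse of that of [j]. Elimination of
   [j (h0 x) = f x] is possible once the stalk map of [f] is generalized. *)
have gex : forall x, exists g : {rmorphism stalk (h0 x) -> stalk x},
    forall s : forall y : Y, stalk y,
    g (stalk_map j (h0 x) (s (j (h0 x)))) = stalk_map f x (s (f x)).
  move=> x; move: (stalk_map f x); case: _ / (he x) => ff.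
  have [g [jg gj]] := rmorphism_inv (jbij (h0 x)).
  by exists (ff \o g : {rmorphism _ -> _}) => s /=; rewrite jg.
pose g x := sval (cid (gex x)).
have gE x (s : forall y : Y, stalk y) :
    g x (stalk_map j (h0 x) (s (j (h0 x)))) = stalk_map f x (s (f x)).
  exact: (svalP (cid (gex x))).
have preo (V : set U) : open V -> open (h0 @^-1` V).
  move=> Vo; have -> : h0 @^-1` V = f @^-1` (j @` V).
    apply/seteqP; split=> x /=; first by move=> Vx; exists (h0 x).
    by move=> [u Vu ju]; have <- : u = h0 x by apply: jinj; rewrite he.
  by apply: open_preimage; exact: jopen.
unshelve eexists.
  exists h0 g.
  - by apply/continuousP.
  - move=> x a ga; have [b bK Kb] := jbij (h0 x).
    have [s sE] := extend_germ (b a).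
    have e : stalk_map j (h0 x) (s (j (h0 x))) = a by rewrite sE Kb.
    move: ga; rewrite -{1}e gE => /stalk_map_local; rewrite -(he x) => inv.
    by rewrite -e; exact: invertible_morph.
  (* Near each point, [s] is the pullback along [j] of a section [t] of [Y], so its image is the
     pullback of [t] along [f]. *)
  - move=> V s Vo sV; have Po := preo V Vo; apply: section_glue => // x Vx.
    have [b bK Kb] := jbij (h0 x).
    have [U' [t [Uo Ux tU tx]]] := germ_surj (b (s (h0 x))).
    have [|O [Oo Ox OV OU h]] :=
      germ_eq Vo (open_preimage j Uo) Vx Ux sV (section_pullback j Uo tU).
      by rewrite tx Kb.
    exists (h0 @^-1` O); split=> //; first exact: preo.
      by move=> y; exact: OV.
    have Ho := preo O Oo.
    apply: (section_ext Ho _ (section_restrict (open_preimage f Uo) Ho _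
      (section_pullback f Uo tU))) => [y Oy|y Oy].
      by rewrite h // gE.
    by rewrite /preimage /= -he; exact: OU.
by apply: morphism_ext => [x|x s] /=; [exact: he | exact: gE].
Qed.

Lemma open_immersion_surj_iso (U Y : locally_ringed_space) (i : morphism U Y) :
  open_immersion i -> (forall y, range i y) ->
  exists h : morphism Y U, i \om h = id_morphism Y /\ h \om i = id_morphism U.
Proof.
move=> hi isurj.
have [h ih] := @open_immersion_factor _ _ _ i (id_morphism Y) hi isurj.
exists h; split=> //; apply: (open_immersion_mono hi).
by rewrite comp_morphismA ih comp_1morphism comp_morphism1.
Qed.

Definition mono (X Y : locally_ringed_space) (e : morphism X Y) : Prop :=
  forall (W : scheme) (h h' : morphism W X), e \om h = e \om h' -> h = h'.

Lemma section_mono (X Y : locally_ringed_space) (e : morphism X Y) (r : morphism Y X) :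
  r \om e = id_morphism X -> mono e.
Proof.
move=> re W h h' eh; rewrite -[h]comp_1morphism -[h']comp_1morphism -re.
by rewrite -!comp_morphismA eh.
Qed.

Lemma prime_field (K : fieldType) (p : prime_ideal K) x : p x <-> x = 0.
Proof.
split=> [px|->]; last exact: ideal0 (prime_is_ideal p).
apply: contrapT => /eqP x0; apply: (@prime_not1 _ p).
by rewrite -(mulVf x0); apply: idealMl px; exact: prime_is_ideal.
Qed.

Lemma point_field_ex (K : fieldType) : exists p : prime_ideal K, True.
Proof.
have [|p _] := proper_ideal_prime (zero_ideal K); last by exists p.
by move=> /eqP; rewrite oner_eq0.
Qed.

Lemma point_field_eq (K : fieldType) (p q : prime_ideal K) : p = q.
Proof. by apply: prime_ideal_ext => a; rewrite !prime_field. Qed.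

Lemma loc_field_eq0 (K : fieldType) (p : prime_ideal K) (x : localization p) :
  ~ invertible x -> x = 0.
Proof.
have [a [b [pb ->]]] := frac_surj x.
rewrite frac_invertible => /contrapT /prime_field ->.
by rewrite -frac0; apply: frac_eq; rewrite !mul0r.
Qed.

(** * Fibre products of schemes *)

Section FibreProducts.
Variables (S X Y P : scheme) (f : morphism X S) (g : morphism Y S).
Variables (p1 : morphism P X) (p2 : morphism P Y).
Hypothesis hP : is_fibre_product f g p1 p2.

Lemma fibre_product_hom_ext (W : scheme) (h h' : morphism W P) :
  p1 \om h = p1 \om h' -> p2 \om h = p2 \om h' -> h = h'.
Proof.
move=> e1 e2; have [sq un] := hP.
have [|m [_ mU]] := un W (p1 \om h) (p2 \om h); first by rewrite !comp_morphismA sq.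
by rewrite -(mU h) //; apply: mU.
Qed.

Lemma fibre_product_unique (P' : scheme) (q1 : morphism P' X) (q2 : morphism P' Y) :
  is_fibre_product f g q1 q2 ->
  exists (r : morphism P' P) (s : morphism P P'),
    [/\ r \om s = id_morphism P, s \om r = id_morphism P',
        p1 \om r = q1 & p2 \om r = q2].
Proof.
move=> hP'; have [sq un] := hP; have [sq' un'] := hP'.
have [r [[r1 r2] _]] := un P' q1 q2 sq'; have [s [[s1 s2] _]] := un' P p1 p2 sq.
exists r, s; split=> //.
  by apply: fibre_product_hom_ext; rewrite comp_morphismA (r1, r2) (s1, s2) comp_morphism1.
have [|m [_ mU]] := un' P' q1 q2; first by [].
rewrite -(mU (s \om r)) //; last by rewrite !comp_morphismA s1 s2.
by apply: mU; rewrite !comp_morphism1.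
Qed.

Lemma fibre_product_iso (P' : scheme) (r : morphism P' P) (s : morphism P P') :
  r \om s = id_morphism P -> s \om r = id_morphism P' ->
  is_fibre_product f g (p1 \om r) (p2 \om r).
Proof.
move=> rs sr; have [sq un] := hP; split; first by rewrite !comp_morphismA sq.
move=> W a b ab; have [h [[h1 h2] hU]] := un W a b ab.
exists (s \om h); split.
  by rewrite -!comp_morphismA (comp_morphismA r) rs comp_1morphism.
move=> m [m1 m2]; rewrite (hU (r \om m)) ?comp_morphismA ?sr ?comp_1morphism //.
Qed.

Lemma fibre_product_left_iso (X' : scheme) (r : morphism X X') (s : morphism X' X) :
  r \om s = id_morphism X' -> s \om r = id_morphism X ->
  is_fibre_product (f \om s) g (r \om p1) p2.
Proof.
move=> rs sr; have [sq un] := hP; split.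
  by rewrite -comp_morphismA (comp_morphismA s) sr comp_1morphism.
move=> W a b ab; have [|h [[h1 h2] hU]] := un W (s \om a) b.
  by rewrite comp_morphismA.
exists h; split; first by rewrite -comp_morphismA h1 comp_morphismA rs comp_1morphism.
move=> m [m1 m2]; apply: hU; split=> //.
by rewrite -m1 -comp_morphismA (comp_morphismA s) sr comp_1morphism.
Qed.

End FibreProducts.

(* A point of the fibre product at which the two projections agree on functions lies on
   the diagonal, because the spectrum of its residue field factors through it. *)
Lemma separated_of_mono (X S : scheme) (C : comPzRingType)
    (e : morphism X (Spec C)) (sX : morphism X S) : mono e -> separated_morphism sX.
Proof.
move=> emono P p1 p2 [pP pU] d d1 d2.
have p1d x : p1 (d x) = x by exact: (mfun_eq d1 x).
have p2d x : p2 (d x) = x by exact: (mfun_eq d2 x).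
split.
- by move=> x y dxy; rewrite -(p1d x) dxy p1d.
- move=> Z Zc; rewrite -openC; apply: open_local => z nz.
  have [pz|pz] := pselect (Z (p1 z)); last first.
    exists (p1 @^-1` (~` Z)); split=> //.
      by apply: open_preimage; rewrite openC.
    by move=> w /= hw [x Zx dx]; apply: hw; rewrite -dx p1d.
  pose sg c (w : P) : stalk w := pull (e \om p1) w c - pull (e \om p2) w c.
  have sec c : is_section setT (sg c).
    have [h1 h1E] := pull_hom (e \om p1); have [h2 h2E] := pull_hom (e \om p2).
    apply: (section_ext openT _ (svalP (h1 c - h2 c))) => w _.
    by rewrite /sg -h1E -h2E -[LHS](rmorphB (@germ_at P w)).
  have sgd c x : stalk_map d x (sg c (d x)) = 0.
    rewrite /sg rmorphB -!pull_comp -!comp_morphismA d1 d2 comp_morphism1.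
    exact: subrr.
  (* A difference [sg c] vanishes along the diagonal, so the neighbourhood of [z] on which it stays
     a unit misses the diagonal. Without such a [c] the two projections agree on the residue field
     of [z]. *)
  have [[c hc]|h] := pselect (exists c, invertible (sg c z)).
    exists (setT `&` [set w | invertible (sg c w)]); split=> //.
      by apply: open_invertible; [exact: openT | exact: sec].
    move=> w [_ hw] [x Zx dx]; move: hw; rewrite -dx /=.
    move=> /(invertible_morph (stalk_map d x)); rewrite sgd => -[b].
    by rewrite mul0r => /eqP; rewrite eq_sym oner_eq0.
  exfalso; apply: nz.
  have [A0 [j [hj [q _ jq]]]] := schemeP z.
  have [K [ka [ka0 _]]] := residue_field (q : prime_ideal A0).
  have [o _] := point_field_ex K.
  have [ze zeo] : exists ze : morphism (Spec K) P, forall w, ze w = z.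
    exists (j \om Spec_map ka) => w; rewrite -jq /=; congr (j _); apply: prime_ideal_ext => a.
    by rewrite -ka0; exact: (prime_field w (ka a)).
  have pz' : p1 \om ze = p2 \om ze.
    apply: (emono (Spec K)); rewrite !comp_morphismA; apply: spec_hom_ext => w c.
    rewrite !pull_comp; apply/eqP; rewrite -subr_eq0 -rmorphB; apply/eqP.
    apply: (@loc_field_eq0 K w).
    move=> hinv; have : invertible (sg c (ze w)) :=
      @stalk_map_local (Spec K) P ze w (sg c (ze w)) hinv.
    by rewrite zeo => hw; apply: h; exists c.
  have zd : ze = d \om (p1 \om ze).
    apply: (fibre_product_hom_ext (conj pP pU)) => //.
      by rewrite [RHS]comp_morphismA d1 comp_1morphism.
    by rewrite [RHS]comp_morphismA d2 comp_1morphism pz'.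
  exists (p1 z) => //; rewrite -(zeo o) {2}zd /=.
  by congr (d _).
- move=> x a; have [s sE] := extend_germ a.
  exists (stalk_map p1 (d x) (s (p1 (d x)))).
  by rewrite -sE; exact: (stalk_map_eq d1 x s).
Qed.

(** A pushout of rings gives a fibre product tested against all schemes, not only affine ones: maps
    from [W] to affine schemes are ring maps into the global sections of [W]. *)
Lemma affine_fibre_product (A B D G : comPzRingType) (f : {rmorphism A -> B})
    (g : {rmorphism A -> D}) (b : {rmorphism B -> G}) (d : {rmorphism D -> G}) :
  (forall a, b (f a) = d (g a)) ->
  (forall (Q : comPzRingType) (b' : {rmorphism B -> Q}) (d' : {rmorphism D -> Q}),
     (forall a, b' (f a) = d' (g a)) -> exists h : {rmorphism G -> Q},
     (forall x, h (b x) = b' x) /\ (forall y, h (d y) = d' y)) ->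
  (forall (Q : comPzRingType) (h h' : {rmorphism G -> Q}),
     (forall x, h (b x) = h' (b x)) -> (forall y, h (d y) = h' (d y)) -> h =1 h') ->
  is_fibre_product (Spec_map f : morphism (Spec B) (Spec A))
    (Spec_map g : morphism (Spec D) (Spec A))
    (Spec_map b : morphism (Spec G) (Spec B)) (Spec_map d : morphism (Spec G) (Spec D)).
Proof.
move=> bd push pushU; split.
  by rewrite -!Spec_map_comp; apply: Spec_map_eq => a /=.
move=> W x y xy.
have [hx hxE] := pull_hom x; have [hy hyE] := pull_hom y.
have pcS (E E' : comPzRingType) (phi : {rmorphism E -> E'}) (m : morphism W (Spec E')) w c :
    pull (Spec_map phi \om m) w c = pull m w (phi c).
  rewrite pull_comp pull_Spec_map //.
have [|h [hb hd]] := push _ hx hy.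
  move=> a; apply: global_section_eq => w; rewrite hxE hyE.
  by rewrite -(pcS _ _ f x) -(pcS _ _ g y) xy.
have [m mE] := spec_hom_exists h.
exists m; split.
  by split; apply: spec_hom_ext => w c; rewrite pcS mE (hb, hd) (hxE, hyE).
move=> m' [mx my]; have [h' hE'] := pull_hom m'.
apply: spec_hom_ext => w c; rewrite mE -hE'; congr (germ_at w _).
apply: pushU => c'; apply: global_section_eq => w'.
  by rewrite hb hE' hxE -mx pcS.
by rewrite hd hE' hyE -my pcS.
Qed.

(** * Noetherian rings *)

Lemma ideal_span_subset (A : comPzRingType) n (r : 'I_n -> A) (I : set A) :
  is_ideal I -> (forall i, I (r i)) -> ideal_span r `<=` I.
Proof.
move=> hI hr _ [c ->]; apply: ideal_sum => // i _.
exact: idealMl.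
Qed.

Lemma ideal_gen_subset (A : comPzRingType) (E I : set A) :
  is_ideal I -> E `<=` I -> ideal_gen E `<=` I.
Proof.
move=> hI EI a [n [r [Er ra]]]; apply: ideal_span_subset ra => // i.
exact: EI.
Qed.

Lemma fg_ideal_of_seq (A : comPzRingType) (I : set A) (l : seq A) : is_ideal I ->
  (forall a, a \in l -> I a) -> (forall a, I a -> ideal_gen [set x | x \in l] a) ->
  exists n (r : 'I_n -> A), I = ideal_span r.
Proof.
move=> hI lI Il; exists (size l), (fun i => l`_i); apply/seteqP; split.
  move=> a /Il; apply: ideal_gen_subset; first exact: ideal_span_ideal.
  move=> x /= xl; have ix : (index x l < size l)%N by rewrite index_mem.
  by have := ideal_span_mem (fun i : 'I_(size l) => l`_i) (Ordinal ix); rewrite /= nth_index.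
by apply: ideal_span_subset => // i; apply/lI/mem_nth.
Qed.

Lemma noetherian_surj (A B : comPzRingType) (f : {rmorphism A -> B}) :
  (forall b, exists a, f a = b) -> is_noetherian_ring A -> is_noetherian_ring B.
Proof.
move=> fs nA I hI; have [|n [r e]] := nA (f @^-1` I).
  split=> [|a b|a b]; rewrite /preimage /= ?rmorph0 ?rmorphD ?rmorphM.
  - exact: ideal0.
  - exact: idealD.
  - exact: idealMl.
exists n, (f \o r); apply/seteqP; split=> b; last first.
  apply: ideal_span_subset => // i /=.
  have : (f @^-1` I) (r i) by rewrite e; exact: ideal_span_mem.
  by [].
have [a <-] := fs b => Ia; have : (f @^-1` I) a by [].
rewrite e => -[c ->]; exists (f \o c); rewrite rmorph_sum.
by apply: eq_bigr => i _; rewrite rmorphM.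
Qed.

Lemma noetherian_field (K : fieldType) : is_noetherian_ring K.
Proof.
move=> I hI; have [h|h] := pselect (exists2 x, I x & x != 0).
  have [x Ix x0] := h; apply: (@fg_ideal_of_seq _ _ [:: x]) => //.
    by move=> a; rewrite inE => /eqP ->.
  move=> a _; have -> : a = a * x^-1 * x by rewrite mulfVK.
  by apply: idealMl; [exact: ideal_gen_ideal | apply: ideal_gen_mem; rewrite /= inE].
apply: (@fg_ideal_of_seq _ _ [::]) => // a Ia.
have -> : a = 0 by apply: contrapT => /eqP a0; apply: h; exists a.
exact: ideal0 (ideal_gen_ideal _).
Qed.

Section HilbertBasis.
Variables (A : comNzRingType) (nA : is_noetherian_ring A).
Variables (I : set {poly A}) (hI : is_ideal I).

Let G (l : seq {poly A}) := ideal_gen [set x | x \in l].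

Lemma poly_gen_sub l l' : {subset l <= l'} -> G l `<=` G l'.
Proof.
move=> ll'; apply: ideal_gen_subset; first exact: ideal_gen_ideal.
by move=> x /= xl; apply: ideal_gen_mem => /=; exact: ll'.
Qed.

Lemma size_sub_lead (f g : {poly A}) d :
  (size f <= d.+1)%N -> (size g <= d.+1)%N -> f`_d = g`_d -> (size (f - g)%R <= d)%N.
Proof.
move=> sf sg e; apply/leq_sizeP => j; rewrite leq_eqVlt => /orP[/eqP <-|dj].
  by rewrite coefB e subrr.
by rewrite coefB !nth_default ?subrr //; [apply: leq_trans sg _|apply: leq_trans sf _].
Qed.

(** The coefficients of degree [d] of the members of [I] of degree at most [d] form an ideal of [A].
    Lifts of its generators lower the degree below [d], where the induction hypothesis applies. *)
Lemma poly_ideal_low_degree d : exists l : seq {poly A},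
  (forall f, f \in l -> I f) /\ forall f, I f -> (size f <= d)%N -> G l f.
Proof.
elim: d => [|d [l [lI lG]]].
  exists [::]; split=> // f _; rewrite leqn0 size_poly_eq0 => /eqP ->.
  exact: ideal0 (ideal_gen_ideal _).
pose L := [set a | exists f, [/\ I f, (size f <= d.+1)%N & f`_d = a]].
have [|n [r e]] := nA (I := L).
  split.
  - by exists 0; split; rewrite ?size_poly0 ?coef0 //; exact: ideal0.
  - move=> _ _ [f [If sf <-]] [g [Ig sg <-]]; exists (f + g); split.
    + exact: idealD.
    + by apply: leq_trans (size_polyD _ _) _; rewrite geq_max sf.
    + by rewrite coefD.
  - move=> a _ [f [If sf <-]]; exists (a%:P * f); split; last by rewrite coefCM.
      exact: idealMl.
    by rewrite mul_polyC; apply: leq_trans (size_scale_leq _ _) sf.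
have /choice[g gP] : forall i, exists f, [/\ I f, (size f <= d.+1)%N & f`_d = r i].
  by move=> i; have : L (r i) by rewrite e; exact: ideal_span_mem.
exists (l ++ codom g); split.
  move=> f; rewrite mem_cat => /orP[/lI //|/codomP[i ->]].
  by have [] := gP i.
move=> f If sf; have : L f`_d by exists f.
rewrite e => -[c ec].
pose s := \sum_i (c i)%:P * g i.
have Is : I s.
  by apply: ideal_sum => // i _; apply: idealMl => //; have [] := gP i.
rewrite -[f](subrK s); apply: idealD; first exact: ideal_gen_ideal.
  apply: (@poly_gen_sub l); first by move=> x xl; rewrite mem_cat xl.
  apply: lG; first exact: idealB.
  apply: size_sub_lead => //.
    apply: leq_trans (size_sum _ _ _) _; apply/bigmax_leqP => i _.
    rewrite mul_polyC; apply: leq_trans (size_scale_leq _ _) _.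
    by have [] := gP i.
  rewrite ec coef_sum; apply: eq_bigr => i _; rewrite coefCM.
  by have [_ _ ->] := gP i.
apply: ideal_sum => [|i _]; first exact: ideal_gen_ideal.
apply: idealMl; first exact: ideal_gen_ideal.
by apply: ideal_gen_mem => /=; rewrite mem_cat codom_f orbT.
Qed.

(** Hilbert's basis theorem. Lifts of generators of the ideal [L] of leading coefficients reduce
    every degree from [D] on; [poly_ideal_low_degree] takes care of the members of lower degree. *)
Lemma poly_ideal_fg : exists n (r : 'I_n -> {poly A}), I = ideal_span r.
Proof.
(* The inequality on the size lets the coefficient be 0, which is needed for [L] to be closed under
   addition. *)
pose L := [set a | exists f k, [/\ I f, (size f <= k.+1)%N & f`_k = a]].
have shift (f : {poly A}) k m : (size f <= k.+1)%N -> (size (f * 'X^m)%R <= (k + m).+1)%N.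
  move=> sf; apply: leq_trans (size_polyMleq _ _) _.
  by rewrite size_polyXn addnS /= -addSn leq_add2r.
have [|n [r e]] := nA (I := L).
  split.
  - by exists 0, 0%N; split; rewrite ?size_poly0 ?coef0 //; exact: ideal0.
  - move=> _ _ [f [k [If sf <-]]] [g [m [Ig sg <-]]].
    exists (f * 'X^m + g * 'X^k), (k + m)%N; split.
    + by apply: idealD => //; apply: idealMr.
    + apply: leq_trans (size_polyD _ _) _; rewrite geq_max shift //.
      by rewrite addnC shift.
    + by rewrite coefD !coefMXn ltnNge leq_addl ltnNge leq_addr /= addnK addnC addnK.
  - move=> a _ [f [k [If sf <-]]]; exists (a%:P * f), k; split; last by rewrite coefCM.
      exact: idealMl.
    by rewrite mul_polyC; apply: leq_trans (size_scale_leq _ _) sf.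
have /choice[gk gkP] : forall i, exists fk : {poly A} * nat,
    [/\ I fk.1, (size fk.1 <= fk.2.+1)%N & fk.1`_fk.2 = r i].
  move=> i; have : L (r i) by rewrite e; exact: ideal_span_mem.
  by move=> [f [k h]]; exists (f, k).
(* Multiplication by powers of the variable brings all the lifts to the common degree [D]. *)
pose D := (\max_i (gk i).2)%N.
pose g i := (gk i).1 * 'X^(D - (gk i).2).
have gP i : [/\ I (g i), (size (g i) <= D.+1)%N & (g i)`_D = r i].
  have [Ig sg cg] := gkP i; have le : ((gk i).2 <= D)%N by exact: (leq_bigmax i).
  split; first exact: idealMr.
    by have := shift _ _ (D - (gk i).2)%N sg; rewrite subnKC.
  by rewrite coefMXn ltnNge leq_subr /= subKn.
have [l [lI lG]] := poly_ideal_low_degree D.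
apply: (@fg_ideal_of_seq _ _ (l ++ codom g)) => //.
  move=> f; rewrite mem_cat => /orP[/lI //|/codomP[i ->]].
  by have [] := gP i.
move=> f If; have [m] := ubnP (size f); elim: m => // m IH in f If *.
rewrite ltnS => sf; have [sD|sD] := leqP (size f) D.
  apply: (@poly_gen_sub l); first by move=> x xl; rewrite mem_cat xl.
  exact: lG.
case: m => [|m] in IH sf *; first by have := leq_trans sD sf.
have Dm : (D <= m)%N by rewrite -ltnS; exact: leq_trans sf.
have : L f`_m by exists f, m.
rewrite e => -[c ec].
pose s := \sum_i ((c i)%:P * 'X^(m - D)) * g i.
have Is : I s.
  by apply: ideal_sum => // i _; apply: idealMl => //; have [] := gP i.
rewrite -[f](subrK s); apply: idealD; first exact: ideal_gen_ideal.
  apply: IH; first exact: idealB.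
  rewrite ltnS; apply: size_sub_lead => //.
    apply: leq_trans (size_sum _ _ _) _; apply/bigmax_leqP => i _.
    rewrite -mulrA mul_polyC; apply: leq_trans (size_scale_leq _ _) _.
    by have [_ sg _] := gP i; have := shift _ _ (m - D)%N sg; rewrite mulrC subnKC.
  rewrite ec coef_sum; apply: eq_bigr => i _; rewrite -mulrA coefCM; congr (_ * _).
  rewrite mulrC coefMXn ltnNge leq_subr /= subKn //.
  by have [_ _ ->] := gP i.
apply: ideal_sum => [|i _]; first exact: ideal_gen_ideal.
apply: idealMl; first exact: ideal_gen_ideal.
by apply: ideal_gen_mem => /=; rewrite mem_cat codom_f orbT.
Qed.

End HilbertBasis.

Lemma noetherian_poly (A : comNzRingType) :
  is_noetherian_ring A -> is_noetherian_ring {poly A}.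
Proof. by move=> nA I hI; exact: poly_ideal_fg. Qed.

(* Finite generation as an algebra, phrased as an induction principle. *)
Definition alg_generated (F S : comPzRingType) (f : {rmorphism F -> S}) n
    (x : 'I_n -> S) : Prop :=
  forall P : set S, (forall a, P (f a)) -> (forall i, P (x i)) ->
  (forall a b, P a -> P b -> P (a + b)) -> (forall a b, P a -> P b -> P (a * b)) ->
  forall s, P s.

(** Variables are adjoined one at a time, the form in which the univariate basis theorem can be
    iterated. *)
Fixpoint iter_poly (A : comNzRingType) n : comNzRingType :=
  if n is n'.+1 then iter_poly {poly A} n' else A.

Lemma noetherian_iter_poly n (A : comNzRingType) :
  is_noetherian_ring A -> is_noetherian_ring (iter_poly A n).
Proof. by elim: n A => //= n IH A /noetherian_poly /IH. Qed.

Lemma iter_poly_hom n (A S : comNzRingType) (f : {rmorphism A -> S}) (x : 'I_n -> S) :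
  exists h : {rmorphism iter_poly A n -> S},
  (forall a, exists p, h p = f a) /\ forall i, exists p, h p = x i.
Proof.
elim: n => [|n IH] /= in A f x *; first by exists f; split=> [a|[]//]; exists a.
have cfu : commr_rmorph f (x ord0) by move=> a; exact: mulrC.
have [h [hf hx]] := IH {poly A} (horner_morph cfu) (fun i => x (lift ord0 i)).
exists h; split=> [a|i].
  by have [p pa] := hf a%:P; exists p; rewrite pa; exact: horner_morphC.
have [j ->|->] := unliftP ord0 i; first exact: hx.
by have [p pX] := hf 'X; exists p; rewrite pX; exact: horner_morphX.
Qed.

(** [finitely_presented_hom] and [iter_poly_hom] ask for a nonzero target; this copy of [B] carries
    a proof of [1 != 0] in its type. *)
Section NonzeroRing.
Variables (B : comPzRingType) (hB : (1 : B) != 0).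
Definition nonzero_ring of (1 : B) != 0 : Type := B.
HB.instance Definition _ := GRing.ComPzRing.on (nonzero_ring hB).
HB.instance Definition _ := GRing.PzSemiRing_isNonZero.Build (nonzero_ring hB) hB.

Lemma nonzero_ring_iso : exists (f : {rmorphism B -> nonzero_ring hB})
  (g : {rmorphism nonzero_ring hB -> B}), cancel f g /\ cancel g f.
Proof. by exists (idfun : {rmorphism B -> B}), (idfun : {rmorphism B -> B}). Qed.

End NonzeroRing.

Lemma trivial_ring_eq (B : comPzRingType) (x y : B) : (1 : B) = 0 -> x = y.
Proof. by move=> e; rewrite -[x]mul1r -[y]mul1r e !mul0r. Qed.

Lemma noetherian_generated (F : comNzRingType) (S : comPzRingType)
    (f : {rmorphism F -> S}) n (x : 'I_n -> S) :
  alg_generated f x -> is_noetherian_ring F -> is_noetherian_ring S.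
Proof.
move=> gen nF; have [e|nz] := eqVneq (1 : S) 0.
  move=> I hI; exists 0%N, (fun _ => 0); apply/seteqP; split=> y _.
    by rewrite (trivial_ring_eq y 0 e); exact: ideal0 (ideal_span_ideal _).
  by rewrite (trivial_ring_eq y 0 e); exact: ideal0 hI.
have [g [g' [gK Kg]]] := nonzero_ring_iso nz.
have [h [hf hx]] := iter_poly_hom (g \o f : {rmorphism F -> nonzero_ring nz}) (g \o x).
apply: (@noetherian_surj _ _ (g' \o h : {rmorphism iter_poly F n -> S})); last first.
  exact: noetherian_iter_poly.
apply: gen => [a|i|_ _ [p <-] [q <-]|_ _ [p <-] [q <-]].
- by have [p pa] := hf a; exists p; rewrite /= pa gK.
- by have [p pa] := hx i; exists p; rewrite /= pa /= gK.
- by exists (p + q); rewrite rmorphD.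
- by exists (p * q); rewrite rmorphM.
Qed.

Lemma alg_generated_alg (F A : comPzRingType) (f : {rmorphism F -> A}) m (x : 'I_m -> A)
    n (d : algdata n A) : alg_generated f x ->
  exists y : 'I_(m + n) -> alg d, alg_generated (alg_C d \o f : {rmorphism F -> alg d}) y.
Proof.
move=> gen; exists (fun i => match fintype.split i with
  inl j => alg_C d (x j) | inr j => alg_e d j end).
move=> P Pf Px PD PM y.
have PC a : P (alg_C d a).
  apply: (gen (fun a => P (alg_C d a))) => [b|i|b c|b c] /=; first exact: Pf.
  - by have := Px (lshift n i); rewrite (unsplitK (inl i)).
  - by rewrite rmorphD; exact: PD.
  - by rewrite rmorphM; exact: PM.
rewrite [y]alg_basisC; elim/big_ind: _ => //; first by rewrite -(rmorph0 (alg_C d)); exact: PC.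
by move=> i _; apply: PM => //; have := Px (rshift m i); rewrite (unsplitK (inr i)).
Qed.

Lemma alg_generated_surj (F A B : comPzRingType) (f : {rmorphism F -> A}) m (x : 'I_m -> A)
    (g : {rmorphism A -> B}) : (forall b, exists a, g a = b) -> alg_generated f x ->
  alg_generated (g \o f : {rmorphism F -> B}) (g \o x).
Proof.
move=> gs gen P Pf Px PD PM y; have [a <-] := gs y.
apply: (gen (fun a => P (g a))) => // [b c|b c]; rewrite ?rmorphD ?rmorphM.
  exact: PD.
exact: PM.
Qed.

Definition mpX n (R : nzRingType) (i : 'I_n) : mpoly.mpoly n R :=
  mpoly.mpolyX R (mpoly.mnm1 i).

Lemma mpoly_generated n (R : comNzRingType) :
  alg_generated (mpoly.mpolyC n (R := R) : {rmorphism R -> mpoly.mpoly n R}) (@mpX n R).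
Proof.
move=> P PC PX PD PM p.
have P1 : P 1 by rewrite -(rmorph1 (mpoly.mpolyC n (R := R))); exact: PC.
elim/mpoly.mpolyind: p => [|c m p _ _ Pp].
  by rewrite -(rmorph0 (mpoly.mpolyC n (R := R))); exact: PC.
apply: PD => //; rewrite -mpoly.mul_mpolyC; apply: (PM); first exact: PC.
have PXn i k : P (mpX R i ^+ k).
  by elim: k => [|k IH]; rewrite ?expr0 // exprS; exact: PM.
rewrite mpoly.mpolyXE_id.
by apply: (@big_ind _ (fun p => P p)) => // i _; exact: PXn.
Qed.

Lemma mpoly_lift n (R S : comNzRingType) (f : {rmorphism R -> S}) (x : 'I_n -> S) :
  exists h : {rmorphism mpoly.mpoly n R -> S},
  [/\ forall p, h p = mpoly.mmap f x p, forall c, h (mpoly.mpolyC n c) = f c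
    & forall i, h (mpX R i) = x i].
Proof.
exists (mpoly.mmap f x : {rmorphism mpoly.mpoly n R -> S}); split=> //= [c|i].
  exact: mpoly.mmapC.
by rewrite /mpX mpoly.mmapX mpoly.mmap1U.
Qed.

Lemma mpoly_hom_ext n (R : comNzRingType) (S : comPzRingType)
    (h h' : {rmorphism mpoly.mpoly n R -> S}) :
  (forall c, h (mpoly.mpolyC n c) = h' (mpoly.mpolyC n c)) ->
  (forall i, h (mpX R i) = h' (mpX R i)) -> h =1 h'.
Proof.
move=> hC hX; apply: (@mpoly_generated n R (fun p => h p = h' p)) => //=.
  by move=> a b; rewrite !rmorphD => -> ->.
by move=> a b; rewrite !rmorphM => -> ->.
Qed.

(** The basis generates, and the relations between its elements form a finitely generated ideal
    because the polynomial ring is Noetherian. *)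
Lemma finitely_presented_alg n (K : fieldType) (d : algdata n K) (nz : (1 : alg d) != 0) :
  exists (g : {rmorphism alg d -> nonzero_ring nz})
    (g' : {rmorphism nonzero_ring nz -> alg d}),
  [/\ cancel g g', cancel g' g
    & finitely_presented_hom (g \o alg_C d : {rmorphism K -> nonzero_ring nz})].
Proof.
have [g [g' [gK Kg]]] := nonzero_ring_iso nz; exists g, g'; split=> //.
have [h [hE hC hX]] := mpoly_lift (g \o alg_C d : {rmorphism K -> nonzero_ring nz})
  (g \o alg_e d).
have nM : is_noetherian_ring (mpoly.mpoly n K).
  by apply: noetherian_generated (@mpoly_generated n K) _; exact: noetherian_field.
have [m [r e]] := nM _ (kernel_ideal h).
exists n, (g \o alg_e d), m, r; split; last first.
  by rewrite -e; apply/seteqP; split=> f /=; rewrite hE.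
move=> y.
exists (\sum_i mpoly.mpolyC n (g' y 0 i) * mpX K i).
rewrite -[LHS]hE rmorph_sum -[RHS]Kg [in RHS](alg_basisC (g' y)) rmorph_sum.
by apply: eq_bigr => i _; rewrite !rmorphM hC hX.
Qed.

(** * The discriminant and formal smoothness *)

(** The determinant trick: multiply the system by the adjugate. The matrix stays over [A] while the
    unknowns lie in [B], so the conclusion concerns the image of one element of [A]. *)
Lemma det_cramer (A B : comPzRingType) (f : {rmorphism A -> B}) n
    (M : 'M[A]_n) (v w : 'I_n -> B) :
  (forall i, \sum_j f (M i j) * v j = w i) ->
  forall i, f (\det M) * v i = \sum_k f (\adj M i k) * w k.
Proof.
move=> h i; pose V : 'cV[B]_n := \col_j v j; pose W : 'cV[B]_n := \col_j w j.
have MV : map_mx f M *m V = W.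
  apply/matrixP => k l; rewrite !mxE -[RHS](h k).
  by apply: eq_bigr => j _; rewrite !mxE.
have : \adj (map_mx f M) *m (map_mx f M *m V) = \adj (map_mx f M) *m W by rewrite MV.
rewrite mulmxA mul_adj_mx mul_scalar_mx det_map_mx -map_mx_adj => /matrixP /(_ i ord0).
rewrite !mxE => ->; apply: eq_bigr => k _.
by congr (_ * _); rewrite mxE.
Qed.

Lemma det_annihilates (A B : comPzRingType) (f : {rmorphism A -> B}) n
    (M : 'M[A]_n) (v : 'I_n -> B) :
  (forall i, \sum_j f (M i j) * v j = 0) -> forall i, f (\det M) * v i = 0.
Proof.
by move=> h i; rewrite (det_cramer h) big1 // => k _; rewrite mulr0.
Qed.

Lemma rquot_lift (A B : comPzRingType) (I : ideal A) (f : {rmorphism A -> B}) :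
  (forall a, I a -> f a = 0) ->
  exists g : {rmorphism rquot I -> B}, forall a, g (rproj I a) = f a.
Proof.
move=> fI; pose g0 (x : rquot I) := f (zlift x).
have g0E a : g0 (rproj I a) = f a.
  apply/eqP; rewrite -subr_eq0 -rmorphB; apply/eqP/fI.
  exact: (zlift_proj (ideal_subgroup I) a).
have [||g gE] := @rmorphism_of _ _ g0.
- move=> x y; have [a ->] := rproj_surj x; have [b ->] := rproj_surj y.
  by rewrite -rmorphB !g0E rmorphB.
- split=> [|x y]; first by rewrite -(rmorph1 (rproj I)) g0E rmorph1.
  have [a ->] := rproj_surj x; have [b ->] := rproj_surj y.
  by rewrite -rmorphM !g0E rmorphM.
by exists g => a; rewrite gE g0E.
Qed.

Definition alg_formally_smooth (K E : comPzRingType) (str : {rmorphism K -> E}) : Prop :=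
  forall (C C0 : comPzRingType) (pi : {rmorphism C -> C0}),
    (forall c0, exists c, pi c = c0) ->
    (forall a b, pi a = 0 -> pi b = 0 -> a * b = 0) ->
  forall (kc : {rmorphism K -> C}) (e0 : {rmorphism E -> C0}),
    (forall a, e0 (str a) = pi (kc a)) ->
  exists e : {rmorphism E -> C},
    (forall a, e (str a) = kc a) /\ forall x, pi (e x) = e0 x.

Section Trace.
Variables (n : nat) (A : comPzRingType).

(** The inner sum is the trace of multiplication by the basis vector of index [m], so the entry is
    the trace of the product of two basis vectors. As a formula in [x] it also makes sense for
    indeterminates that satisfy no relation. *)
Definition trace_form (x : sidx n -> A) : 'M[A]_n :=
  \matrix_(i, j) \sum_m sc x i j m * \sum_l sc x m l l.

Definition disc (x : sidx n -> A) : A := \det (trace_form x).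

Variable d : algdata n A.

Definition alg_trace (y : alg d) : A := \sum_l (y * alg_e d l) 0 l.

Lemma alg_traceD y z : alg_trace (y + z) = alg_trace y + alg_trace z.
Proof. by rewrite -big_split; apply: eq_bigr => l _; rewrite mulrDl mxE. Qed.

Lemma alg_traceZ a y : alg_trace (a *: y) = a * alg_trace y.
Proof. by rewrite mulr_sumr; apply: eq_bigr => l _; rewrite -alg_scaleAl mxE. Qed.

Lemma alg_trace_sum (I : Type) (r : seq I) (F : I -> alg d) :
  alg_trace (\sum_(i <- r) F i) = \sum_(i <- r) alg_trace (F i).
Proof.
elim: r => [|i r IH]; last by rewrite !big_cons alg_traceD IH.
by rewrite !big_nil -(scale0r (0 : alg d)) alg_traceZ mul0r.
Qed.

Lemma trace_formE i j : trace_form d i j = alg_trace (alg_e d i * alg_e d j).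
Proof.
rewrite mxE alg_e_mul alg_trace_sum; apply: eq_bigr => m _; rewrite alg_traceZ.
congr (_ * _); apply: eq_bigr => l _; rewrite alg_e_mulE (bigD1 l) //=.
rewrite alg_eE eqxx mul1r big1 ?addr0 // => k kl.
by rewrite alg_eE eq_sym (negbTE kl) mul0r.
Qed.

End Trace.

Lemma disc_map n (A B : comPzRingType) (f : {rmorphism A -> B}) (x : sidx n -> A) :
  disc (f \o x) = f (disc x).
Proof.
rewrite /disc -det_map_mx; congr (\det _); apply/matrixP => i j; rewrite !mxE rmorph_sum.
by apply: eq_bigr => m _; rewrite rmorphM rmorph_sum.
Qed.

Section DiscToSmooth.
Variables (n : nat) (K : fieldType) (d : algdata n K).
Hypothesis disc0 : disc d != 0.

Local Notation e := (alg_e d).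
Local Notation tr := (@alg_trace n K d).

Definition dual_e i : alg d := \sum_j (invmx (trace_form d)) i j *: e j.

Lemma dual_eP i k : tr (dual_e i * e k) = (i == k)%:R.
Proof.
have u : trace_form d \in unitmx by rewrite unitmxE unitfE.
have := mulVmx u => /matrixP /(_ i k); rewrite !mxE => <-.
rewrite mulr_suml alg_trace_sum; apply: eq_bigr => j _.
by rewrite -alg_scaleAl alg_traceZ trace_formE.
Qed.

Lemma trace_dual x i : tr (dual_e i * x) = x 0 i.
Proof.
rewrite {1}[x]alg_basisC mulr_sumr alg_trace_sum (bigD1 i) //= big1 ?addr0 => [|k ki].
  by rewrite mulrCA alg_CE alg_traceZ dual_eP eqxx mulr1.
by rewrite mulrCA alg_CE alg_traceZ dual_eP eq_sym (negbTE ki) mulr0.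
Qed.

Lemma trace_nondeg x : (forall y, tr (x * y) = 0) -> x = 0.
Proof. by move=> h; apply/rowP => i; rewrite -trace_dual mulrC h mxE. Qed.

Lemma dual_basis x : x = \sum_i tr (x * e i) *: dual_e i.
Proof.
apply/eqP; rewrite -subr_eq0; apply/eqP/trace_nondeg => y.
rewrite [y]alg_basisC mulr_sumr alg_trace_sum big1 // => k _.
rewrite mulrCA alg_CE alg_traceZ mulrBl alg_traceD -scaleN1r alg_traceZ mulr_suml.
rewrite alg_trace_sum (bigD1 k) //= big1 ?addr0 => [|i ik].
  by rewrite -alg_scaleAl alg_traceZ dual_eP eqxx mulr1 mulN1r subrr mulr0.
by rewrite -alg_scaleAl alg_traceZ dual_eP (negbTE ik) mulr0.
Qed.

(** Paired with [y] under the trace form, the left side gives the sum of the coordinates of index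
    [i] of [y * e i], which is the trace of [y]. *)
Lemma sum_dual : \sum_i e i * dual_e i = 1.
Proof.
apply/eqP; rewrite -subr_eq0; apply/eqP/trace_nondeg => y.
rewrite mulrBl mul1r -scaleN1r alg_traceD alg_traceZ mulr_suml alg_trace_sum.
rewrite (eq_bigr (fun i => (y * e i) 0 i)) => [|i _]; first by rewrite -/(tr y); ring.
by rewrite -trace_dual; congr (tr _); ring.
Qed.

(* The trace form gives the separability idempotent [sum_i e_i (x) dual_e i]; it
   splits the Hochschild cocycle of a [K]-linear lift. *)
Lemma disc_formally_smooth : alg_formally_smooth (alg_C d).
Proof.
move=> C C0 pi pis sq kc e0 e0E.
have /choice[ce ceE] : forall i, exists c, pi c = e0 (e i) by move=> i; exact: pis.
(* A lift of [e0] that is linear over [K] but need not be multiplicative; [c] measures the defect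
   and takes values in the kernel of [pi]. *)
pose s (x : alg d) := \sum_i kc (x 0 i) * ce i.
have sD x y : s (x + y) = s x + s y.
  by rewrite -big_split; apply: eq_bigr => i _; rewrite mxE rmorphD mulrDl.
have sZ a x : s (a *: x) = kc a * s x.
  by rewrite mulr_sumr; apply: eq_bigr => i _; rewrite mxE rmorphM mulrA.
have ssum (F : 'I_n -> alg d) : s (\sum_i F i) = \sum_i s (F i).
  elim/big_ind2: _ => // [|x a y b <- <-]; last by rewrite sD.
  by rewrite -(scale0r (0 : alg d)) sZ rmorph0 mul0r.
have pis' x : pi (s x) = e0 x.
  rewrite rmorph_sum [in RHS](alg_basisC x) rmorph_sum; apply: eq_bigr => i _.
  by rewrite !rmorphM ceE e0E.
pose c x y := s x * s y - s (x * y).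
have cJ x y : pi (c x y) = 0 by rewrite rmorphB rmorphM !pis' rmorphM subrr.
(* The kernel has square zero, so a factor in front of one of its elements matters only modulo the
   kernel. *)
have Jeq a b j : pi a = pi b -> pi j = 0 -> a * j = b * j.
  move=> ab j0; apply/eqP; rewrite -subr_eq0 -mulrBl; apply/eqP/sq => //.
  by rewrite rmorphB ab subrr.
have cDl x y z : c (x + y) z = c x z + c y z by rewrite /c mulrDl !sD; ring.
have cZl a x y : c (a *: x) y = kc a * c x y.
  by rewrite /c -alg_scaleAl !sZ; ring.
have csum (F : 'I_n -> alg d) y : c (\sum_i F i) y = \sum_i c (F i) y.
  elim/big_ind2: _ => // [|x a z b <- <-]; last by rewrite cDl.
  by rewrite -(scale0r (0 : alg d)) cZl rmorph0 mul0r.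
(* Contraction of the cocycle with the separability idempotent; [key] says that its coboundary is
   [c], so [s - H] is multiplicative. *)
pose H x := \sum_i s (e i) * c (dual_e i) x.
have HJ x : pi (H x) = 0.
  by rewrite rmorph_sum big1 // => i _; rewrite rmorphM cJ mulr0.
(* In [sum_i e_i (x) dual_e i], a factor [x] may pass from one side to the other: expand
   [dual_e i * x] in the dual basis and recognize the coordinates of [e k * x]. *)
have swap x y : \sum_i s (e i) * c (dual_e i * x) y = \sum_i s (e i * x) * c (dual_e i) y.
  transitivity (\sum_i \sum_k s (e i) * (kc (tr (dual_e i * x * e k)) * c (dual_e k) y)).
    apply: eq_bigr => i _; rewrite -mulr_sumr {1}[dual_e i * x]dual_basis csum.
    by congr (_ * _); apply: eq_bigr => k _; rewrite cZl.
  rewrite exchange_big; apply: eq_bigr => k _ /=.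
  rewrite [e k * x]alg_basis ssum mulr_suml; apply: eq_bigr => i _.
  rewrite sZ -trace_dual.
  have -> : dual_e i * (e k * x) = dual_e i * x * e k by ring.
  by ring.
have key x y : c x y - s x * H y + H (x * y) - H x * s y = 0.
  have coc i : s (e i) * (s (dual_e i) * c x y - c (dual_e i * x) y + c (dual_e i) (x * y)
      - c (dual_e i) x * s y) = 0.
    rewrite /c !mulrA; have -> : dual_e i * x * y = dual_e i * (x * y) by ring.
    by ring.
  have e1 : \sum_i s (e i) * (s (dual_e i) * c x y) = c x y.
    rewrite -[RHS]mul1r; under eq_bigr => i _ do rewrite mulrA.
    rewrite -mulr_suml; apply: Jeq => //; rewrite rmorph_sum rmorph1.
    under eq_bigr => i _ do rewrite rmorphM !pis' -rmorphM.
    by rewrite -rmorph_sum sum_dual rmorph1.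
  have e2 : \sum_i s (e i) * c (dual_e i * x) y = s x * H y.
    rewrite swap mulr_sumr; apply: eq_bigr => i _; rewrite mulrA; apply: Jeq => //.
    by rewrite rmorphM !pis' -rmorphM mulrC.
  rewrite -e1 -e2 /H mulr_suml -sumrB -big_split -sumrB /=.
  transitivity (\sum_(i < n) (0 : C)); last by rewrite big1.
  by apply: eq_bigr => i _; rewrite -(coc i); ring.
pose f x := s x - H x.
have fE x : pi (f x) = e0 x by rewrite rmorphB pis' HJ subr0.
have sH a x : H (a *: x) = kc a * H x.
  rewrite mulr_sumr; apply: eq_bigr => i _; rewrite /c mulrC.
  by rewrite -(alg_CE a) mulrCA !alg_CE !sZ; ring.
have fM x y : f (x * y) = f x * f y.
  have h0 : H x * H y = 0 by exact: sq.
  have -> : f x * f y = s x * s y - s x * H y - H x * s y + H x * H y by rewrite /f; ring.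
  rewrite h0 addr0; have := key x y; rewrite /c /f => h.
  by apply/eqP; rewrite -subr_eq0 -oppr_eq0; apply/eqP; rewrite -[RHS]h; ring.
(* [f 1] is idempotent and differs from 1 by an element of square zero. *)
have f1 : f 1 = 1.
  have j0 : pi (f 1 - 1) = 0 by rewrite rmorphB fE !rmorph1 subrr.
  have h1 : f 1 * f 1 = f 1 by rewrite -fM mulr1.
  have h2 := sq _ _ j0 j0.
  have h3 : (f 1 - 1) * (f 1 - 1) = f 1 * f 1 - f 1 - f 1 + 1 by ring.
  have : 1 - f 1 = 0 by rewrite -[RHS]h2 h3 h1; ring.
  by move=> /eqP; rewrite subr_eq0 => /eqP.
have [||g gE] := @rmorphism_of _ _ f.
- move=> x y; have HB : H (x - y) = H x - H y.
    rewrite -sumrB; apply: eq_bigr => i _; rewrite -mulrBr; congr (_ * _).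
    by rewrite /c mulrBr -!(scaleN1r (_ : alg d)) !sD !sZ; ring.
  by rewrite /f HB -(scaleN1r (_ : alg d)) sD sZ rmorphN rmorph1; ring.
- by split.
exists g; split=> [a|x]; rewrite gE //.
by rewrite /alg_C /f sZ sH -mulrBr -/(f 1) f1 mulr1.
Qed.

End DiscToSmooth.

(** * From formal smoothness to a nonzero discriminant *)

Section TruncatedPolynomials.
Variable L : fieldType.

Lemma trunc_ideal N : is_ideal [set p : {poly L} | exists q, p = q * 'X^N].
Proof.
split=> /=; first by exists 0; rewrite mul0r.
  by move=> _ _ [q ->] [r ->]; exists (q + r); rewrite mulrDl.
by move=> a _ [q ->]; exists (a * q); rewrite mulrA.
Qed.

Definition trunc N := rquot (Ideal (trunc_ideal N)).

Definition truncp N (p : {poly L}) : trunc N := rproj (Ideal (trunc_ideal N)) p.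

HB.instance Definition _ N := GRing.ComPzRing.on (trunc N).
HB.instance Definition _ N := GRing.isZmodMorphism.Build {poly L} (trunc N) (@truncp N)
  (rproj_is_additive (Ideal (trunc_ideal N))).
HB.instance Definition _ N := GRing.isMonoidMorphism.Build {poly L} (trunc N) (@truncp N)
  (rproj_is_multiplicative (Ideal (trunc_ideal N))).

Lemma truncp_eq0 N p : truncp N p = 0 <-> exists q, p = q * 'X^N.
Proof. exact: (rproj_eq0 (Ideal (trunc_ideal N))). Qed.

Lemma truncp_surj N (x : trunc N) : exists p, x = truncp N p.
Proof. exact: rproj_surj. Qed.

Lemma trunc_map_ex N : exists f : {rmorphism trunc N.+1 -> trunc N},
  forall p, f (truncp N.+1 p) = truncp N p.
Proof.
apply: (@rquot_lift _ _ (Ideal (trunc_ideal N.+1)) (@truncp N : {rmorphism {poly L} -> trunc N})).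
by move=> p [q ->]; apply/truncp_eq0; exists (q * 'X); rewrite exprS mulrA.
Qed.

Lemma polyC_truncp_hom N : exists f : {rmorphism L -> trunc N},
  forall a, f a = truncp N a%:P.
Proof. by exists (@truncp N \o polyC : {rmorphism L -> trunc N}). Qed.

End TruncatedPolynomials.

Section NoDerivation.
Variables (n : nat) (K : fieldType) (d : algdata n K).
Hypothesis smooth : alg_formally_smooth (alg_C d).
Variables (L : fieldType) (chi : {rmorphism alg d -> L}) (D : alg d -> L).
Hypothesis DB : zmod_morphism D.
Hypothesis DM : forall x y, D (x * y) = chi x * D y + chi y * D x.
Hypothesis DC : forall a, D (alg_C d a) = 0.
Variable x : alg d.
Hypothesis Dx : D x = 1.

(** The derivation is a tangent vector at the point [chi]: [y] goes to [chi y + D y * X] modulo the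
    square of [X]. *)
Lemma derivation_hom : exists h : {rmorphism alg d -> trunc L 2},
  (forall a, h (alg_C d a) = truncp 2 (chi (alg_C d a))%:P) /\
  h x = truncp 2 ((chi x)%:P + 'X).
Proof.
pose f (y : alg d) := truncp 2 ((chi y)%:P + (D y)%:P * 'X).
have D1 : D 1 = 0 by rewrite -(rmorph1 (alg_C d)) DC.
have [||h hE] := @rmorphism_of _ _ f.
- move=> y z; rewrite /f -rmorphB; congr (truncp _ _).
  by rewrite DB !rmorphB; ring.
- split=> [|y z]; rewrite /f; first by rewrite rmorph1 D1 rmorph0 mul0r addr0 rmorph1.
  rewrite -rmorphM; apply/eqP; rewrite -subr_eq0 -rmorphB; apply/eqP/truncp_eq0.
  exists (- ((D y)%:P * (D z)%:P)); rewrite DM rmorphD !rmorphM expr2; ring.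
exists h; split=> [a|]; rewrite hE /f; first by rewrite DC rmorph0 mul0r addr0.
by rewrite Dx rmorph1 mul1r.
Qed.

(* Formal smoothness lifts the first order curve of [derivation_hom] to every order. *)
Lemma derivation_lift N : exists (h : {rmorphism alg d -> trunc L N.+2}) (q : {poly L}),
  (forall a, h (alg_C d a) = truncp N.+2 (chi (alg_C d a))%:P) /\
  h x = truncp N.+2 ((chi x)%:P + (1 + q * 'X) * 'X).
Proof.
elim: N => [|N [h [q [hC hx]]]].
  have [h [hC hx]] := derivation_hom.
  by exists h, 0; rewrite mul0r addr0 mul1r.
have [pi piE] := trunc_map_ex L N.+2.
have [kc kcE] := polyC_truncp_hom L N.+3.
have pis c0 : exists c, pi c = c0.
  by have [p ->] := truncp_surj c0; exists (truncp _ p).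
have sq a b : pi a = 0 -> pi b = 0 -> a * b = 0.
  have [p ->] := truncp_surj a; have [r ->] := truncp_surj b.
  rewrite !piE => /truncp_eq0[p' ->] /truncp_eq0[r' ->].
  rewrite -rmorphM; apply/truncp_eq0; exists (p' * r' * 'X^(N.+1)).
  rewrite [LHS]mulrACA -[RHS]mulrA -!exprD; congr (_ * 'X^_).
  by rewrite !addnS !addSn.
have [|h' [h'C h'x]] := smooth pis sq (kc := (kc \o (chi \o alg_C d) : {rmorphism K -> trunc L N.+3})) (e0 := h).
  by move=> a; rewrite hC /= kcE piE.
exists h'; have [p px] := truncp_surj (h' x).
have := h'x x; rewrite px piE hx => /eqP; rewrite -subr_eq0 -rmorphB => /eqP /truncp_eq0[r er].
exists (q + r * 'X^N); split=> [a|]; first by rewrite h'C /= kcE.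
congr (truncp _ _); rewrite -[LHS](subrK ((chi x)%:P + (1 + q * 'X) * 'X)) er.
by rewrite !exprSr; ring.
Qed.

(* The characteristic polynomial of [x] vanishes on the lifted curve to order [n + 2],
   but [chi x] is a root of it of multiplicity at most [n]. *)
Lemma no_derivation : False.
Proof.
pose M : 'M[K]_n := \matrix_(i, j) (x * alg_e d i) 0 j.
pose A := map_mx (chi \o alg_C d : {rmorphism K -> L}) M.
pose P := char_poly A.
have [h [q [hC hx]]] := derivation_lift n.
set g := (chi x)%:P + (1 + q * 'X) * 'X in hx.
pose Q := map_mx (comp_poly g) (char_poly_mx A).
have detQ : \det Q = P \Po g by exact: det_map_mx.
(* Modulo the truncation [g] is the image of [x], so the characteristic matrix of [x] at [g] kills
   the vector of images of the basis. Hence its determinant, [P] evaluated at [g], kills the image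
   of 1. *)
have ann i : truncp n.+2 (\det Q) * h (alg_e d i) = 0.
  apply: (@det_annihilates {poly L} (trunc L n.+2) (@truncp L n.+2) n Q
    (fun i => h (alg_e d i))) => {}i.
  have QE j : Q i j = g *+ (i == j) - (A i j)%:P.
    by rewrite !mxE rmorphB rmorphMn /= comp_polyX comp_polyC.
  transitivity (h (x * alg_e d i) - h (\sum_j alg_C d (M i j) * alg_e d j)).
    under eq_bigr => j _ do rewrite QE rmorphB mulrBl.
    rewrite sumrB; congr (_ - _).
      rewrite (bigD1 i) //= eqxx mulr1n big1 ?addr0 => [|j ji].
        by rewrite rmorphM hx.
      by rewrite eq_sym (negbTE ji) mulr0n rmorph0 mul0r.
    rewrite rmorph_sum; apply: eq_bigr => j _.
    by rewrite rmorphM hC mxE.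
  rewrite -rmorphB -[RHS](rmorph0 h); congr (h _); apply/eqP; rewrite subr_eq0; apply/eqP.
  by rewrite [LHS]alg_basisC; apply: eq_bigr => j _; rewrite [M i j]mxE.
have hP : truncp n.+2 (P \Po g) = 0.
  rewrite -detQ -[LHS]mulr1 -(rmorph1 h) alg_one_e (rmorph_sum h) mulr_sumr big1 // => k _.
  by rewrite -alg_CE rmorphM mulrCA ann mulr0.
have [r er] := (truncp_eq0 _ _).1 hP.
have Pmon : P \is monic by exact: char_poly_monic.
have [m [s sroot Pe]] := multiplicity_XsubC P (chi x).
have P0 : P != 0 by exact: monic_neq0.
rewrite P0 /= in sroot.
have mn : (m <= n)%N.
  have s0 : s != 0 by apply: contraNneq P0 => s0; rewrite Pe s0 mul0r.
  have := size_char_poly A; rewrite -/P Pe size_Mmonic ?monic_exp ?monicXsubC //.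
  rewrite size_exp_XsubC addnS /= => e.
  by rewrite -ltnS -e -add1n leq_add2r size_poly_gt0.
have gx : g - (chi x)%:P = (1 + q * 'X) * 'X by rewrite /g addrC addKr.
have e1 : P \Po g = (s \Po g) * (1 + q * 'X) ^+ m * 'X^m.
  by rewrite Pe comp_polyM rmorphXn /= comp_polyB comp_polyX comp_polyC gx exprMn mulrA.
(* [g - chi x] vanishes to order exactly one. The exponent left on the right is positive because
   [m <= n], so evaluation at 0 makes [s] vanish at [chi x]. *)
have e2 : (s \Po g) * (1 + q * 'X) ^+ m = r * 'X^(n.+2 - m).
  have Xm : ('X^m : {poly L}) != 0 by rewrite monic_neq0 ?monicXn.
  apply: (mulIf Xm); rewrite -e1 er -mulrA -exprD subnK //.
  by apply: leq_trans mn _; rewrite ltnW.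
have := congr1 (horner^~ 0) e2; rewrite hornerM horner_comp hornerM hornerXn.
rewrite expr0n subn_eq0 leqNgt ltnS (leq_trans mn) // mulr0 horner_exp.
rewrite !(hornerD, hornerM, hornerX, hornerC, hornerXn) !mulr0 !addr0 expr1n mulr1.
by move=> /eqP; apply/negP; rewrite rootE in sroot.
Qed.

End NoDerivation.

Section SmoothToDisc.
Variables (n : nat) (K : fieldType) (d : algdata n K).
Hypothesis smooth : alg_formally_smooth (alg_C d).
Variables (L : fieldType) (chi : {rmorphism alg d -> L}).

Let phi : {rmorphism K -> L} := chi \o alg_C d.
Let dL := map_data phi d.
Let mp : alg d -> alg dL := @alg_map n K L phi d.

Let m i : alg dL := alg_e dL i - alg_C dL (chi (alg_e d i)).

Lemma alg_map_shift y :
  mp y - alg_C dL (chi y) = \sum_i alg_C dL (phi (y 0 i)) * m i.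
Proof.
rewrite {1}[y]alg_basisC {1}/mp rmorph_sum [in chi _](alg_basisC y) rmorph_sum.
rewrite (rmorph_sum (alg_C dL)) -sumrB; apply: eq_bigr => i _.
by rewrite !rmorphM /= alg_map_C alg_map_e /m mulrBr -/dL.
Qed.

(* The augmentation ideal of [chi] on [L (x) alg d], spanned by the [m i], is
   idempotent: otherwise some linear functional on it is a derivation. *)
Lemma augmentation_idempotent i : exists z : 'I_n * 'I_n -> L,
  m i = \sum_k z k *: (m k.1 * m k.2).
Proof.
pose S : 'M[L]_(#|{: 'I_n * 'I_n}|, n) :=
  \matrix_(k < #|{: 'I_n * 'I_n}|) ((m (enum_val k).1 * m (enum_val k).2 : alg dL) : 'rV[L]_n).
have rowS k : row k S = m (enum_val k).1 * m (enum_val k).2 by rewrite rowK.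
have [/submxP[w mw]|nS] := boolP ((m i : 'rV[L]_n) <= S)%MS.
  exists (fun k => w 0 (enum_rank k)).
  rewrite mw mulmx_sum_row [RHS](reindex (fun k : 'I_#|{: 'I_n * 'I_n}| => enum_val k)) /=; last first.
    by exists enum_rank => k _; rewrite ?enum_valK ?enum_rankK.
  by apply: eq_bigr => k _; rewrite enum_valK rowS.
(* A column of [cokermx S] kills all the products but not [m i]. Normalized to the value 1 at [m i],
   it is the functional [lam]. *)
exfalso; have [j cj] : exists j, ((m i : 'rV[L]_n) *m cokermx S) 0 j != 0.
  apply: contrapT => h; move/negP: nS; apply; rewrite submxE; apply/eqP/rowP => j.
  by rewrite [RHS]mxE; apply: contrapT => /eqP hj; apply: h; exists j.
set a := (X in X != 0) in cj.
pose lam (y : alg dL) := a^-1 * ((y : 'rV[L]_n) *m cokermx S) 0 j.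
have lamB y z : lam (y - z) = lam y - lam z by rewrite /lam mulmxBl !mxE mulrBr.
have lamD y z : lam (y + z) = lam y + lam z by rewrite /lam mulmxDl !mxE mulrDr.
have lamZ l y : lam (l *: y) = l * lam y by rewrite /lam -scalemxAl mxE mulrCA.
have lamM k l : lam (m k * m l) = 0.
  rewrite /lam; have <- : row (enum_rank (k, l)) S = m k * m l by rewrite rowS enum_rankK.
  by rewrite -row_mul mulmx_coker row0 mxE mulr0.
have lam_sum (F : 'I_n -> alg dL) : lam (\sum_k F k) = \sum_k lam (F k).
  elim/big_ind2: _ => // [|x1 x2 y1 y2 <- <-]; last by rewrite lamD.
  by rewrite -(subrr 0) lamB subrr.
(* [s] projects to the augmentation ideal and obeys the Leibniz rule up to the product [s y * s z],
   which [lam] kills. *)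
pose s y := mp y - alg_C dL (chi y).
have lams y z : lam (s y * s z) = 0.
  rewrite /s !alg_map_shift mulr_suml lam_sum big1 // => k _.
  rewrite mulr_sumr lam_sum big1 // => l _.
  by rewrite mulrACA -rmorphM alg_CE lamZ lamM mulr0.
apply: (@no_derivation _ _ _ smooth L chi (fun y => lam (s y)) _ _ _ (alg_e d i)).
- by move=> y z; rewrite -lamB /s /mp !rmorphB; congr lam; rewrite opprB addrACA opprB [_ + (_ - _)]addrC; ring.
- move=> y z /=; have -> : s (y * z) = chi y *: s z + chi z *: s y + s y * s z.
    by rewrite -!alg_CE /s /mp !rmorphM /=; ring.
  by rewrite lamD lams addr0 lamD !lamZ.
- by move=> b /=; rewrite /s /mp alg_map_C subrr -(subrr 0) lamB subrr.
- by rewrite /s /mp alg_map_e -/dL -/(m i) /lam mulVf.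
Qed.

(** Nakayama: the vector of the [m i] is fixed by a matrix [Z] with entries in the augmentation
    ideal, so [det (1 - Z)] kills all the [m i] and has augmentation 1. The element [f] is the
    idempotent that splits off the factor [L] on which [chi] lives. *)
Lemma augmentation_annihilator : exists f : alg dL,
  (forall y, y * f = \sum_i y 0 i * chi (alg_e d i) *: f) /\
  \sum_i f 0 i * chi (alg_e d i) = 1.
Proof.
have [|ev [evm evC]] := @alg_pushout n K L phi d L chi idfun; first by [].
have eve i : ev (alg_e dL i) = chi (alg_e d i) by rewrite -evm alg_map_e.
have evE y : ev y = \sum_i y 0 i * chi (alg_e d i).
  by rewrite alg_homE; apply: eq_bigr => i _; rewrite eve evC.
have evmi i : ev (m i) = 0 by rewrite rmorphB eve evC subrr.
have /choice[z zE] := augmentation_idempotent.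
pose Z : 'M[alg dL]_n := \matrix_(i, j) \sum_k z i (k, j) *: m k.
have evZ : map_mx ev Z = 0.
  apply/matrixP => i j; rewrite !mxE rmorph_sum big1 // => k _.
  by rewrite -alg_CE rmorphM evmi mulr0.
pose f := \det (1%:M - Z); have evf : ev f = 1.
  by rewrite -det_map_mx map_mxB evZ subr0 map_mx1 det1.
have fm i : f * m i = 0.
  apply: (@det_annihilates _ _ (idfun : {rmorphism alg dL -> alg dL}) n (1%:M - Z) m) => {}i /=.
  have ZE j : (1%:M - Z) i j = (i == j)%:R - Z i j by rewrite !mxE.
  under eq_bigr => j _ do rewrite ZE mulrBl.
  rewrite sumrB (bigD1 i) //= eqxx mulr1n mul1r big1 ?addr0 => [|j ji]; last first.
    by rewrite eq_sym (negbTE ji) mulr0n mul0r.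
  apply/eqP; rewrite subr_eq0 {1}zE; apply/eqP.
  transitivity (\sum_k \sum_j z i (k, j) *: (m k * m j)).
    by rewrite pair_bigA; apply: eq_bigr => -[].
  rewrite exchange_big /=.
  apply: eq_bigr => j _; rewrite mxE mulr_suml; apply: eq_bigr => k _.
  by rewrite alg_scaleAl.
exists f; split; last by rewrite -evE.
move=> y; rewrite -scaler_suml -evE {1}[y]alg_basisC mulr_suml evE scaler_suml.
apply: eq_bigr => i _; rewrite -mulrA.
have -> : alg_e dL i = m i + alg_C dL (chi (alg_e d i)) by rewrite subrK.
by rewrite mulrDl (mulrC (m i)) fm add0r !alg_CE scalerA.
Qed.

(** Multiplication by [f] is a projection of rank one, so the trace of [x * f] is [chi x], which
    therefore vanishes, and [x * f = 0]. Kernels commute with extension of scalars, so [f] is a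
    combination over [L] of elements of [alg d] killed by [x]. As [chi] vanishes on these, the
    augmentation of [f] would be 0 instead of 1. *)
Lemma trace_radical_annihilator (x : alg d) : (forall y, alg_trace (x * y) = 0) ->
  (forall y, x * y = 0 -> chi y = 0) -> False.
Proof.
move=> trx ann; have [f [fE f1]] := augmentation_annihilator.
have chiE y : chi y = \sum_i (mp y) 0 i * chi (alg_e d i).
  rewrite {1}[y]alg_basisC rmorph_sum; apply: eq_bigr => i _.
  by rewrite rmorphM mxE.
have xf : mp x * f = chi x *: f by rewrite fE -scaler_suml -chiE.
have trL (y : alg dL) : alg_trace (mp x * y) = 0.
  rewrite [y]alg_basisC mulr_sumr alg_trace_sum big1 // => i _.
  rewrite mulrCA alg_CE alg_traceZ -alg_map_e -rmorphM.
  have -> : alg_trace (@alg_map n K L phi d (x * alg_e d i)) = phi (alg_trace (x * alg_e d i)).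
    rewrite /alg_trace (rmorph_sum phi); apply: eq_bigr => l _.
    by rewrite -(alg_map_e phi) -rmorphM mxE.
  by rewrite trx rmorph0 mulr0.
have trf : alg_trace f = 1.
  rewrite -[RHS]f1; apply: eq_bigr => l _; rewrite mulrC fE.
  rewrite (bigD1 l) //= alg_eE eqxx mul1r big1 ?addr0 => [|k kl]; last first.
    by rewrite alg_eE eq_sym (negbTE kl) mul0r scale0r.
  by rewrite mxE mulrC.
have chix : chi x = 0.
  by have := trL f; rewrite xf alg_traceZ trf mulr1.
rewrite chix scale0r in xf.
pose M : 'M[K]_n := \matrix_(i, j) (x * alg_e d i) 0 j.
have mulM (y : alg d) : (y : 'rV[K]_n) *m M = x * y.
  apply/rowP => l; rewrite [in RHS](alg_basisC y) mulr_sumr summxE mxE.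
  by apply: eq_bigr => i _; rewrite [M i l]mxE [in RHS]mulrCA alg_CE [RHS]mxE.
have mulML (y : alg dL) : (y : 'rV[L]_n) *m map_mx phi M = mp x * y.
  apply/rowP => l; rewrite [in RHS](alg_basisC y) mulr_sumr summxE mxE.
  apply: eq_bigr => i _; rewrite [in RHS]mulrCA alg_CE -(alg_map_e phi).
  rewrite -rmorphM [RHS]mxE; congr (_ * _).
  by rewrite [LHS]mxE [M i l]mxE [RHS]mxE.
have : ((f : 'rV[L]_n) <= kermx (map_mx phi M))%MS by apply/sub_kermxP; rewrite mulML.
rewrite -map_kermx => /submxP[w fw].
have : (1 : L) = 0; last by move/eqP; rewrite oner_eq0.
rewrite -f1 fw; under eq_bigr => i _ do rewrite mxE mulr_suml.
rewrite exchange_big big1 // => k _ /=.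
under eq_bigr => i _ do rewrite mxE -mulrA.
rewrite -mulr_sumr; have -> : \sum_i phi (kermx M k i) * chi (alg_e d i) = chi (row k (kermx M) : alg d).
  by rewrite [in RHS](alg_basisC (row k (kermx M))) rmorph_sum; apply: eq_bigr => i _; rewrite rmorphM [row _ _ _ _]mxE.
rewrite ann ?mulr0 // -mulM; apply/eqP.
by rewrite -row_mul mulmx_ker row0.
Qed.

End SmoothToDisc.

(* If [x] spans a degeneracy of the trace form, the contradiction is found at a prime
   containing the annihilator of [x]. *)
Lemma formally_smooth_disc n (K : fieldType) (d : algdata n K) :
  alg_formally_smooth (alg_C d) -> disc d != 0.
Proof.
move=> smooth; apply/negP => /det0P[x0 x00 xD].
pose x : alg d := x0.
have trx (y : alg d) : alg_trace (x * y) = 0.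
  rewrite [y]alg_basisC mulr_sumr alg_trace_sum big1 // => j _.
  rewrite mulrCA alg_CE alg_traceZ; move/rowP: xD => /(_ j); rewrite !mxE.
  move=> e; rewrite {1}(alg_basisC x) mulr_suml alg_trace_sum.
  rewrite (eq_bigr (fun i => x 0 i * trace_form d i j)) ?e ?mulr0 // => i _.
  by rewrite -mulrA alg_CE alg_traceZ trace_formE.
have [|p Ip] := proper_ideal_prime (annihilator_ideal x).
  by rewrite /= mul1r => /eqP; apply/negP.
have [L [chi [chi0 _]]] := residue_field p.
apply: (trace_radical_annihilator smooth trx (chi := chi)) => y xy.
by apply/chi0/Ip; rewrite /= mulrC.
Qed.

(** * Flatness *)

Lemma linear_of (A : pzRingType) (U V : lmodType A) (f : U -> V) :
  linear f -> exists g : {linear U -> V}, g =1 f.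
Proof.
move=> fL; pose g : {linear U -> V} := HB.pack f (GRing.isLinear.Build A U V *:%R f fL).
by exists g.
Qed.

Lemma mquot_lift (A : comPzRingType) (V W : lmodType A) (U : submodule V) (f : V -> W) :
  linear f -> (forall x, U x -> f x = 0) ->
  exists g : {linear mquot U -> W}, forall x, g (mproj U x) = f x.
Proof.
move=> /linear_of[h hE] fU; pose g0 (x : mquot U) := h (zlift x).
have g0E x : g0 (mproj U x) = f x.
  rewrite -hE; apply/eqP; rewrite -subr_eq0 -linearB hE; apply/eqP/fU.
  exact: (zlift_proj U x).
have [|g gE] := @linear_of A (mquot U) W g0.
  move=> c x y; have [v ->] := mproj_surj x; have [w ->] := mproj_surj y.
  by rewrite -mproj_is_linear !g0E -!hE linearP.
by exists g => x; rewrite gE g0E.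
Qed.

Section BilinearFacts.
Variables (A : comPzRingType) (M N P : lmodType A) (b : M -> N -> P).
Hypothesis hb : is_bilinear b.

Lemma bilinearDl m m' x : b (m + m') x = b m x + b m' x.
Proof. by have [_ h] := hb; have := h x 1 m m'; rewrite !scale1r. Qed.
Lemma bilinearDr m x y : b m (x + y) = b m x + b m y.
Proof. by have [h _] := hb; have := h m 1 x y; rewrite !scale1r. Qed.
Lemma bilinear0l x : b 0 x = 0.
Proof. by have := bilinearDl 0 0 x; rewrite addr0 -{1}[b 0 x]addr0 => /addrI. Qed.
Lemma bilinear0r m : b m 0 = 0.
Proof. by have := bilinearDr m 0 0; rewrite addr0 -{1}[b m 0]addr0 => /addrI. Qed.
Lemma bilinearZl a m x : b (a *: m) x = a *: b m x.
Proof. by have [_ h] := hb; have := h x a m 0; rewrite !addr0 bilinear0l addr0. Qed.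
Lemma bilinearZr a m x : b m (a *: x) = a *: b m x.
Proof. by have [h _] := hb; have := h m a x 0; rewrite !addr0 bilinear0r addr0. Qed.
Lemma bilinear_suml (I : Type) (r : seq I) (F : I -> M) x :
  b (\sum_(i <- r) F i) x = \sum_(i <- r) b (F i) x.
Proof. by elim: r => [|i r IH]; rewrite ?big_nil ?bilinear0l // !big_cons bilinearDl IH. Qed.
Lemma bilinear_sumr (I : Type) (r : seq I) m (F : I -> N) :
  b m (\sum_(i <- r) F i) = \sum_(i <- r) b m (F i).
Proof. by elim: r => [|i r IH]; rewrite ?big_nil ?bilinear0r // !big_cons bilinearDr IH. Qed.

Hypothesis hP : is_tensor_product b.

(** Pure tensors generate: the projection to the quotient by [U] and the zero map both extend the
    zero bilinear map, hence coincide. *)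
Lemma tensor_ind (U : submodule P) : (forall m x, U (b m x)) -> forall z, U z.
Proof.
move=> hU z; apply/(mproj_eq0 U).
have [_ univ] := hP.
have [|h0 [_ hu]] := univ (mquot U) (fun _ _ => 0).
  by split=> m a x y; rewrite scaler0 addr0.
have e1 : h0 = mproj U.
  by apply: hu; split; [exact: mproj_is_linear | move=> m x; apply/mproj_eq0].
have e2 : h0 = fun _ => 0 by apply: hu; split=> // a x y; rewrite scaler0 addr0.
by rewrite -e1 e2.
Qed.

End BilinearFacts.

Section FlatRelation.
Variables (S M : comPzRingType) (theta : {rmorphism S -> M}) (n : nat) (a : 'I_n -> S).

Let Mn : lmodType S := {ffun 'I_n -> restr_scal theta}.
Let Sn : lmodType S := {ffun 'I_n -> S^o}.

Let Kset (v : Sn) : Prop := \sum_i a i * v i = 0.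

Lemma relations_subgroup : Kset 0 /\ forall v w, Kset v -> Kset w -> Kset (v - w).
Proof.
split; first by rewrite /Kset big1 // => i _; rewrite ffunE mulr0.
move=> v w hv hw; transitivity (\sum_i a i * v i - \sum_i a i * w i).
  by rewrite -sumrB; apply: eq_bigr => i _; rewrite !ffunE mulrBr.
by rewrite hv hw subrr.
Qed.

Lemma relationsZ c v : Kset v -> Kset (c *: v).
Proof.
rewrite /Kset => hv; transitivity (c * \sum_i a i * v i); last by rewrite hv mulr0.
rewrite mulr_sumr; apply: eq_bigr => i _; rewrite ffunE; exact: mulrCA.
Qed.

Let K : submodule Sn := @Submodule _ _
  (Subgroup (proj1 relations_subgroup) (proj2 relations_subgroup)) relationsZ.

(** The image of [M (x) K] in [M^n]. The quotient [M^n / KM] is thus a model of [M (x) (S^n / K)],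
    and [b_tensor] verifies the universal property that [flat_module] requires of it. *)
Let KMset (w : Mn) : Prop := exists r (v : 'I_r -> 'I_n -> S) (y : 'I_r -> M),
  (forall k, \sum_i a i * v k i = 0) /\ forall i, w i = \sum_k theta (v k i) * y k.

Lemma KM_add v w : KMset v -> KMset w -> KMset (v + w).
Proof.
move=> [r [v1 [y1 [h1 e1]]]] [s [v2 [y2 [h2 e2]]]].
exists (r + s)%N, (fun k => match fintype.split k with inl j => v1 j | inr j => v2 j end).
exists (fun k => match fintype.split k with inl j => y1 j | inr j => y2 j end).
split=> [k|i]; first by case: fintype.split.
rewrite ffunE e1 e2 big_split_ord /=; congr (_ + _); apply: eq_bigr => k _.
  by rewrite (unsplitK (inl k)).
by rewrite (unsplitK (inr k)).
Qed.

Lemma KM_scale c w : KMset w -> KMset (c *: w).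
Proof.
move=> [r [v [y [h e]]]]; exists r, v, (fun k => theta c * y k); split=> // i.
rewrite ffunE e; transitivity (theta c * \sum_k theta (v k i) * y k) => //.
by rewrite mulr_sumr; apply: eq_bigr => k _; rewrite mulrCA.
Qed.

Lemma KM_subgroup : KMset 0 /\ forall v w, KMset v -> KMset w -> KMset (v - w).
Proof.
split.
  exists 0%N, (fun _ _ => 0), (fun _ => 0); split=> [[]//|i].
  by rewrite ffunE big_ord0.
by move=> v w hv hw; apply: KM_add => //; rewrite -scaleN1r; exact: KM_scale.
Qed.

Let KM : submodule Mn := @Submodule _ _
  (Subgroup (proj1 KM_subgroup) (proj2 KM_subgroup)) KM_scale.

Let b (m : restr_scal theta) (x : mquot K) : mquot KM :=
  mproj KM [ffun i => (zlift x i : S) *: m].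

Let bE m v : b m (mproj K v) = mproj KM [ffun i => (v i : S) *: m].
Proof.
apply/eqP; rewrite -subr_eq0 -raddfB; apply/eqP/mproj_eq0.
exists 1%N, (fun _ i => zlift (mproj K v) i - v i), (fun _ => m); split=> [_|i].
  have := zlift_proj K v; rewrite /= /Kset => e; rewrite -[RHS]e.
  by apply: eq_bigr => i _; rewrite !ffunE.
by rewrite big_ord1 !ffunE rmorphB mulrBl.
Qed.

Let delta (i : 'I_n) : Sn := [ffun j => (j == i)%:R].

Lemma mproj_sum (V : lmodType S) (U : submodule V) (I : Type) (r : seq I) (F : I -> V) :
  mproj U (\sum_(i <- r) F i) = \sum_(i <- r) mproj U (F i).
Proof. exact: (raddf_sum (mproj U)). Qed.

Let bdelta (w : Mn) : \sum_i b (w i) (mproj K (delta i)) = mproj KM w.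
Proof.
under eq_bigr => i _ do rewrite bE.
rewrite -mproj_sum; congr (mproj KM _); apply/ffunP => j.
rewrite sum_ffunE (bigD1 j) //= !ffunE eqxx scale1r big1 ?addr0 // => i ij.
by rewrite !ffunE eq_sym (negbTE ij) scale0r.
Qed.

Let delta_sum (v : Sn) : mproj K v = \sum_i (v i : S) *: mproj K (delta i).
Proof.
transitivity (mproj K (\sum_i (v i : S) *: delta i)).
  congr (mproj K _); apply/ffunP => j.
  rewrite sum_ffunE (bigD1 j) //= !ffunE eqxx big1 ?addr0 => [|i ij].
    by rewrite [RHS]mulr1.
  by rewrite !ffunE eq_sym (negbTE ij); exact: mulr0.
rewrite mproj_sum; apply: eq_bigr => i _.
by have := mproj_is_linear K (v i : S) (delta i) 0; rewrite !addr0.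
Qed.

Let b_bilinear : is_bilinear b.
Proof.
split=> [m|x] c y z.
  have [v ->] := mproj_surj y; have [w ->] := mproj_surj z.
  rewrite -mproj_is_linear !bE -mproj_is_linear; congr (mproj KM _).
  by apply/ffunP => i; rewrite !ffunE scalerDl scalerA.
rewrite /b -mproj_is_linear; congr (mproj KM _); apply/ffunP => i.
by rewrite !ffunE scalerDr !scalerA mulrC.
Qed.

Let b_tensor : is_tensor_product b.
Proof.
split; first exact: b_bilinear.
move=> Q c hc.
pose h0 (w : Mn) : Q := \sum_i c (w i) (mproj K (delta i)).
have h0L : linear h0.
  move=> s v w; rewrite /h0 scaler_sumr -big_split; apply: eq_bigr => i _.
  by rewrite !ffunE (bilinearDl hc) (bilinearZl hc).
have h0K w : KM w -> h0 w = 0.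
  move=> [r [v [y [hv e]]]]; rewrite /h0.
  transitivity (\sum_k c (y k : restr_scal theta) (mproj K [ffun i => v k i])).
    under [RHS]eq_bigr => k _ do rewrite delta_sum (bilinear_sumr hc).
    rewrite exchange_big; apply: eq_bigr => i _ /=.
    transitivity (c (\sum_k (v k i : S) *: (y k : restr_scal theta)) (mproj K (delta i))).
      by congr (c _ _); exact: e.
    rewrite (bilinear_suml hc); apply: eq_bigr => k _.
    by rewrite ffunE (bilinearZl hc) (bilinearZr hc).
  rewrite big1 // => k _.
  have -> : mproj K [ffun i => v k i] = 0.
    by apply/mproj_eq0; rewrite /= /Kset -[RHS](hv k); apply: eq_bigr => i _; rewrite ffunE.
  exact: bilinear0r hc _.
have [h hE] := mquot_lift h0L h0K.
exists h; split.
  split=> [|m x]; first exact: linearP.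
  have [v ->] := mproj_surj x; rewrite bE hE /h0 [in RHS]delta_sum (bilinear_sumr hc).
  by apply: eq_bigr => i _; rewrite ffunE (bilinearZl hc) (bilinearZr hc).
move=> h' [h'L h'b]; apply/funext => x; have [w ->] := mproj_surj x.
rewrite hE /h0; under eq_bigr => i _ do rewrite -h'b.
have [g gE] := linear_of h'L.
by rewrite -bdelta -gE linear_sum; apply: eq_bigr => i _; rewrite gE.
Qed.

Let b' (m : restr_scal theta) (x : S^o) : restr_scal theta := (x : S) *: m.

Let b'_tensor : is_tensor_product b'.
Proof.
have bb : is_bilinear b'.
  split=> [m|x] s y z; rewrite /b'.
    by rewrite scalerDl scalerA.
  by rewrite scalerDr !scalerA mulrC.
split=> // Q c hc; exists (fun m => c m (1 : S^o)); split.
  split=> [s x y|m x]; first by rewrite (bilinearDl hc) (bilinearZl hc).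
  rewrite /b' (bilinearZl hc) -(bilinearZr hc); congr (c m _); exact: mulr1.
move=> h' [h'L h'b]; apply/funext => m; rewrite -h'b /b'; congr h'.
by rewrite scale1r.
Qed.

(* Flatness is applied to the injection [S^n / K -> S] induced by [a]; tensored with [M],
   it becomes [M^n / KM -> M]. *)
Lemma flat_hom_relation (m : 'I_n -> M) : flat_hom theta ->
  \sum_i theta (a i) * m i = 0 ->
  exists r (v : 'I_r -> 'I_n -> S) (y : 'I_r -> M),
    (forall k, \sum_i a i * v k i = 0) /\ forall i, m i = \sum_k theta (v k i) * y k.
Proof.
move=> flat am0.
pose g0 (v : Sn) : S^o := \sum_i a i * v i.
have g0L : linear g0.
  move=> c v w; transitivity (c * (\sum_i a i * v i) + \sum_i a i * w i) => //.
  rewrite mulr_sumr -big_split; apply: eq_bigr => i _; rewrite !ffunE mulrDr.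
  by congr (_ + _); exact: mulrCA.
have [g gE] := mquot_lift (U := K) g0L (fun v hv => hv).
have ginj : injective g.
  move=> x y; have [v ->] := mproj_surj x; have [w ->] := mproj_surj y.
  rewrite !gE /g0 => e; apply/eqP; rewrite -subr_eq0 -raddfB; apply/eqP/mproj_eq0.
  rewrite /= /Kset -[RHS](subrr (\sum_i a i * w i)) -{1}e -sumrB.
  by apply: eq_bigr => i _; rewrite !ffunE mulrBr.
pose h0 (w : Mn) : restr_scal theta := \sum_i a i *: w i.
have h0L : linear h0.
  move=> s v w; rewrite /h0 scaler_sumr -big_split; apply: eq_bigr => i _.
  by rewrite !ffunE scalerDr !scalerA mulrC.
have h0K w : KM w -> h0 w = 0.
  move=> [r [v [y [hv e]]]]; rewrite /h0.
  transitivity (\sum_i \sum_k theta (a i) * (theta (v k i) * y k)).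
    by apply: eq_bigr => i _; rewrite e -mulr_sumr.
  rewrite exchange_big big1 // => k _ /=.
  transitivity (theta (\sum_i a i * v k i) * y k); last by rewrite hv rmorph0 mul0r.
  by rewrite rmorph_sum mulr_suml; apply: eq_bigr => i _; rewrite rmorphM mulrA.
have [h hE] := mquot_lift h0L h0K.
have hb' p x : h (b p x) = b' p (g x).
  have [v ->] := mproj_surj x.
  rewrite bE hE gE /b' /h0 scaler_suml.
  by apply: eq_bigr => i _; rewrite ffunE scalerA.
have hinj := flat _ _ g ginj _ _ b b' b_tensor b'_tensor h hb'.
have /mproj_eq0 [r [v [y [hv e]]]] : mproj KM [ffun i => m i : restr_scal theta] = 0.
  apply: hinj; rewrite linear0 hE /h0 -[RHS]am0.
  by apply: eq_bigr => i _; rewrite ffunE.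
by exists r, v, y; split=> // i; rewrite -e ffunE.
Qed.

End FlatRelation.

(** The extension of [A] by [V] as an ideal of square zero. It makes elements of a module into
    elements of a ring, where vanishing in a localization has a concrete meaning. *)
Definition trivext (A S : comPzRingType) (f : {rmorphism A -> S}) (V : lmodType S) : Type :=
  (A * V)%type.

Section TrivialExtension.
Variables (A S : comPzRingType) (f : {rmorphism A -> S}) (V : lmodType S).

HB.instance Definition _ := GRing.Zmodule.on (trivext f V).

Definition te_mul (x y : trivext f V) : trivext f V :=
  (x.1 * y.1, f x.1 *: y.2 + f y.1 *: x.2).
Definition te_one : trivext f V := (1, 0).

Lemma te_mulA : associative te_mul.
Proof.
move=> [a v] [b w] [c x]; congr pair => /=; first by rewrite mulrA.
rewrite !scalerDr !scalerA !rmorphM addrA.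
by congr (_ + _ + _ *: _); [congr (_ *: _) | ]; rewrite // mulrC.
Qed.
Lemma te_mulC : commutative te_mul.
Proof. by move=> [a v] [b w]; congr pair => /=; rewrite (mulrC, addrC). Qed.
Lemma te_mul1 : left_id te_one te_mul.
Proof. by move=> [a v]; congr pair => /=; rewrite ?mul1r // rmorph1 scale1r scaler0 addr0. Qed.
Lemma te_mulDl : left_distributive te_mul +%R.
Proof.
move=> [a v] [b w] [c x]; congr pair => /=; first by rewrite mulrDl.
by rewrite rmorphD scalerDl scalerDr addrACA.
Qed.

HB.instance Definition _ := GRing.Zmodule_isComPzRing.Build (trivext f V)
  te_mulA te_mulC te_mul1 te_mulDl.

Lemma te_homs : exists (inc : {rmorphism A -> trivext f V}) (pr : {rmorphism trivext f V -> A}),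
  (forall a, inc a = (a, 0)) /\ (forall x, pr x = x.1).
Proof.
have [||inc incE] := @rmorphism_of A (trivext f V) (fun a => (a, 0)).
- by move=> a b; congr pair; rewrite /= subrr.
- by split=> // a b; congr pair; rewrite /= !scaler0 addr0.
have [||pr prE] := @rmorphism_of (trivext f V) A (fun x => x.1) => //.
by exists inc, pr.
Qed.

End TrivialExtension.

(** * Flatness of the stalks of a free algebra; a stalk is a localization of a free module, not
    itself free *)

Section FlatLocalization.
Variables (A : comPzRingType) (n : nat) (d : algdata n A) (q : prime_ideal (alg d)).

Let p := comap (alg_C d) q.
Let S : comPzRingType := localization p.
Let M : comPzRingType := localization q.
Let theta : {rmorphism S -> M} := @localization_map _ _ (alg_C d) q.

Lemma localization_map_loc_map (X Y : comPzRingType) (f : {rmorphism X -> Y})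
    (r : prime_ideal Y) a :
  localization_map (loc_map (comap f r) a) = loc_map r (f a).
Proof. exact: pull_Spec_map. Qed.

Let thetaE a : theta (loc_map p a) = loc_map q (alg_C d a).
Proof. exact: localization_map_loc_map. Qed.

Lemma loc_scaleE (a : A) (x : restr_scal theta) :
  (loc_map p a : S) *: x = loc_map q (alg_C d a) * (x : M).
Proof. by rewrite -thetaE. Qed.

Lemma loc_map_basis (x : alg d) : loc_map q x =
  \sum_l (loc_map p (x 0 l) : S) *: (loc_map q (alg_e d l) : restr_scal theta).
Proof.
rewrite {1}[x]alg_basisC rmorph_sum; apply: eq_bigr => l _.
by rewrite rmorphM loc_scaleE.
Qed.

Section Elements.
Variables (N P : lmodType S) (b : restr_scal theta -> N -> P).
Hypothesis bT : is_tensor_product b.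

Let bb : is_bilinear b := proj1 bT.

(** Expanding [x * e_j] in the basis absorbs [x] into the second factors; this is how tensors are
    brought to a common denominator. *)
Lemma tensor_rescale (w : M) (x : alg d) (nu : 'I_n -> N) :
  \sum_j b (w * loc_map q x * loc_map q (alg_e d j)) (nu j) =
  \sum_l b (w * loc_map q (alg_e d l))
    (\sum_j (loc_map p ((x * alg_e d j) 0 l) : S) *: nu j).
Proof.
under [RHS]eq_bigr => l _ do rewrite (bilinear_sumr bb).
rewrite exchange_big; apply: eq_bigr => j _ /=.
under eq_bigr => l _ do rewrite (bilinearZr bb) -(bilinearZl bb).
rewrite -(bilinear_suml bb); congr (b _ _).
rewrite -mulrA -rmorphM /= loc_map_basis mulr_sumr; apply: eq_bigr => l _.
by rewrite !loc_scaleE mulrCA.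
Qed.

Let std (z : P) := exists s (nu : 'I_n -> N), ~ q s /\
  z = \sum_j b (inverse (loc_map q s) * loc_map q (alg_e d j)) (nu j).

Let inv_loc s : ~ q s -> loc_map q s * inverse (loc_map q s) = 1.
Proof. by move=> qs; apply: mul_inverse; apply/loc_map_invertible. Qed.

Lemma tensor_std z : std z.
Proof.
have stdD x y : std x -> std y -> std (x + y).
  move=> [s [nu [qs ->]]] [t [mu [qt ->]]].
  have qst := prime_notM qs qt; set w := inverse (loc_map q (s * t)).
  have es : inverse (loc_map q s) = w * loc_map q t.
    apply: (@invertible_mulI _ (loc_map q s)); first exact/loc_map_invertible.
    rewrite inv_loc // mulrCA -rmorphM /= mulrC; exact: (esym (inv_loc qst)).
  have et : inverse (loc_map q t) = w * loc_map q s.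
    apply: (@invertible_mulI _ (loc_map q t)); first exact/loc_map_invertible.
    rewrite inv_loc // mulrCA -rmorphM /= [t * s]mulrC [w * _]mulrC; exact: (esym (inv_loc qst)).
  rewrite es et !tensor_rescale -big_split.
  exists (s * t), (fun l => \sum_j (loc_map p ((t * alg_e d j) 0 l) : S) *: nu j
    + \sum_j (loc_map p ((s * alg_e d j) 0 l) : S) *: mu j).
  by split=> //; apply: eq_bigr => l _; rewrite (bilinearDr bb).
have stdZ c x : std x -> std (c *: x).
  move=> [s [nu [qs ->]]]; exists s, (fun j => c *: nu j); split=> //.
  by rewrite scaler_sumr; apply: eq_bigr => j _; rewrite (bilinearZr bb).
have std0 : std 0.
  exists 1, (fun _ => 0); split; first exact: prime_not1.
  by rewrite big1 // => j _; rewrite (bilinear0r bb).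
have stdB x y : std x -> std y -> std (x - y).
  by move=> hx hy; apply: stdD => //; rewrite -scaleN1r; exact: stdZ.
apply: (tensor_ind bT (U := @Submodule _ _ (Subgroup std0 stdB) stdZ)) => m x /=.
have [y [s [qs ms]]] := loc_surj m.
exists s, (fun l => (loc_map p (y 0 l) : S) *: x); split=> //.
transitivity (b (inverse (loc_map q s) * loc_map q y) x).
  by congr (b _ _); rewrite -ms mulrA [inverse _ * _]mulrC inv_loc // mul1r.
under [RHS]eq_bigr => l _ do rewrite (bilinearZr bb) -(bilinearZl bb).
rewrite -(bilinear_suml bb); congr (b _ _).
by rewrite (loc_map_basis y) mulr_sumr; apply: eq_bigr => l _; rewrite !loc_scaleE mulrCA.
Qed.

(* A vanishing tensor is detected in the localization of the algebra with the same
   structure constants over the trivial extension [A (+) N]. *)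
Lemma tensor_eq0 (w : M) (nu : 'I_n -> N) : invertible w ->
  \sum_j b (w * loc_map q (alg_e d j)) (nu j) = 0 ->
  exists2 u, ~ q u &
    forall l, \sum_j (loc_map p ((u * alg_e d j) 0 l) : S) *: nu j = 0.
Proof.
move=> winv z0.
pose D : comPzRingType := trivext (loc_map p : {rmorphism A -> S}) N.
have [inc [pr [incE prE]]] := te_homs (loc_map p : {rmorphism A -> S}) N.
pose dD := map_data inc d.
have [||prD [prDE prDC prDe]] := @alg_lift n D dD (alg d)
    (alg_C d \o pr : {rmorphism D -> alg d}) (alg_e d).
- move=> i j; rewrite alg_e_mul; apply: eq_bigr => l _.
  by rewrite /= /sc /= incE prE alg_CE.
- rewrite alg_one_e; apply: eq_bigr => i _.
  by rewrite /= /su /= incE prE alg_CE.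
pose qD := comap prD q.
have princ x : prD (alg_map inc x) = x.
  rewrite prDE [RHS]alg_basisC; apply: eq_bigr => i _.
  by rewrite mxE /= incE prE.
have [|tau tauE] := @loc_lift _ q (localization qD)
    (loc_map qD \o @alg_map n A D inc d : {rmorphism alg d -> localization qD}).
  by move=> a qa; apply/loc_map_invertible; rewrite /qD /= /preimage /= princ.
pose iN (x : N) : localization qD := loc_map qD (alg_C dD (0, x)).
have iND x y : iN (x + y) = iN x + iN y.
  by rewrite /iN -!rmorphD; congr (loc_map _ (alg_C _ _)); congr pair; rewrite addr0.
have tauC a : tau (theta (loc_map p a)) = loc_map qD (alg_C dD (inc a)).
  by rewrite thetaE tauE /= alg_map_C.
have iNa a x : iN ((loc_map p a : S) *: x) = tau (theta (loc_map p a)) * iN x.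
  rewrite tauC /iN -!rmorphM; congr (loc_map _ (alg_C _ _)).
  by rewrite incE; congr pair; rewrite /= ?mulr0 // scaler0 addr0.
have iNZ (c : S) x : iN (c *: x) = tau (theta c) * iN x.
  have [a [s [ps cs]]] := loc_surj (c : localization p).
  apply: (@invertible_mulI _ (tau (theta (loc_map p s)))).
    by do 2!apply: invertible_morph; apply/loc_map_invertible.
  rewrite -iNa scalerA mulrA -!rmorphM.
  have -> : (loc_map p s : S) * c = loc_map p a by exact: cs.
  exact: iNa.
(* This bilinear map sends tensors into a localization of [alg dD], where an element is zero exactly
   if something outside [qD] kills it. *)
pose c0 (m : restr_scal theta) (x : N) : restr_scal (tau \o theta : {rmorphism S -> localization qD}) :=
  tau (m : M) * iN x.
have c0b : is_bilinear c0.
  split=> [m|x] s y z; rewrite /c0.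
    by rewrite iND iNZ mulrDr; congr (_ + _); exact: mulrCA.
  rewrite rmorphD mulrDl; congr (_ + _).
  transitivity (tau (theta s) * (tau (y : M) * iN x)) => //.
  by rewrite mulrA -rmorphM.
have [_ univ] := bT; have [k [[kL kE] _]] := univ _ c0 c0b.
have [kk kkE] := linear_of kL.
have Y0 : tau w * loc_map qD (\sum_j alg_C dD (0, nu j) * alg_e dD j) = 0.
  rewrite -[RHS](linear0 kk) -z0 linear_sum rmorph_sum mulr_sumr.
  apply: eq_bigr => j _; rewrite kkE kE /c0.
  transitivity (tau w * tau (loc_map q (alg_e d j)) * iN (nu j)).
    by rewrite tauE /= alg_map_e rmorphM -mulrA; congr (_ * _); rewrite mulrC.
  by congr (_ * _); exact/esym/(rmorphM tau).
(* The components in [N] of the product of [u] with the sum are the relations sought; only the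
   projection [prD u] of [u] to [alg d] enters them, because [N] has square zero. *)
have /loc_map_eq0[u qu uY] : loc_map qD (\sum_j alg_C dD (0, nu j) * alg_e dD j) = 0.
  apply: (@invertible_mulI _ (tau w)); first exact: invertible_morph.
  by rewrite Y0 mulr0.
exists (prD u) => // l.
have prDu i : (prD u) 0 i = (u 0 i).1.
  by rewrite prDE alg_sum_row mxE prE.
have snd_sum (I : Type) (r : seq I) (F : I -> D) :
    (\sum_(i <- r) F i).2 = \sum_(i <- r) (F i).2.
  by elim: r => [|i r IH]; rewrite ?big_nil // !big_cons -IH.
have := congr1 (fun y : alg dD => (y 0 l).2) uY; rewrite alg_sum_row alg_mulE !mxE /= => uYl.
rewrite -[RHS]uYl snd_sum; under [RHS]eq_bigr => i _ do rewrite snd_sum.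
rewrite [RHS]exchange_big; apply: eq_bigr => j _ /=.
rewrite mulrC alg_e_mulE rmorph_sum scaler_suml; apply: eq_bigr => i _.
have -> : sc (inc \o d) i j l = (sc d i j l, 0) by exact: incE.
have -> : (\row_k ((0, nu k) : D)) 0 j = (0, nu j) by rewrite mxE.
rewrite prDu /= scaler0 add0r rmorph0 scale0r addr0 scalerA.
by rewrite rmorphM mulrC scC.
Qed.

End Elements.

(** If the image of a tensor in standard form vanishes, some [u] outside [q] makes its coefficients
    vanish after [g], hence before it by injectivity; absorbing [u] into the coefficients then shows
    that the tensor is zero. *)
Lemma flat_localization : flat_hom theta.
Proof.
move=> N N' g ginj P P' b b' bT bT' h hb.
suff ker z : h z = 0 -> z = 0.
  by move=> x y xy; apply/eqP; rewrite -subr_eq0; apply/eqP/ker; rewrite linearB xy subrr.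
have [s [nu [qs ->]]] := tensor_std bT z; set w := inverse _.
have winv : invertible w.
  by exists (loc_map q s); rewrite mulrC; apply: mul_inverse; apply/loc_map_invertible.
rewrite linear_sum => hz.
have [|u qu hu] := tensor_eq0 bT' winv (nu := g \o nu).
  by rewrite -[RHS]hz; apply: eq_bigr => j _; rewrite hb.
pose w' := w * inverse (loc_map q u).
have ww' : w = w' * loc_map q u.
  by rewrite -mulrA [inverse _ * _]mulrC mul_inverse ?mulr1 //; apply/loc_map_invertible.
rewrite {1}ww' (tensor_rescale bT) big1 // => l _.
have -> : \sum_j (loc_map p ((u * alg_e d j) 0 l) : S) *: nu j = 0.
  apply: ginj; rewrite linear0 linear_sum -[RHS](hu l).
  by apply: eq_bigr => j _; rewrite linearZ.
by rewrite (bilinear0r (proj1 bT)).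
Qed.

End FlatLocalization.

(** * The discriminant criterion *)

Definition iso_pair (X Y : locally_ringed_space) (r : morphism X Y) (s : morphism Y X) : Prop :=
  r \om s = id_morphism Y /\ s \om r = id_morphism X.

Lemma iso_pair_id (X : locally_ringed_space) : iso_pair (id_morphism X) (id_morphism X).
Proof. by split; exact: comp_morphism1. Qed.

Lemma iso_pair_comp (X Y Z : locally_ringed_space) (r : morphism X Y) s
    (r' : morphism Y Z) s' :
  iso_pair r s -> iso_pair r' s' -> iso_pair (r' \om r) (s \om s').
Proof.
move=> [rs sr] [rs' sr']; split.
  by rewrite -comp_morphismA (comp_morphismA r) rs comp_1morphism.
by rewrite -comp_morphismA (comp_morphismA s') sr' comp_1morphism.
Qed.

Lemma iso_pair_Spec (A B : comPzRingType) (f : {rmorphism A -> B}) (g : {rmorphism B -> A}) :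
  cancel f g -> cancel g f -> iso_pair (Spec_map f) (Spec_map g).
Proof. by move=> fg gf; split; rewrite -Spec_map_comp; exact: Spec_map_id. Qed.

Lemma bijective_inj_surj (T U : Type) (f : T -> U) :
  injective f -> (forall u, exists t, f t = u) -> bijective f.
Proof.
move=> finj /choice[g gE]; exists g => // x.
by apply: finj; rewrite gE.
Qed.

Lemma iso_open_immersion (X Y : locally_ringed_space) (i : morphism X Y) h :
  iso_pair i h -> open_immersion i /\ forall y, range i y.
Proof.
move=> [ih hi]; have hiE x : h (i x) = x by exact: (mfun_eq hi x).
have ihE y : i (h y) = y by exact: (mfun_eq ih y).
split; last by move=> y; exists (h y).
split.
- by move=> x x' e; rewrite -(hiE x) e hiE.
- move=> U Uo; have -> : i @` U = h @^-1` U.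
    apply/seteqP; split=> y /=; first by move=> [x Ux <-]; rewrite hiE.
    by move=> Uy; exists (h y).
  exact: open_preimage.
- move=> x; apply: bijective_inj_surj; last first.
    move=> a; have [s sE] := extend_germ a.
    exists (stalk_map h (i x) (s (h (i x)))).
    by rewrite -sE; exact: (stalk_map_eq hi x s).
  move=> a a' e; apply/eqP; rewrite -subr_eq0; apply/eqP.
  have [t tE] := extend_germ (a - a').
  have t0 : stalk_map i x (t (i x)) = 0 by rewrite tE rmorphB e subrr.
  have := stalk_map_eq ih (i x) t; rewrite /= tE => <-.
  suff -> : stalk_map i (h (i x)) (t (i (h (i x)))) = 0 by rewrite rmorph0.
  by rewrite hiE.
Qed.

Lemma open_immersion_id (X : locally_ringed_space) : open_immersion (id_morphism X).
Proof. exact: (iso_open_immersion (iso_pair_id X)).1. Qed.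

Lemma is_scheme_over_affine (F : fieldType) (A : comPzRingType) (X : scheme)
    (r : morphism (Spec A) X) (s : morphism X (Spec A)) (sX : morphism X (Spec F)) :
  iso_pair r s -> is_noetherian_ring A -> is_scheme_over sX.
Proof.
move=> rs nA; split.
  by apply: (@separated_of_mono X (Spec F) A s sX); exact: section_mono rs.1.
move=> x; exists A, r; have [ro rr] := iso_open_immersion rs.
by split=> //; exact: rr.
Qed.

Lemma module_finite_alg n (A : comPzRingType) (d : algdata n A) :
  module_finite_hom (alg_C d : {rmorphism A -> alg d}).
Proof. by exists n, (alg_e d) => x; exists (x 0); exact: alg_basisC. Qed.

Lemma finite_affine (X Y : scheme) (A B : comPzRingType) (f : morphism X Y)
    (r : morphism (Spec B) X) s (r' : morphism (Spec A) Y) s' (phi : {rmorphism A -> B}) :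
  iso_pair r s -> iso_pair r' s' -> f \om r = r' \om Spec_map phi ->
  module_finite_hom phi -> finite_morphism f.
Proof.
move=> rs rs' e fin y; exists A, B, phi, r', r.
have [ro rr] := iso_open_immersion rs; have [ro' rr'] := iso_open_immersion rs'.
split=> //; apply/seteqP; split=> x _; first exact: rr'.
exact: rr.
Qed.

Lemma alg_generated_id (F : comPzRingType) :
  alg_generated (idfun : {rmorphism F -> F}) (fun i : 'I_0 => 0 : F).
Proof. by move=> P h _ _ _ s; exact: h. Qed.

Lemma noetherian_alg (F : comNzRingType) (A : comPzRingType) (f : {rmorphism F -> A}) m
    (x : 'I_m -> A) n (d : algdata n A) : is_noetherian_ring F -> alg_generated f x ->
  is_noetherian_ring (alg d).
Proof.
move=> nF gen; have [y yP] := alg_generated_alg d gen.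
exact: noetherian_generated yP nF.
Qed.

Lemma finite_scheme_of_alg (F : fieldType) n (d : algdata n F) (X : scheme)
    (r : morphism (Spec (alg d)) X) s (sX : morphism X (Spec F)) :
  iso_pair r s -> sX \om r = Spec_map (alg_C d) -> is_finite_scheme_over sX.
Proof.
move=> rs e; split.
  apply: (is_scheme_over_affine sX rs).
  exact: noetherian_alg (@noetherian_field F) (@alg_generated_id F).
apply: (finite_affine rs (iso_pair_id (Spec F)) (phi := alg_C d)) => //.
  by rewrite comp_1morphism.
exact: module_finite_alg.
Qed.

Lemma smooth_alg_morphism n (K : fieldType) (d : algdata n K) : disc d != 0 ->
  smooth_morphism (Spec_map (alg_C d) : morphism (Spec (alg d)) (Spec K)).
Proof.
move=> d0; split.
  move=> x; have nz : (1 : alg d) != 0.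
    apply/eqP => e; apply: (@prime_not1 _ (x : prime_ideal (alg d))).
    by rewrite e; exact: ideal0 (prime_is_ideal x).
  have [g [g' [gg' g'g fp]]] := finitely_presented_alg nz.
  exists K, (nonzero_ring nz), (g \o alg_C d : {rmorphism K -> nonzero_ring nz}).
  exists (id_morphism (Spec K)), (Spec_map g : morphism (Spec (nonzero_ring nz)) (Spec (alg d))).
  have [io ir] := iso_open_immersion (iso_pair_Spec gg' g'g).
  split=> //; first by split=> //; exact: open_immersion_id.
  by rewrite comp_1morphism; apply/esym; exact: (Spec_map_comp (alg_C d) g).
move=> C C0 pi pis sq y x0 yx.
have [kc ykc] := spec_full y; have [e0 xe0] := spec_full x0.
have [|e [eC ee]] := disc_formally_smooth d0 pis sq (kc := kc) (e0 := e0).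
  apply: spec_faithful (e0 \o alg_C d : {rmorphism _ -> _}) (pi \o kc : {rmorphism _ -> _}) _.
  by move: yx; rewrite xe0 ykc !Spec_map_comp.
exists (Spec_map e); rewrite ykc xe0; split.
  by rewrite -Spec_map_comp; apply: Spec_map_eq => a; exact: eC.
by rewrite -Spec_map_comp; apply: Spec_map_eq => a; exact: ee.
Qed.

Lemma base_change_alg n (A D : comPzRingType) (f : {rmorphism A -> D}) (d : algdata n A) :
  is_fibre_product (Spec_map (alg_C d) : morphism (Spec (alg d)) (Spec A))
    (Spec_map f : morphism (Spec D) (Spec A))
    (Spec_map (@alg_map n A D f d) : morphism (Spec (alg (map_data f d))) (Spec (alg d)))
    (Spec_map (alg_C (map_data f d)) : morphism (Spec (alg (map_data f d))) (Spec D)).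
Proof.
apply: affine_fibre_product => [a|Q b' d' e|Q h h' hb hd].
- exact: alg_map_C.
- exact: alg_pushout.
- exact: alg_map_hom_ext.
Qed.

(** * A smoothing over an integral base with nonzero discriminant *)

Section Family.
Variables (F : fieldType) (Q : comPzRingType) (n m : nat) (d : algdata n Q).
Variables (sg : {rmorphism F -> Q}) (ev : {rmorphism Q -> F}) (x : 'I_m -> Q).
Hypotheses (evsg : cancel sg ev) (gen : alg_generated sg x).
Hypotheses (Q0 : is_prime_ideal [set 0 : Q]) (disc0 : disc d <> 0).

Let eta : prime_ideal Q := PrimeIdeal Q0.

Lemma open_eta (U : set (Spec Q)) p : open U -> U p -> U eta.
Proof.
move=> /zariski_openP h /h[a pa aU]; apply: aU => /= a0; apply: pa.
by rewrite a0; exact: ideal0 (prime_is_ideal p).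
Qed.

Lemma generic_eta : generic_point (eta : Spec Q).
Proof.
apply/seteqP; split=> // p _ B; rewrite nbhsE => -[U [Uo Up] UB].
by exists eta; split=> //; apply: UB; exact: (open_eta Uo Up).
Qed.

Lemma irreducible_family : irreducible_space (Spec Q).
Proof.
split; first by exists eta.
move=> C D Cc Dc CD; have : (C `|` D) eta by rewrite CD.
have full (E : set (Spec Q)) : closed E -> E eta -> E = setT.
  move=> Ec Ee; apply/seteqP; split=> // p _; apply: contrapT => nE.
  have Eo : open (~` E) by rewrite openC.
  exact: (open_eta Eo nE Ee).
by case=> [/(full _ Cc)|/(full _ Dc)]; [left | right].
Qed.

Lemma smoothable_of_family (R : scheme) (rho : morphism R (Spec F))
    (r : morphism (Spec (alg (map_data ev d))) R) s :
  iso_pair r s -> rho \om r = Spec_map (alg_C (map_data ev d)) -> smoothable rho.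
Proof.
move=> rs er.
have nQ : is_noetherian_ring Q by exact: noetherian_generated gen (@noetherian_field F).
have nZ : is_noetherian_ring (alg d) by exact: noetherian_alg (@noetherian_field F) gen.
exists (Spec Q), (Spec (alg d)), (Spec_map sg), (Spec_map (alg_C d)); split.
- split; last exact: irreducible_family.
  exact: (is_scheme_over_affine (X := Spec Q) _ (iso_pair_id _) nQ).
- exact: (is_scheme_over_affine (X := Spec (alg d)) _ (iso_pair_id _) nZ).
- split; first by move=> q; exact: (@flat_localization Q n d q).
  apply: (finite_affine (X := Spec (alg d)) (Y := Spec Q) (iso_pair_id _) (iso_pair_id _)
    (phi := alg_C d)).
    by rewrite comp_1morphism comp_morphism1.
  exact: module_finite_alg.
- exists (Spec_map ev), (Spec_map (@alg_map n Q F ev d) \om s); split.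
    by rewrite -Spec_map_comp; apply: Spec_map_id.
  have := fibre_product_iso (base_change_alg ev d) (P' := R) (r := s) (s := r) rs.2 rs.1.
  by rewrite -er -(comp_morphismA rho) rs.1 comp_morphism1.
have [K [ka [ka0 kafrac]]] := residue_field eta.
exists eta, K, (Spec_map ka), (Spec (alg (map_data ka d))).
exists (Spec_map (@alg_map n Q K ka d)), (Spec_map (alg_C (map_data ka d))); split.
- exact: generic_eta.
- move=> o; split.
    apply: prime_ideal_ext => a; rewrite -ka0; exact: (prime_field o (ka a)).
  move=> z; have [u [v [ov ->]]] := frac_surj (z : localization (o : prime_ideal K)).
  have v0 : v != 0 by apply/eqP => v0; apply: ov; apply/prime_field.
  have [a [b [eb e]]] := kafrac (u / v).
  have ob : ~ comap ka o b by move=> /(prime_field o (ka b)) /ka0.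
  exists (frac a ob); rewrite [LHS]localization_mapE; apply: frac_eq.
  by rewrite -e -mulrA divfK // mulrC.
- exact: base_change_alg.
apply: smooth_alg_morphism; rewrite (disc_map ka d); apply/eqP => h.
by apply: disc0; have /ka0 := h.
Qed.

End Family.

Lemma algdata_eq n (A : comPzRingType) (d d' : algdata n A) : d =1 d' -> d = d'.
Proof.
case: d d' => [d dP] [d' d'P] /= /funext e; subst d'.
by rewrite (Prop_irrelevance dP d'P).
Qed.

Section Criterion.
Variables (F : fieldType) (n : nat).

Definition nvars := #|sidx n|.
Definition sc_poly : comNzRingType := mpoly.mpoly nvars F.
Definition generic_data (i : sidx n) : sc_poly := mpX F (enum_rank i).

(* The point [d] of the scheme of algebra structures on [F^n] lies on an integral
   closed subscheme along which the discriminant is not identically zero. *)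
Definition disc_criterion (d : sidx n -> F) : Prop :=
  exists P : prime_ideal sc_poly,
  [/\ forall a, alg_rel generic_data a -> P a, ~ P (disc generic_data)
    & forall p, P p -> mpoly.mmap idfun (d \o enum_val) p = 0].

Lemma smoothable_of_criterion (d : algdata n F) (R : scheme) (rho : morphism R (Spec F))
    (r : morphism (Spec (alg d)) R) s :
  iso_pair r s -> rho \om r = Spec_map (alg_C d) -> disc_criterion d -> smoothable rho.
Proof.
move=> rs er [P [Prel Pdisc Pev]].
pose I := Ideal (prime_is_ideal P); pose Q : comPzRingType := rquot I.
pose pr : {rmorphism sc_poly -> Q} := rproj I.
have dQP a : alg_rel (pr \o generic_data) a -> a = 0.
  by move=> /alg_rel_map[b /Prel Pb ->]; apply/(rproj_eq0 I).
pose dQ := AlgData dQP.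
have [e0 [e0E e0C e0X]] := mpoly_lift (idfun : {rmorphism F -> F}) (d \o enum_val : 'I_nvars -> F).
have [|ev evE] := @rquot_lift _ _ I e0; first by move=> p /Pev; rewrite e0E.
have ed : map_data ev dQ = d.
  apply: algdata_eq => i /=; rewrite [LHS]evE e0X /=.
  by rewrite enum_rankK.
subst d.
pose sg : {rmorphism F -> Q} := pr \o mpoly.mpolyC nvars (R := F).
apply: (@smoothable_of_family F Q n nvars dQ sg ev (pr \o @mpX nvars F)) rs er.
- by move=> a; rewrite /sg /= evE e0C.
- apply: alg_generated_surj; last exact: mpoly_generated.
  by move=> y; have [p ->] := rproj_surj y; exists p.
- split.
  + exact: zero_ideal.
  + move=> /= e; apply: (@prime_not1 _ P); apply/(rproj_eq0 I).
    by rewrite rmorph1.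
  + move=> a b /=; have [a' ->] := rproj_surj a; have [b' ->] := rproj_surj b.
    rewrite -rmorphM => /(rproj_eq0 I)/prime_mul [h|h]; [left|right]; exact/(rproj_eq0 I).
- by rewrite (disc_map pr) => /(rproj_eq0 I).
Qed.

End Criterion.

(** * Finite flat algebras over a local ring *)

Lemma common_denominator (A : comPzRingType) (p : prime_ideal A) (I : finType)
    (x : I -> localization p) :
  exists s (a : I -> A), ~ p s /\ forall i, loc_map p s * x i = loc_map p (a i).
Proof.
have /choice[ab abP] : forall i, exists ab : A * A, ~ p ab.2 /\ loc_map p ab.2 * x i = loc_map p ab.1.
  by move=> i; have [a [b [pb e]]] := loc_surj (x i); exists (a, b).
exists (\prod_i (ab i).2), (fun i => (\prod_(j | j != i) (ab j).2) * (ab i).1); split.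
  by apply: prime_not_prod => i; have [] := abP i.
move=> i; have [_ e] := abP i.
by rewrite (bigD1 i) //= rmorphM rmorphM /= -e; ring.
Qed.

(** Modulo [p] the determinant is [s ^ n]. *)
Lemma det_scalar_sub_prime (A : comPzRingType) (p : prime_ideal A) n (s : A) (X : 'M[A]_n) :
  ~ p s -> (forall i j, p (X i j)) -> ~ p (\det (s%:M - X)).
Proof.
move=> ps pX; have [K [k [k0 _]]] := residue_field p.
rewrite -k0 -det_map_mx map_mxB map_scalar_mx.
have -> : map_mx k X = 0 by apply/matrixP => i j; rewrite !mxE; apply/k0.
rewrite subr0 det_scalar => /eqP; rewrite expf_eq0 => /andP[_ /eqP /k0].
exact: ps.
Qed.

Section LyingOver.
Variables (A B : comPzRingType) (phi : {rmorphism A -> B}) (m : nat) (e : 'I_m -> B).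
Hypothesis gen : forall x, exists c : 'I_m -> A, x = \sum_i phi (c i) * e i.
Variable p : prime_ideal A.

Definition extended_ideal : set B :=
  [set x | exists c : 'I_m -> A, (forall i, p (c i)) /\ x = \sum_i phi (c i) * e i].

Lemma extended_ideal_ideal : is_ideal extended_ideal.
Proof.
have hp := prime_is_ideal p; split.
- exists (fun _ => 0); split=> [_|]; first exact: ideal0.
  by rewrite big1 // => i _; rewrite rmorph0 mul0r.
- move=> _ _ [c [pc ->]] [c' [pc' ->]]; exists (fun i => c i + c' i); split.
    by move=> i; exact: idealD.
  by rewrite -big_split; apply: eq_bigr => i _; rewrite rmorphD mulrDl.
- move=> b _ [c [pc ->]].
  have /choice[g gE] : forall i, exists g : 'I_m -> A, b * e i = \sum_j phi (g j) * e j.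
    by move=> i; exact: gen.
  exists (fun j => \sum_i c i * g i j); split.
    by move=> j; apply: ideal_sum => // i _; exact: idealMr.
  rewrite mulr_sumr; under eq_bigr => i _ do rewrite mulrCA gE mulr_sumr.
  rewrite exchange_big; apply: eq_bigr => j _ /=.
  by rewrite rmorph_sum mulr_suml; apply: eq_bigr => i _; rewrite rmorphM mulrA.
Qed.

Lemma extended_ideal_phi a x : p a -> extended_ideal (phi a * x).
Proof.
move=> pa; have [c ->] := gen x; exists (fun i => a * c i); split.
  by move=> i; apply: idealMr => //; exact: prime_is_ideal.
by rewrite mulr_sumr; apply: eq_bigr => i _; rewrite rmorphM mulrA.
Qed.

(* If [phi s] lies in [J + pB] with [s] outside [p], Cramer's rule in [B / J] gives
   an element of [J] that is the image of a determinant congruent to a power of [s]. *)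
Lemma lying_over (J : set B) : is_ideal J -> (forall s, J (phi s) -> p s) ->
  exists q : prime_ideal B, J `<=` q /\ forall a, q (phi a) <-> p a.
Proof.
move=> hJ Jp; have hE := extended_ideal_ideal.
pose I := [set x | exists j y, [/\ J j, extended_ideal y & x = j + y]].
have hI : is_ideal I.
  split.
  - by exists 0, 0; split; [exact: ideal0|exact: ideal0|rewrite addr0].
  - move=> _ _ [j [y [Jj Ey ->]]] [j' [y' [Jj' Ey' ->]]].
    by exists (j + j'), (y + y'); split; [exact: idealD|exact: idealD|rewrite addrACA].
  - move=> b _ [j [y [Jj Ey ->]]].
    by exists (b * j), (b * y); split; [exact: idealMl|exact: idealMl|rewrite mulrDr].
have [||||q [Iq qS]] := @exists_prime_avoiding B I [set x | exists2 s, ~ p s & x = phi s].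
- exact: hI.
- by exists 1; [exact: prime_not1 | rewrite rmorph1].
- by move=> _ _ [s ps ->] [t pt ->]; exists (s * t); [exact: prime_notM | rewrite rmorphM].
- move=> _ [j [y [Jj Ey ->]]] [s ps jys].
  have /choice[X XP] : forall i, exists c : 'I_m -> A,
      (forall k, p (c k)) /\ y * e i = \sum_k phi (c k) * e k.
    by move=> i; have : extended_ideal (y * e i) by exact: idealMr.
  pose M : 'M[A]_m := s%:M - \matrix_(i, k) X i k.
  have pM : ~ p (\det M).
    by apply: det_scalar_sub_prime => // i k; rewrite mxE; have [] := XP i.
  pose pr : {rmorphism B -> rquot (Ideal hJ)} := rproj (Ideal hJ).
  have ann : forall i, (pr \o phi) (\det M) * pr (e i) = 0.
    apply: (@det_annihilates _ _ (pr \o phi : {rmorphism A -> _}) m M (fun i => pr (e i))) => i.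
    have [_ Xi] := XP i.
    transitivity (pr (phi s * e i - y * e i)).
      rewrite Xi rmorphB rmorph_sum.
      have ME k : M i k = s *+ (i == k) - X i k by rewrite !mxE.
      under eq_bigr => k _ do rewrite ME rmorphB mulrBl.
      rewrite sumrB; congr (_ - _); last by apply: eq_bigr => k _; rewrite [RHS]rmorphM.
      rewrite (bigD1 i) //= eqxx mulr1n big1 ?addr0 => [|k ki].
        by rewrite [RHS]rmorphM.
      by rewrite eq_sym (negbTE ki) mulr0n rmorph0 mul0r.
    apply/(rproj_eq0 (Ideal hJ)) => /=.
    by rewrite -mulrBl -jys addrK; exact: idealMr.
  apply: pM; apply: Jp; have [c c1] := gen 1.
  apply/(rproj_eq0 (Ideal hJ)); rewrite -[phi _]mulr1 c1 mulr_sumr.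
  rewrite (rmorph_sum pr) big1 // => i _.
  by rewrite mulrCA (rmorphM pr) [pr (phi _ * _)](rmorphM pr) [X in _ * X]ann mulr0.
exists q; split.
  move=> x Jx; apply: Iq; exists x, 0.
  by split=> //; [exact: ideal0 | rewrite addr0].
move=> a; split=> [qa|pa].
  by apply: contrapT => pa; apply: (qS _ qa); exists a.
apply: Iq; exists 0, (phi a); split; [exact: ideal0| |by rewrite add0r].
by rewrite -[phi a]mulr1; exact: extended_ideal_phi.
Qed.

End LyingOver.

Section LocalFreeness.
Variables (A B : comPzRingType) (phi : {rmorphism A -> B}) (m : nat) (e : 'I_m -> B).
Hypothesis gen : forall x, exists c : 'I_m -> A, x = \sum_i phi (c i) * e i.
Variables (F : fieldType) (tau : {rmorphism A -> F}) (sg : {rmorphism F -> A}).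
Hypothesis tausg : cancel sg tau.
Variables (n : nat) (d0 : algdata n F) (beta : {rmorphism B -> alg d0}).
Hypothesis betaphi : forall a, beta (phi a) = alg_C d0 (tau a).
Hypothesis beta_surj : forall y, exists x, beta x = y.
Variable p : prime_ideal A.
Hypothesis pE : forall a, p a <-> tau a = 0.
Hypothesis beta_ker : forall x, beta x = 0 -> extended_ideal phi e p x.
Hypothesis local_flat : forall (q : prime_ideal B), (forall a, q (phi a) <-> p a) ->
  forall k (a : 'I_k -> A) (b : 'I_k -> B), \sum_i phi (a i) * b i = 0 ->
  exists t r (v : 'I_r -> 'I_k -> A) (y : 'I_r -> B),
  [/\ ~ q t, forall l, exists2 s, ~ p s & s * \sum_i a i * v l i = 0
    & forall i, t * b i = \sum_l phi (v l i) * y l].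

Lemma basis_lift_ex : exists b : 'I_n -> B, forall j, beta (b j) = alg_e d0 j.
Proof.
have /choice[f fE] : forall j, exists x, beta x = alg_e d0 j by move=> j; exact: beta_surj.
by exists f.
Qed.

Let b := sval (cid basis_lift_ex).
Let bE j : beta (b j) = alg_e d0 j. Proof. exact: (svalP (cid basis_lift_ex)). Qed.

(** Nakayama with an explicit denominator: each generator differs from a combination of the [b j] by
    an element of [pB], and Cramer's rule solves for the generators up to a determinant congruent to
    1 modulo [p]. The section [sg] lifts the coordinates from [F] to [A]. *)
Lemma lift_span : exists2 s, ~ p s & forall x, exists a : 'I_n -> A,
  phi s * x = \sum_j phi (a j) * b j.
Proof.
have /choice[X XP] : forall i, exists c : 'I_m -> A, (forall k, p (c k)) /\
    e i - \sum_j phi (sg ((beta (e i)) 0 j)) * b j = \sum_k phi (c k) * e k.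
  move=> i; apply: beta_ker; rewrite rmorphB rmorph_sum.
  under eq_bigr => j _ do rewrite rmorphM betaphi tausg bE.
  by rewrite -alg_basisC subrr.
pose M : 'M[A]_m := 1%:M - \matrix_(i, k) X i k.
have pM : ~ p (\det M).
  by apply: det_scalar_sub_prime; [exact: prime_not1|move=> i k; rewrite mxE; have [] := XP i].
have key i : phi (\det M) * e i = \sum_k phi (\adj M i k) *
    (\sum_j phi (sg ((beta (e k)) 0 j)) * b j).
  apply: det_cramer => {}i; have [_ Xi] := XP i.
  have ME k : M i k = (i == k)%:R - X i k by rewrite !mxE.
  under eq_bigr => k _ do rewrite ME rmorphB mulrBl.
  rewrite sumrB -Xi (bigD1 i) //= eqxx rmorph1 mul1r big1 ?addr0 => [|k ki].
    by rewrite subKr.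
  by rewrite eq_sym (negbTE ki) rmorph0 mul0r.
exists (\det M) => // x; have [c ->] := gen x.
exists (fun j => \sum_i c i * \sum_k \adj M i k * sg ((beta (e k)) 0 j)).
rewrite mulr_sumr; under eq_bigr => i _ do rewrite mulrCA key.
under [RHS]eq_bigr => j _ do rewrite rmorph_sum mulr_suml.
rewrite exchange_big; apply: eq_bigr => i _ /=.
under [RHS]eq_bigr => j _ do rewrite rmorphM -mulrA rmorph_sum mulr_suml.
rewrite -mulr_sumr; congr (_ * _); rewrite exchange_big; apply: eq_bigr => k _ /=.
by rewrite mulr_sumr; apply: eq_bigr => j _; rewrite rmorphM mulrA.
Qed.

(** At each prime over [p], flatness writes [t * b i] through syzygies of [a] for some [t] outside
    that prime. The [t] that work form an ideal, so by lying over one of them is [phi s] with [s]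
    outside [p]. Re-expanding in the [b j] gives a matrix [X] that reduces to the scalar [s * u]
    modulo [p] and whose transpose kills [a] up to a denominator; its determinant lies outside
    [p]. *)
Lemma lift_independent (a : 'I_n -> A) : \sum_j phi (a j) * b j = 0 ->
  exists2 s, ~ p s & forall j, s * a j = 0.
Proof.
move=> ab0.
pose good t := exists r (v : 'I_r -> 'I_n -> A) (y : 'I_r -> B),
  (forall l, exists2 s, ~ p s & s * \sum_i a i * v l i = 0) /\
  forall i, t * b i = \sum_l phi (v l i) * y l.
have hgood : is_ideal good.
  split.
  - exists 0%N, (fun _ _ => 0), (fun _ => 0); split=> [[]//|i].
    by rewrite big_ord0 mul0r.
  - move=> t1 t2 [r1 [v1 [y1 [h1 e1]]]] [r2 [v2 [y2 [h2 e2]]]].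
    exists (r1 + r2)%N, (fun k => match fintype.split k with inl j => v1 j | inr j => v2 j end).
    exists (fun k => match fintype.split k with inl j => y1 j | inr j => y2 j end).
    split=> [k|i]; first by case: fintype.split.
    rewrite mulrDl e1 e2 big_split_ord /=; congr (_ + _); apply: eq_bigr => k _.
      by rewrite (unsplitK (inl k)).
    by rewrite (unsplitK (inr k)).
  - move=> c t [r [v [y [h et]]]]; exists r, v, (fun l => c * y l); split=> // i.
    by rewrite -mulrA et mulr_sumr; apply: eq_bigr => l _; rewrite mulrCA.
have [s [sgood ps]] : exists s, good (phi s) /\ ~ p s.
  apply: contrapT => h.
  have [|q [Jq qp]] := lying_over gen (p := p) hgood.
    by move=> s gs; apply: contrapT => ps; apply: h; exists s.
  have [t [r [v [y [qt hv et]]]]] := local_flat qp ab0.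
  by apply: qt; apply: Jq; exists r, v, y.
have [r [v [y [hv hs]]]] := sgood.
have [u pu ub] := lift_span.
have /choice[w wE] : forall l, exists w : 'I_n -> A, phi u * y l = \sum_j phi (w j) * b j.
  by move=> l; exact: ub.
pose X : 'M[A]_n := \matrix_(i, j) \sum_l v l i * w l j.
have Xb i : phi (s * u) * b i = \sum_j phi (X i j) * b j.
  rewrite rmorphM mulrAC hs mulr_suml.
  under eq_bigr => l _ do rewrite -mulrA [y l * _]mulrC wE mulr_sumr.
  rewrite exchange_big; apply: eq_bigr => j _ /=.
  by rewrite mxE rmorph_sum mulr_suml; apply: eq_bigr => l _; rewrite rmorphM mulrA.
have tauX i j : tau (X i j) = tau (s * u) *+ (i == j).
  have := congr1 beta (Xb i); rewrite rmorphM betaphi bE rmorph_sum.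
  under eq_bigr => k _ do rewrite rmorphM betaphi bE.
  rewrite alg_sum_row alg_CE => /(congr1 (fun x : alg d0 => x 0 j)); rewrite !mxE => <-.
  by rewrite eqxx /= eq_sym mulr_natr.
have pX : ~ p (\det X).
  rewrite pE -det_map_mx.
  have -> : map_mx tau X = (tau (s * u))%:M by apply/matrixP => i j; rewrite !mxE -tauX mxE.
  rewrite det_scalar => /eqP; rewrite expf_eq0 => /andP[_ /eqP] h.
  by apply: (prime_notM ps pu); apply/pE.
have /choice[z zP] : forall l, exists z, ~ p z /\ z * \sum_i a i * v l i = 0.
  by move=> l; have [z pz e0] := hv l; exists z.
pose Z := \prod_l z l.
have aX j : Z * \sum_i X i j * a i = 0.
  have -> : \sum_i X i j * a i = \sum_l w l j * \sum_i a i * v l i.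
    under [RHS]eq_bigr => l _ do rewrite mulr_sumr.
    rewrite exchange_big; apply: eq_bigr => i _ /=.
    by rewrite mxE mulr_suml; apply: eq_bigr => l _; ring.
  rewrite mulr_sumr big1 // => l _; rewrite mulrCA /Z (bigD1 l) //=.
  by rewrite mulrAC; have [_ ->] := zP l; rewrite mul0r mulr0.
exists (Z * \det X).
  by apply: prime_notM => //; apply: prime_not_prod => l; have [] := zP l.
move=> j; rewrite mulrAC -det_tr mulrC.
apply: (@det_annihilates _ _ (idfun : {rmorphism A -> A}) n X^T (fun j => Z * a j)) => {}j /=.
rewrite -[RHS](aX j) mulr_sumr; apply: eq_bigr => i _.
by rewrite mxE mulrCA.
Qed.

Let Ap : comNzRingType := localization p.

(** Coordinates of [x] in the localization of [B] at [p], expressed by clearing denominators.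
    [lift_span] gives their existence and [lift_independent] their uniqueness. *)
Definition coords (x : B) (v : 'I_n -> Ap) : Prop := exists s (a : 'I_n -> A),
  [/\ ~ p s, phi s * x = \sum_j phi (a j) * b j
    & forall j, loc_map p s * v j = loc_map p (a j)].

Lemma coords_ex x : exists v, coords x v.
Proof.
have [s ps sb] := lift_span; have [a ax] := sb x.
exists (fun j => frac (a j) ps), s, a; split=> // j.
exact: frac_loc_map.
Qed.

Lemma coords_unique x v w : coords x v -> coords x w -> forall j, v j = w j.
Proof.
move=> [s [a [ps sa va]]] [t [c [pt tc wc]]] j.
have [|u pu hu] := @lift_independent (fun i => t * a i - s * c i).
  under eq_bigr => i _ do rewrite rmorphB !rmorphM mulrBl -!mulrA.
  by rewrite sumrB -!mulr_sumr -sa -tc; ring.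
apply: (@invertible_mulI _ (loc_map p (s * t))).
  exact/loc_map_invertible/prime_notM.
rewrite rmorphM /=; transitivity (loc_map p (t * a j)).
  by rewrite rmorphM /= -va; ring.
transitivity (loc_map p (s * c j)); last by rewrite rmorphM /= -wc; ring.
apply/loc_map_eq; exists u => //; apply/eqP; rewrite -subr_eq0 -mulrBr; apply/eqP.
exact: hu.
Qed.

Let kappa x := sval (cid (coords_ex x)).
Let kappaP x : coords x (kappa x). Proof. exact: (svalP (cid (coords_ex x))). Qed.
Let kappaE x v : coords x v -> forall j, kappa x j = v j.
Proof. by move=> h; apply: coords_unique h; exact: kappaP. Qed.

Lemma coordsB x y v w : coords x v -> coords y w -> coords (x - y) (fun j => v j - w j).
Proof.
move=> [s [a [ps sa va]]] [t [c [pt tc wc]]].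
exists (s * t), (fun j => t * a j - s * c j); split; first exact: prime_notM.
  under eq_bigr => j _ do rewrite rmorphB !rmorphM mulrBl -!mulrA.
  by rewrite sumrB -!mulr_sumr -sa -tc rmorphM; ring.
by move=> j; rewrite rmorphM rmorphB !rmorphM /= -va -wc; ring.
Qed.

Lemma coords_basis i : coords (b i) (fun j => (i == j)%:R).
Proof.
exists 1, (fun j => (i == j)%:R); split; first exact: prime_not1.
  rewrite rmorph1 mul1r (bigD1 i) //= eqxx rmorph1 mul1r big1 ?addr0 // => j ji.
  by rewrite eq_sym (negbTE ji) rmorph0 mul0r.
by move=> j; rewrite rmorph1 mul1r rmorph_nat.
Qed.

Lemma coordsM x y :
  coords (x * y) (fun l => \sum_i \sum_j kappa x i * kappa y j * kappa (b i * b j) l).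
Proof.
have [s [a [ps sa va]]] := kappaP x; have [t [c [pt tc wc]]] := kappaP y.
have [u pu ub] := lift_span.
have /choice[g gE] : forall ij : 'I_n * 'I_n, exists g : 'I_n -> A,
    phi u * (b ij.1 * b ij.2) = \sum_l phi (g l) * b l by move=> ij; exact: ub.
have kg i j l : loc_map p u * kappa (b i * b j) l = loc_map p (g (i, j) l).
  have /kappaE -> : coords (b i * b j) (fun l => frac (g (i, j) l) pu).
    exists u, (g (i, j)); split=> [//||k]; last exact: frac_loc_map.
    exact: (gE (i, j)).
  exact: frac_loc_map.
exists (s * t * u), (fun l => \sum_i \sum_j a i * c j * g (i, j) l); split.
- by do 2?[apply: prime_notM => //].
- transitivity ((phi s * x) * (phi t * y) * phi u); first by rewrite !rmorphM; ring.
  rewrite sa tc mulr_suml mulr_suml.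
  under [RHS]eq_bigr => l _ do rewrite rmorph_sum mulr_suml.
  rewrite exchange_big; apply: eq_bigr => i _ /=.
  rewrite mulr_sumr mulr_suml.
  under [RHS]eq_bigr => l _ do rewrite rmorph_sum mulr_suml.
  rewrite exchange_big; apply: eq_bigr => j _ /=.
  transitivity (phi (a i) * phi (c j) * (phi u * (b i * b j))); first by ring.
  by rewrite (gE (i, j)) mulr_sumr; apply: eq_bigr => l _; rewrite !rmorphM mulrA.
move=> l; rewrite mulr_sumr rmorph_sum; apply: eq_bigr => i _.
rewrite mulr_sumr rmorph_sum; apply: eq_bigr => j _.
by rewrite !rmorphM /= -va -wc -kg; ring.
Qed.

Lemma kappaM x y l :
  kappa (x * y) l = \sum_i \sum_j kappa x i * kappa y j * kappa (b i * b j) l.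
Proof. exact: (kappaE (coordsM x y)). Qed.

Lemma kappaMb x j l : kappa (x * b j) l = \sum_i kappa x i * kappa (b i * b j) l.
Proof.
rewrite kappaM; apply: eq_bigr => i _; rewrite (bigD1 j) //= big1 ?addr0 => [|k kj].
  by rewrite (kappaE (coords_basis j)) eqxx mulr1.
by rewrite (kappaE (coords_basis j)) eq_sym (negbTE kj) mulr0 mul0r.
Qed.

Let dp0 (i : sidx n) : Ap :=
  match i with inl (i, j, l) => kappa (b i * b j) l | inr i => kappa 1 i end.

Lemma dp0P a : alg_rel dp0 a -> a = 0.
Proof.
rewrite /alg_rel /sc /su /=; case=> [[i [j [k [l ->]]]]|[i [j [l ->]]]|[j [l ->]]].
- rewrite -kappaMb.
  under eq_bigr => m' _ do rewrite [b i * b m']mulrC.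
  by rewrite -kappaMb -mulrA [b j * b k * b i]mulrC subrr.
- by rewrite mulrC subrr.
- by rewrite -kappaMb mul1r (kappaE (coords_basis j)) subrr.
Qed.

Let dp : algdata n Ap := AlgData dp0P.

(* [alg dp] is the localization of [B] at [p], a free module over [A] at [p]. *)
Lemma local_free : exists (dp : algdata n (localization p))
    (ka : {rmorphism B -> alg dp}) (taup : {rmorphism localization p -> F}),
  [/\ forall a, taup (loc_map p a) = tau a,
      map_data taup dp = d0,
      forall a, ka (phi a) = alg_C dp (loc_map p a),
      forall (G : comPzRingType) (h h' : {rmorphism alg dp -> G}),
      (forall x, h (ka x) = h' (ka x)) ->
      (forall y, h (alg_C dp y) = h' (alg_C dp y)) -> h =1 h'
    & forall (G : comPzRingType) (xi : {rmorphism B -> G}) (kc : {rmorphism localization p -> G}),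
      (forall a, xi (phi a) = kc (loc_map p a)) ->
      exists h : {rmorphism alg dp -> G},
      (forall x, h (ka x) = xi x) /\ forall y, h (alg_C dp y) = kc y].
Proof.
have [|taup taupE] := @loc_lift A p F tau.
  by move=> a pa; apply/invertible_field/eqP => ta; apply: pa; apply/pE.
have [||ka kaE] := @rmorphism_of B (alg dp) (fun x => \row_j kappa x j).
- move=> x y; apply/rowP => j; rewrite !mxE.
  exact: (kappaE (coordsB (kappaP x) (kappaP y))).
- split; first by apply/rowP => j; rewrite [RHS]alg_oneE [LHS]mxE.
  move=> x y; apply/rowP => l; rewrite mxE alg_mulE kappaM.
  by apply: eq_bigr => i _; apply: eq_bigr => j _; rewrite !mxE.
have taus s : ~ p s -> tau s != 0 by move=> ps; apply/eqP => ts; apply: ps; apply/pE.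
have taukappa x l : taup (kappa x l) = (beta x) 0 l.
  have [s [a [ps sa va]]] := kappaP x.
  apply: (mulfI (taus s ps)); rewrite -{1}taupE -rmorphM va taupE.
  have := congr1 beta sa; rewrite rmorphM betaphi rmorph_sum.
  under eq_bigr => k _ do rewrite rmorphM betaphi bE.
  rewrite alg_sum_row alg_CE => /(congr1 (fun x : alg d0 => x 0 l)).
  by rewrite [LHS]mxE [RHS]mxE => ->.
exists dp, ka, taup; split=> //.
- apply: algdata_eq => -[[[i j] l]|i] /=.
    by rewrite taukappa rmorphM !bE alg_e_mul summxE (bigD1 l) //= big1 ?addr0 => [|k kl];
      rewrite mxE alg_eE ?eqxx ?mulr1 // (negbTE kl) mulr0.
  by rewrite taukappa rmorph1 alg_oneE.
- move=> a; rewrite kaE; apply/rowP => j; rewrite mxE alg_C_coef.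
  apply: (kappaE (v := fun j => loc_map p a * kappa 1 j)).
  have [s [c [ps sc vc]]] := kappaP 1.
  exists s, (fun j => a * c j); split=> // [|k].
    rewrite -[phi a]mulr1 mulrCA sc mulr_sumr.
    by apply: eq_bigr => k _; rewrite rmorphM mulrA.
  by rewrite rmorphM /= -vc; ring.
- move=> G h h' hka hC; apply: alg_hom_ext => // i.
  have -> : alg_e dp i = ka (b i); last exact: hka.
  by rewrite kaE; apply/rowP => j; rewrite alg_eE mxE (kappaE (coords_basis i)).
move=> G xi kc xikc.
have xiE x : xi x = \sum_l kc (kappa x l) * xi (b l).
  have [s [a [ps sa va]]] := kappaP x.
  apply: (@invertible_mulI _ (kc (loc_map p s))).
    by apply: invertible_morph; apply/loc_map_invertible.
  rewrite -{1}xikc -rmorphM sa rmorph_sum mulr_sumr; apply: eq_bigr => l _.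
  by rewrite rmorphM xikc -va rmorphM mulrA.
have [||h [hE hC he]] := @alg_lift n Ap dp G kc (fun j => xi (b j)).
- by move=> i j; rewrite -rmorphM xiE.
- by rewrite -(rmorph1 xi) [in RHS]xiE.
exists h; split=> // x; rewrite hE kaE xiE.
by apply: eq_bigr => l _; rewrite mxE.
Qed.

End LocalFreeness.

(** Open immersions identify the stalks of [T] and [Z] with localizations of [A] and [B]; the
    equational criterion is applied in these stalks and its data are brought back to [A] and [B] by
    common denominators. *)
Lemma stalk_relation (A B : comPzRingType) (phi : {rmorphism A -> B}) (Z T : scheme)
    (f : morphism Z T) (j : morphism (Spec A) T) (i : morphism (Spec B) Z) :
  open_immersion j -> open_immersion i -> f \om i = j \om Spec_map phi ->
  flat_morphism f -> forall (q : prime_ideal B) k (a : 'I_k -> A) (b : 'I_k -> B),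
  \sum_l phi (a l) * b l = 0 ->
  exists t r (v : 'I_r -> 'I_k -> A) (y : 'I_r -> B),
  [/\ ~ q t, forall l, exists2 s, ~ q (phi s) & s * \sum_c a c * v l c = 0
    & forall c, t * b c = \sum_l phi (v l c) * y l].
Proof.
move=> hj hi fi fflat q k a b ab0.
pose p := comap phi q; pose x : Spec B := q; pose y0 : Spec A := p.
have [_ _ jbij] := hj; have [_ _ ibij] := hi.
have fx : f (i x) = j y0 by exact: (mfun_eq fi x).
have sq (s : forall z : T, stalk z) :
    stalk_map i x (stalk_map f (i x) (s (f (i x)))) =
    @localization_map _ _ phi q (stalk_map j y0 (s (j y0))).
  exact: (stalk_map_eq fi x s).
have [ji jiK Kji] := jbij y0; have [ii iiK Kii] := ibij x.
have /choice[al alE] : forall c, exists s : forall z : T, stalk z,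
    stalk_map j y0 (s (j y0)) = loc_map p (a c).
  by move=> c; have [s sE] := extend_germ (ji (loc_map p (a c))); exists s; rewrite sE Kji.
pose mb c := ii (loc_map q (b c)).
have rel0 : \sum_c stalk_map f (i x) (al c (f (i x))) * mb c = 0.
  apply: (can_inj iiK); rewrite rmorph0 rmorph_sum.
  transitivity (loc_map q (\sum_c phi (a c) * b c)); last by rewrite ab0 rmorph0.
  rewrite [RHS]rmorph_sum; apply: eq_bigr => c _.
  by rewrite rmorphM sq alE Kii [RHS]rmorphM; congr (_ * _); exact: localization_map_loc_map.
have [r [v [y [hv hm]]]] := flat_hom_relation (fflat (i x)) rel0.
have /choice[w wE] : forall lc : 'I_r * 'I_k, exists s : forall z : T, stalk z,
    s (f (i x)) = v lc.1 lc.2.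
  by move=> lc; exact: extend_germ.
pose V lc : localization p := stalk_map j y0 (w lc (j y0)).
have VE l c : @localization_map _ _ phi q (V (l, c)) = stalk_map i x (stalk_map f (i x) (v l c)).
  by rewrite -(wE (l, c)) sq.
have V0 l : \sum_c loc_map p (a c) * V (l, c) = 0.
  have w0 : \sum_c al c (j y0) * w (l, c) (j y0) = 0.
    rewrite -fx -[RHS](hv l); apply: eq_bigr => c _.
    by rewrite (wE (l, c)).
  rewrite -[RHS](rmorph0 (stalk_map j y0)) -w0 rmorph_sum; apply: eq_bigr => c _.
  by rewrite rmorphM alE.
have [s [v' [ps v'E]]] := common_denominator V.
have [u [y' [qu y'E]]] := common_denominator (fun l => stalk_map i x (y l) : localization q).
have key c : exists2 u', ~ q u' &
    u' * (phi s * u * b c) = u' * \sum_l phi (v' (l, c)) * y' l.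
  apply/loc_map_eq; rewrite !rmorphM rmorph_sum /=.
  have -> : loc_map q (b c) = \sum_l stalk_map i x (stalk_map f (i x) (v l c) * y l).
    by rewrite -rmorph_sum -hm /mb Kii.
  rewrite mulr_sumr; apply: eq_bigr => l _.
  rewrite rmorphM [RHS]rmorphM /= -(localization_map_loc_map phi q s) -(localization_map_loc_map phi q) -v'E -y'E -VE.
  by rewrite rmorphM; ring.
have /choice[u' u'P] : forall c, exists u', ~ q u' /\
    u' * (phi s * u * b c) = u' * \sum_l phi (v' (l, c)) * y' l.
  by move=> c; have [u' qu' e] := key c; exists u'.
(* Each equation holds in the localization only, that is after multiplication by some [u' c]; the
   product serves all indices at once. *)
pose U := \prod_c u' c.
have qU : ~ q U by apply: prime_not_prod => c; have [] := u'P c.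
exists (U * phi s * u), r, (fun l c => v' (l, c)), (fun l => U * y' l); split.
- by do 2?[apply: prime_notM => //].
- move=> l; have /loc_map_eq0[z pz z0] : loc_map p (\sum_c a c * v' (l, c)) = 0.
    transitivity (loc_map p s * \sum_c loc_map p (a c) * V (l, c)); last by rewrite V0 mulr0.
    rewrite rmorph_sum mulr_sumr; apply: eq_bigr => c _.
    by rewrite rmorphM /= -v'E; ring.
  by exists z.
move=> c; have [_ e] := u'P c.
transitivity (\prod_(c' | c' != c) u' c' * (u' c * (phi s * u * b c))).
  by rewrite /U (bigD1 c) //=; ring.
rewrite e mulrA; have <- : U = \prod_(c' | c' != c) u' c' * u' c.
  by rewrite /U (bigD1 c) //= mulrC.
by rewrite mulr_sumr; apply: eq_bigr => l _; rewrite mulrCA.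
Qed.

(** What a smoothing leaves behind: an algebra free over the local ring of [T] at [t], with special
    fibre [d0] on the given basis, and a map from that local ring to [K] under which its
    discriminant is nonzero. *)
Lemma smoothable_family_data (F : fieldType) n (d0 : algdata n F) (R : scheme)
    (rho : morphism R (Spec F)) (r : morphism (Spec (alg d0)) R) s :
  iso_pair r s -> rho \om r = Spec_map (alg_C d0) -> smoothable rho ->
  exists (A : comPzRingType) (p : prime_ideal A) (dp : algdata n (localization p))
    (sg : {rmorphism F -> A}) (taup : {rmorphism localization p -> F})
    (K : fieldType) (al : {rmorphism localization p -> K}),
  [/\ forall c, taup (loc_map p (sg c)) = c,
      forall a, ~ p a <-> taup (loc_map p a) != 0,
      map_data taup dp = d0 & disc (map_data al dp) != 0].
Proof.
move=> rs er [T [Z [sT [f [[hT irrT] hZ [fflat ffin] [t [iR [tT fib]]]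
  [eta [K [g [W [v [w [geta gres fibW smW]]]]]]]]]]]].
have [o _] := point_field_ex F; have [oK _] := point_field_ex K.
(* One chart around the image of [t] suffices, since the generic point lies in it as well. *)
have [A [B [phi [j [i [[hj jt hi] irange fi fin]]]]]] := ffin (t o).
have tj (x : Spec F) : range j (t x) by rewrite (point_field_eq x o).
have [t' t'E] := open_immersion_factor hj tj; have [tau tauE] := spec_full t'.
have [sg sgE] := spec_full (sT \om j).
have jmono (C : comPzRingType) (h h' : {rmorphism A -> C}) :
    j \om Spec_map h = j \om Spec_map h' -> h =1 h'.
  by move=> e; apply: spec_faithful; exact: (open_immersion_mono hj e).
have imono (C : comPzRingType) (h h' : {rmorphism B -> C}) :
    i \om Spec_map h = i \om Spec_map h' -> h =1 h'.
  by move=> e; apply: spec_faithful; exact: (open_immersion_mono hi e).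
have ifactor (C : comPzRingType) (z : morphism (Spec C) Z) :
    (forall x, range j ((f \om z) x)) -> exists h : {rmorphism B -> C}, i \om Spec_map h = z.
  move=> hz; have [|z' z'E] := open_immersion_factor (f := z) hi.
    by move=> x; rewrite irange; exact: hz.
  by have [h hE] := spec_full z'; exists h; rewrite -hE.
have tausg : cancel sg tau.
  apply: (spec_faithful (f := tau \o sg) (g := idfun)).
  rewrite Spec_map_comp -sgE -comp_morphismA -tauE t'E tT.
  by apply/esym/Spec_map_id.
pose p := comap tau o.
have pE a : p a <-> tau a = 0 by exact: (prime_field o (tau a)).
have tE : t = j \om Spec_map tau by rewrite -tauE t'E.
have [fibsq fibun] := fib.
(* Testing the fibre product against [B / pB] identifies [B / pB] with [alg d0]. *)
have zr : f \om (iR \om r) = t \om Spec_map (alg_C d0).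
  by rewrite comp_morphismA fibsq -comp_morphismA er.
have [|beta betaE] := ifactor _ (iR \om r).
  by move=> x; rewrite zr; exact: tj.
have betaphi : (beta \o phi : {rmorphism _ -> _}) =1 (alg_C d0 \o tau : {rmorphism _ -> _}).
  apply: jmono; rewrite !Spec_map_comp !comp_morphismA -fi -tE -zr.
  by rewrite -betaE !comp_morphismA.
have [m [e gen]] := fin.
have {}gen x : exists c : 'I_m -> A, x = \sum_i phi (c i) * e i by exact: (gen x).
pose I := Ideal (extended_ideal_ideal gen p).
pose D : comPzRingType := rquot I; pose ga : {rmorphism B -> D} := rproj I.
pose psi : {rmorphism F -> D} := ga \o (phi \o sg).
have gaphi : (ga \o phi : {rmorphism _ -> _}) =1 (psi \o tau : {rmorphism _ -> _}).
  move=> a; apply/(rproj_eq I); rewrite -rmorphB -[phi _]mulr1.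
  by apply: (extended_ideal_phi gen); apply/pE; rewrite rmorphB tausg subrr.
have [|zeta [[zeta1 zeta2] _]] := fibun (Spec D) (i \om Spec_map ga) (Spec_map psi).
  rewrite comp_morphismA fi -comp_morphismA -Spec_map_comp tE -comp_morphismA -Spec_map_comp.
  by rewrite (Spec_map_eq gaphi).
have [de deE] := spec_full (s \om zeta).
have rde : r \om Spec_map de = zeta by rewrite -deE comp_morphismA rs.1 comp_1morphism.
(* This puts the kernel of [beta] inside [pB]; the one-sided inverse [bbde] below yields the
   surjectivity of [beta]. *)
have gade : ga =1 (de \o beta : {rmorphism _ -> _}).
  apply: imono; rewrite Spec_map_comp comp_morphismA betaE -zeta1 -rde.
  by rewrite !comp_morphismA.
have beta_ker x : beta x = 0 -> extended_ideal phi e p x.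
  by move=> bx; apply/(rproj_eq0 I); rewrite [LHS]gade /= bx rmorph0.
have [|bb bbE] := @rquot_lift _ _ I beta.
  move=> _ [c [pc ->]]; rewrite rmorph_sum big1 // => l _.
  have := betaphi (c l); rewrite /= rmorphM => ->.
  by have /pE -> := pc l; rewrite rmorph0 mul0r.
have bbde : (bb \o de : {rmorphism _ -> _}) =1 (idfun : {rmorphism alg d0 -> alg d0}).
  apply: spec_faithful; rewrite Spec_map_comp [RHS]Spec_map_id //.
  have rmono : forall h h' : morphism (Spec (alg d0)) (Spec (alg d0)), r \om h = r \om h' -> h = h'.
    by move=> h h'; apply: (section_mono rs.2).
  apply: rmono; rewrite comp_morphism1 comp_morphismA rde.
  apply: (fibre_product_hom_ext fib).
    rewrite comp_morphismA zeta1 -comp_morphismA -Spec_map_comp -betaE.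
    by congr (i \om _); apply: Spec_map_eq => x /=; exact: bbE.
  rewrite comp_morphismA zeta2 er -Spec_map_comp; apply: Spec_map_eq => c /=.
  by rewrite [LHS]bbE; have := betaphi (sg c); rewrite /= tausg.
have beta_surj y : exists x, beta x = y.
  have [x xE] := rproj_surj (de y); exists x.
  by rewrite -bbE -[rproj I x]xE; exact: bbde.
have lflat (q : prime_ideal B) : (forall a, q (phi a) <-> p a) ->
    forall k (a : 'I_k -> A) (b : 'I_k -> B), \sum_i phi (a i) * b i = 0 ->
    exists t r (v : 'I_r -> 'I_k -> A) (y : 'I_r -> B),
    [/\ ~ q t, forall l, exists2 s, ~ p s & s * \sum_i a i * v l i = 0
      & forall i, t * b i = \sum_l phi (v l i) * y l].
  move=> qp k a b ab0; have [t1 [r1 [v1 [y1 [h1 h2 h3]]]]] := stalk_relation hj hi fi fflat q ab0.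
  exists t1, r1, v1, y1; split=> // l; have [s1 hs1 e1] := h2 l.
  by exists s1 => //; rewrite -qp.
have [dp [ka [taup [taupE dpd0 kaphi kaU push]]]] :=
  local_free gen tausg betaphi beta_surj pE beta_ker lflat.
(* [eta] lies in every nonempty open set, so [g] factors through [Spec A] and inverts
   the complement of [p]. *)
have [_ jo _] := hj.
have eta_open (U : set (Spec A)) : open U -> U p -> exists2 x, U x & j x = eta.
  move=> Uo Up; have jUo := jo U Uo.
  have : closure [set eta] (j p) by rewrite geta.
  move=> /(_ (j @` U)) []; first by rewrite nbhsE; exists (j @` U) => //; split=> //; exists p.
  by move=> _ [-> [x Ux jx]]; exists x.
have geta' (x : Spec K) : g x = eta by have [] := gres x.
have [|g' g'E] := open_immersion_factor (f := g) hj.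
  move=> x; rewrite geta'; have [y _ <-] := eta_open setT openT (Logic.I).
  by exists y.
have [al0 al0E] := spec_full g'.
have gE : g = j \om Spec_map al0 by rewrite -al0E g'E.
have al0p a : ~ p a -> invertible (al0 a).
  move=> pa; apply/invertible_field/eqP => ala.
  have [x xa jx] := eta_open _ (open_basic a) pa.
  apply: xa; have -> : x = comap al0 oK.
    by have [jinj _ _] := hj; apply: jinj; rewrite jx -(geta' oK) gE.
  exact/(prime_field oK (al0 a)).
have [al alE] := loc_lift al0p.
have tausE a : ~ p a <-> taup (loc_map p a) != 0.
  rewrite taupE pE; split; first by move/eqP.
  by move=> h; apply/eqP.
exists A, p, dp, sg, taup, K, al; split=> //; first by move=> c; rewrite taupE tausg.
apply: formally_smooth_disc => C C0 pi pis sq kc e0 e0E.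
have [fibWsq fibWun] := fibW.
(* [W] is known only by its universal property. The lifting problem for the generic fibre algebra is
   turned into a [C0]-point of [W], lifted there by smoothness, read back as a map from [B] to [C],
   and extended by [push] and [alg_pushout]. *)
pose e1 : {rmorphism B -> C0} := e0 \o (@alg_map _ _ _ al dp \o ka).
have e1phi : (e1 \o phi : {rmorphism _ -> _}) =1 (pi \o kc \o al0 : {rmorphism _ -> _}).
  by move=> a; rewrite /= kaphi alg_map_C e0E alE.
have [|x0 [[x0v x0w] _]] := fibWun (Spec C0) (i \om Spec_map e1)
    (Spec_map (pi \o kc : {rmorphism K -> C0})).
  rewrite comp_morphismA fi -comp_morphismA -Spec_map_comp gE -comp_morphismA -Spec_map_comp.
  by rewrite (Spec_map_eq e1phi).
have [x [xw xpi]] := smW.2 C C0 pi pis sq (Spec_map kc) x0 (etrans x0w (Spec_map_comp kc pi)).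
have [|xi xiE] := ifactor _ (v \om x).
  move=> y; rewrite comp_morphismA fibWsq -comp_morphismA xw /= geta'.
  by have [z _ <-] := eta_open setT openT (Logic.I); exists z.
have xiphi : (xi \o phi : {rmorphism _ -> _}) =1 (kc \o al0 : {rmorphism _ -> _}).
  apply: jmono; rewrite !Spec_map_comp !comp_morphismA -fi -gE -xw.
  by rewrite [RHS]comp_morphismA -fibWsq -[RHS]comp_morphismA -xiE comp_morphismA.
have [|h1 [h1ka h1C]] := push C xi (kc \o al : {rmorphism _ -> _}).
  by move=> a; have := xiphi a; rewrite /= alE.
have [|h [hm hC]] := alg_pushout (f := al) (d := dp) (a := h1) (b := kc); first by [].
exists h; split=> //; apply: (alg_map_hom_ext (h := pi \o h : {rmorphism _ -> _})) => [y|y] /=;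
  last by rewrite hC e0E.
rewrite hm; apply: (kaU _ (pi \o h1 : {rmorphism _ -> _}) (e0 \o @alg_map _ _ _ al dp : {rmorphism _ -> _})) => [z|z] /=.
  rewrite h1ka; apply: (imono _ (pi \o xi : {rmorphism _ -> _}) e1).
  by rewrite Spec_map_comp comp_morphismA xiE -comp_morphismA xpi.
by rewrite h1C /= alg_map_C e0E.
Qed.

Lemma criterion_of_smoothable (F : fieldType) n (d0 : algdata n F) (R : scheme)
    (rho : morphism R (Spec F)) (r : morphism (Spec (alg d0)) R) s :
  iso_pair r s -> rho \om r = Spec_map (alg_C d0) -> smoothable rho -> disc_criterion d0.
Proof.
move=> rs er sm.
have [A [p [dp [sg [taup [K [al [taupsg taupE dpd0 discK]]]]]]]] := smoothable_family_data rs er sm.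
have [h [_ hC hX]] := mpoly_lift (loc_map p \o sg : {rmorphism F -> localization p})
  (dp \o enum_val : 'I_(nvars n) -> _).
have hgen : h \o @generic_data F n = dp.
  by apply/funext => i; rewrite /= hX /= enum_rankK.
pose alh : {rmorphism sc_poly F n -> K} := al \o h.
have pP : is_prime_ideal [set f | alh f = 0].
  split.
  - exact: kernel_ideal.
  - by rewrite /mkset rmorph1; apply/eqP; exact: oner_neq0.
  - move=> a b; rewrite /mkset rmorphM => /eqP; rewrite mulf_eq0.
    by move=> /orP[] /eqP; [left | right].
exists (PrimeIdeal pP); split=> /=.
- move=> a ra; rewrite /mkset /= (_ : h a = 0) ?rmorph0 //.
  apply: (@adataP _ _ dp); rewrite -hgen; apply/alg_rel_map.
  by exists a.
- rewrite /mkset /= -(disc_map h) hgen -(disc_map al); exact/eqP.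
move=> f /= hf; have [e [eE eC eX]] := mpoly_lift (idfun : {rmorphism F -> F})
  (d0 \o enum_val : 'I_(nvars n) -> F).
rewrite -[LHS]eE.
have -> : e f = taup (h f).
  apply: (mpoly_hom_ext (h' := taup \o h : {rmorphism _ -> _})) => [c|i] /=.
    by rewrite eC hC /= taupsg.
  by rewrite eX hX -dpd0.
(* A function not vanishing at the marked point is a unit of the local ring, so it cannot lie in the
   kernel of the map to [K]. *)
apply: contrapT => tf; have hfinv : invertible (h f).
  have [a [b [pb ab]]] := loc_surj (h f).
  have : invertible (loc_map p a).
    apply/loc_map_invertible/taupE; rewrite -ab rmorphM mulf_neq0 //; last exact/eqP.
    exact/taupE.
  by rewrite -ab => /invertibleM[].
have := invertible_morph al hfinv; rewrite [al _]hf => -[z].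
by rewrite mul0r => /eqP; rewrite eq_sym oner_eq0.
Qed.

(** * Base change of the criterion *)

(** A maximal [k]-subspace [X] missing [z] is a complement of the line through [z]; [lam y] is the
    coefficient of [z] in [y] modulo [X]. *)
Lemma exists_functional (k K : fieldType) (iota : {rmorphism k -> K}) (z : K) : z != 0 ->
  exists lam : {additive K -> k},
    (forall a x, lam (iota a * x) = a * lam x) /\ lam z = 1.
Proof.
move=> z0; pose good (X : set K) := [/\ forall x y, X x -> X y -> X (x + y),
  forall a x, X x -> X (iota a * x) & ~ X z].
have [G Ggood Gtot|X [gX Xmax]] := @Zorn_bigcup K good.
  split.
  - move=> x y [V GV Vx] [W GW Wy]; have [VW|WV] := Gtot _ _ GV GW.
      by exists W => //; have [h _ _] := Ggood W GW; apply: h => //; exact: VW.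
    by exists V => //; have [h _ _] := Ggood V GV; apply: h => //; exact: WV.
  - by move=> a x [V GV Vx]; exists V => //; have [_ h _] := Ggood V GV; exact: h.
  - by move=> [V GV Vz]; have [_ _ h] := Ggood V GV.
have max (Y : set K) : good Y -> X `<=` Y -> Y `<=` X.
  move=> gY XY; apply: contrapT => YX; exact: (Xmax Y).
have [XD XZ Xz] := gX.
(* [good] does not require 0, so that the empty chain has a good union; maximality supplies it. *)
have X0 : X 0.
  apply: (max (X `|` [set 0])); [split | by left | by right].
  - move=> x y [Xx|->] [Xy|->]; rewrite ?add0r ?addr0; [left|left|left|right] => //.
    exact: XD.
  - by move=> a x [Xx|->]; [left; exact: XZ | right; rewrite mulr0].
  - by move=> [//|/eqP]; apply/negP.
have XN x : X x -> X (- x) by move=> /(XZ (-1)); rewrite rmorphN rmorph1 mulN1r.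
have /choice[lam0 lamE] : forall y, exists c, X (y - iota c * z).
  move=> y; have [Xy|Xy] := pselect (X y).
    by exists 0; rewrite rmorph0 mul0r subr0.
  pose Y := [set w | exists x c, X x /\ w = x + iota c * y].
  have [x [c [Xx zE]]] : Y z.
    apply: contrapT => nz; apply: Xy; apply: (max Y).
    - split=> //.
        move=> _ _ [x [c [Xx ->]]] [x' [c' [Xx' ->]]].
        by exists (x + x'), (c + c'); split; [exact: XD | rewrite rmorphD; ring].
      move=> a _ [x [c [Xx ->]]]; exists (iota a * x), (a * c).
      by split; [exact: XZ | rewrite rmorphM; ring].
    - by move=> x Xx; exists x, 0; rewrite rmorph0 mul0r addr0.
    - by exists 0, 1; rewrite rmorph1 mul1r add0r.
  have c0 : c != 0.
    by apply/eqP => c0; apply: Xz; rewrite zE c0 rmorph0 mul0r addr0.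
  exists c^-1; have -> : y - iota c^-1 * z = - (iota c^-1 * x).
    by rewrite zE mulrDr mulrA -rmorphM mulVf // rmorph1; ring.
  exact/XN/XZ.
have uniq c c' y : X (y - iota c * z) -> X (y - iota c' * z) -> c = c'.
  move=> h h'; apply: contrapT => /eqP; rewrite -subr_eq0 => cc'; apply: Xz.
  have /(XZ (c - c')^-1) : X ((iota c - iota c') * z).
    have -> : (iota c - iota c') * z = (y - iota c' * z) + - (y - iota c * z) by ring.
    by apply: XD => //; exact: XN.
  by rewrite -rmorphB mulrA -rmorphM mulVf // rmorph1 mul1r.
have lamB : zmod_morphism lam0.
  move=> x y; apply: uniq (lamE _) _.
  have -> : x - y - iota (lam0 x - lam0 y) * z =
      (x - iota (lam0 x) * z) + - (y - iota (lam0 y) * z).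
    by rewrite rmorphB; ring.
  by apply: XD => //; exact: XN.
pose lam : {additive K -> k} := HB.pack lam0 (GRing.isZmodMorphism.Build K k lam0 lamB).
exists lam; split=> [a x|]; apply: uniq (lamE _) _; last by rewrite rmorph1 mul1r subrr.
have -> : iota a * x - iota (a * lam0 x) * z = iota a * (x - iota (lam0 x) * z).
  by rewrite rmorphM; ring.
exact: XZ.
Qed.

Section CriterionBaseChange.
Variables (k K : fieldType) (iota : {rmorphism k -> K}) (n : nat) (d : algdata n k).

Let emb := @mpoly.map_mpoly (nvars n) k K iota.

Lemma map_mpoly_hom : exists f : {rmorphism sc_poly k n -> sc_poly K n},
  [/\ f =1 emb, forall c, f (mpoly.mpolyC _ c) = mpoly.mpolyC _ (iota c)
    & f \o @generic_data k n = @generic_data K n].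
Proof.
have [f [fE fC fX]] := mpoly_lift (mpoly.mpolyC (nvars n) (R := K) \o iota : {rmorphism k -> sc_poly K n})
  (@mpX (nvars n) K).
by exists f; split=> //; apply/funext => i; exact: fX.
Qed.

Lemma disc_criterion_descent : disc_criterion (iota \o d) -> disc_criterion d.
Proof.
move=> [P [Prel Pdisc Pev]]; have [f [_ fC fgen]] := map_mpoly_hom.
have fX i : f (mpX k i) = mpX K i.
  by have := congr1 (fun g => g (enum_val i)) fgen; rewrite /= /generic_data enum_valK.
exists (comap f P); split.
- move=> a ra; apply: Prel; rewrite -fgen; apply/alg_rel_map.
  by exists a.
- by move=> /= h; apply: Pdisc; rewrite -fgen (disc_map f).
move=> p /= /Pev h.
have [e [eE eC eX]] := mpoly_lift (idfun : {rmorphism k -> k}) (d \o enum_val : 'I_(nvars n) -> k).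
have [e' [e'E e'C e'X]] := mpoly_lift (idfun : {rmorphism K -> K})
  ((iota \o d) \o enum_val : 'I_(nvars n) -> K).
apply/eqP; rewrite -(fmorph_eq0 iota) -eE; apply/eqP; rewrite -[RHS]h -e'E.
apply: (mpoly_hom_ext (h := iota \o e : {rmorphism _ -> _}) (h' := e' \o f : {rmorphism _ -> _})) => [c|i] /=.
  by rewrite eC fC e'C.
by rewrite eX fX e'X.
Qed.

Section Functional.
Variable lam : {additive K -> k}.
Hypothesis lamZ : forall a x, lam (iota a * x) = a * lam x.

Let Lam := @mpoly.map_mpoly (nvars n) K k lam.

Lemma map_functionalM (f : sc_poly K n) (g : sc_poly k n) : Lam (f * emb g) = Lam f * g.
Proof.
apply/mpoly.mpolyP => m; rewrite mpoly.mcoeff_map_mpoly !mpoly.mcoeffM raddf_sum.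
apply: eq_bigr => c _; rewrite !mpoly.mcoeff_map_mpoly /=.
by rewrite mulrC lamZ mulrC.
Qed.

(** At a point with coordinates in [k] the monomials take values in [k], so [lam], being linear over
    [k], can be applied before or after evaluation. *)
Lemma map_functional_eval (v : 'I_(nvars n) -> k) (f : sc_poly K n) :
  mpoly.mmap idfun v (Lam f) = lam (mpoly.mmap idfun (iota \o v) f).
Proof.
(* A common degree bound lets both evaluations be expanded over the same monomials. *)
pose b := maxn (mpoly.msize f) (mpoly.msize (Lam f)).
rewrite (@mpoly.mmapE _ _ _ v idfun (Lam f) b) ?leq_maxr //.
rewrite (@mpoly.mmapE _ _ _ (iota \o v) idfun f b) ?leq_maxl //.
rewrite raddf_sum; apply: eq_bigr => m _ /=.
rewrite mpoly.mcoeff_map_mpoly /= mulrC [in RHS]mulrC -lamZ; congr (lam (_ * _)).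
rewrite /mpoly.mmap1 rmorph_prod; apply: eq_bigr => i _.
by rewrite rmorphXn.
Qed.

End Functional.

Lemma disc_criterion_ascent : disc_criterion d -> disc_criterion (iota \o d).
Proof.
move=> [P [Prel Pdisc Pev]]; have [f [fE fC fgen]] := map_mpoly_hom.
have [e' [e'E e'C e'X]] := mpoly_lift (idfun : {rmorphism K -> K})
  ((iota \o d) \o enum_val : 'I_(nvars n) -> K).
pose I := ideal_gen [set b | alg_rel (@generic_data K n) b].
(* A prime missing [S] contains neither the discriminant ([u = 1], [N = 1]) nor a function nonzero
   at the point ([N = 0]). *)
pose S := [set w | exists u N, e' u != 0 /\ w = u * disc (@generic_data K n) ^+ N].
have [||||P' [IP' P'S]] := @exists_prime_avoiding _ I S.
- exact: ideal_gen_ideal.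
- by exists 1, 0%N; rewrite rmorph1 oner_eq0 mulr1.
- move=> _ _ [u [N [u0 ->]]] [v [M [v0 ->]]]; exists (u * v), (N + M)%N.
  by rewrite rmorphM mulf_neq0 // exprD; split=> //; ring.
- move=> w [r [g [grel [c wE]]]] [u [N [u0 wS]]].
  (* With value 1 at [e' u], the functional makes [L u] take the value 1 at the point, so [L u] is
     outside [P]; the relation would place [L u * disc ^ N] in [P]. *)
  have [lam [lamZ lam1]] := exists_functional iota u0.
  pose L := mpoly.map_mpoly lam : sc_poly K n -> sc_poly k n.
  have LM := map_functionalM lamZ.
  have PL : P (L w).
    have /choice[a aP] : forall i, exists a, alg_rel (@generic_data k n) a /\ g i = emb a.
      move=> i; have := grel i; rewrite /= -fgen => /alg_rel_map[a ra ga].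
      by exists a; split=> //; rewrite ga fE.
    have LD (x y : sc_poly K n) : L (x + y) = L x + L y by exact: raddfD.
    rewrite wE; elim/big_ind: _ => [|x y Px Py|i _].
    + have -> : L 0 = 0 by apply: (@addrI _ (L 0)); rewrite -LD !addr0.
      exact: ideal0 (prime_is_ideal P).
    + by rewrite LD; exact: idealD (prime_is_ideal P) _ _ Px Py.
    have [ra ->] := aP i; rewrite [L _]LM.
    by apply: idealMl; [exact: prime_is_ideal | exact: Prel].
  have : P (L u * disc (@generic_data k n) ^+ N).
    rewrite -[_ * _]LM -fE rmorphXn -(disc_map f) fgen -wS.
    exact: PL.
  move=> /prime_mul[/Pev|]; last exact: prime_notX.
  rewrite [LHS](map_functional_eval lamZ) -[X in lam X]e'E lam1 => /eqP.
  by rewrite oner_eq0.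
exists P'; split.
- by move=> a ra; apply: IP'; exact: ideal_gen_mem.
- move=> h; apply: (P'S _ h); exists 1, 1%N.
  by rewrite rmorph1 oner_neq0 mul1r.
move=> p P'p; rewrite -e'E; apply: contrapT => /eqP h; apply: (P'S _ P'p).
by exists p, 0%N; rewrite mulr1.
Qed.

End CriterionBaseChange.

(* A generating family of minimal size is a basis. *)
Lemma finite_algebra_alg (k : fieldType) (B : comPzRingType) (psi : {rmorphism k -> B}) :
  module_finite_hom psi -> exists n (d : algdata n k) (h : {rmorphism alg d -> B})
    (h' : {rmorphism B -> alg d}),
  [/\ cancel h h', cancel h' h & forall c, h (alg_C d c) = psi c].
Proof.
pose gen n (e : 'I_n -> B) := forall x, exists c : 'I_n -> k, x = \sum_i psi (c i) * e i.
move=> [n0 [e0 gen0]].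
have ex : exists n, `[< exists e : 'I_n -> B, gen n e >].
  by exists n0; apply/asboolP; exists e0 => x; exact: gen0.
case: (ex_minnP ex) => n /asboolP[e ge] min.
have free (c : 'I_n -> k) : \sum_i psi (c i) * e i = 0 -> forall i, c i = 0.
  move=> ce0 i; apply: contrapT => /eqP ci.
  case: n => [|n] in e ge min c ce0 i ci *; first by case: i ci.
  have ei : e i = \sum_j psi (- (c i)^-1 * c (lift i j)) * e (lift i j).
    rewrite (bigD1_ord i) //= in ce0.
    have -> : e i = psi (c i)^-1 * (psi (c i) * e i).
      by rewrite mulrA -rmorphM mulVf // rmorph1 mul1r.
    move/eqP: ce0; rewrite addr_eq0 => /eqP ->.
    rewrite mulrN mulr_sumr -sumrN; apply: eq_bigr => j _.
    by rewrite rmorphM rmorphN !mulNr mulrA.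
  have : (n.+1 <= n)%N; last by rewrite ltnn.
  apply: min; apply/asboolP; exists (fun j => e (lift i j)) => x.
  have [a ->] := ge x; exists (fun j => a i * (- (c i)^-1 * c (lift i j)) + a (lift i j)).
  rewrite (bigD1_ord i) //= {1}ei mulr_sumr -big_split; apply: eq_bigr => j _.
  by rewrite rmorphD mulrDl [psi (a i * _)]rmorphM mulrA.
pose comb (c : 'I_n -> k) := \sum_i psi (c i) * e i.
have comb_inj a c : comb a = comb c -> forall i, a i = c i.
  move=> ac i; apply/eqP; rewrite -subr_eq0; apply/eqP/(free (fun i => a i - c i)).
  under eq_bigr => j _ do rewrite rmorphB mulrBl.
  by rewrite sumrB -/(comb a) ac subrr.
have /choice[co coE] : forall x, exists c, comb c = x.
  by move=> x; have [c ->] := ge x; exists c.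
pose d0 (i : sidx n) := match i with inl (i, j, l) => co (e i * e j) l | inr i => co 1 i end.
have combM (v : 'I_n -> k) y : comb (fun l => \sum_i v i * co (e i * y) l) = comb v * y.
  rewrite /comb mulr_suml; under eq_bigr => l _ do rewrite rmorph_sum mulr_suml.
  rewrite exchange_big; apply: eq_bigr => i _ /=.
  under eq_bigr => l _ do rewrite rmorphM -mulrA.
  by rewrite -mulr_sumr -/(comb (co (e i * y))) coE mulrA.
have d0P a : alg_rel d0 a -> a = 0.
  rewrite /alg_rel /sc /su /=; case=> [[i [j [h [l ->]]]]|[i [j [l ->]]]|[j [l ->]]].
  - apply/eqP; rewrite subr_eq0; apply/eqP.
    apply: (comb_inj (fun l => \sum_m co (e i * e j) m * co (e m * e h) l)
      (fun l => \sum_m co (e j * e h) m * co (e i * e m) l)).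
    rewrite combM coE; under [RHS]eq_bigr => l' _ do under eq_bigr => m' _ do rewrite [e i * _]mulrC.
    by rewrite [RHS]combM coE mulrAC -mulrA mulrC; ring.
  - by rewrite mulrC subrr.
  - apply/eqP; rewrite subr_eq0; apply/eqP.
    apply: (comb_inj (fun l => \sum_i co 1 i * co (e i * e j) l) (fun l => (j == l)%:R)).
    rewrite combM coE mul1r /comb (bigD1 j) //= eqxx rmorph1 mul1r big1 ?addr0 // => i ij.
    by rewrite eq_sym (negbTE ij) rmorph0 mul0r.
pose d := AlgData d0P.
have [||h [hE hC he]] := @alg_lift n k d B psi e.
- by move=> i j; rewrite -[LHS]coE.
- exact: coE.
have hbij : bijective h.
  apply: bijective_inj_surj.
    by move=> x y; rewrite !hE => /comb_inj xy; apply/rowP => i; exact: xy.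
  move=> y; exists (\row_i co y i); rewrite hE -[RHS]coE.
  by apply: eq_bigr => i _; rewrite mxE.
have [h' [hh' h'h]] := rmorphism_inv hbij.
by exists n, d, h, h'.
Qed.

(** [Spec k] has a single point, so one chart of the finite morphism covers everything; its base
    ring is identified with [k] by full faithfulness of [Spec]. *)
Lemma finite_scheme_alg (k : fieldType) (R : scheme) (rho : morphism R (Spec k)) :
  finite_morphism rho -> exists n (d : algdata n k) (r : morphism (Spec (alg d)) R) s,
  iso_pair r s /\ rho \om r = Spec_map (alg_C d).
Proof.
move=> fin; have [o _] := point_field_ex k.
have [A [B [phi [j [i [[hj jo hi] irange e fphi]]]]]] := fin o.
have jsurj (y : Spec k) : range j y by rewrite (point_field_eq y o).
have isurj y : range i y by rewrite irange; exact: jsurj.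
have [j' jj'] := open_immersion_surj_iso hj jsurj.
have [i' ii'] := open_immersion_surj_iso hi isurj.
have [th thE] := spec_full j; have [th' th'E] := spec_full j'.
have thth' a : th (th' a) = a.
  apply: (spec_faithful (f := th \o th' : {rmorphism _ -> _}) (g := idfun : {rmorphism A -> A})).
  rewrite Spec_map_comp -thE -th'E [RHS]Spec_map_id //.
  exact: jj'.2.
have [m [g gen]] := fphi.
have [|n [d [h [h' [hh' h'h hC]]]]] := @finite_algebra_alg k B (phi \o th : {rmorphism k -> B}).
  exists m, g => x; have [c ->] := gen x; exists (th' \o c).
  by apply: eq_bigr => l _; rewrite /GRing.scale /= /restr_scale /= thth'.
exists n, d, (i \om Spec_map h'), (Spec_map h \om i'); split.
  apply: (iso_pair_comp (iso_pair_Spec h'h hh') (r' := i) (s' := i')).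
  exact: ii'.
rewrite comp_morphismA e thE -!Spec_map_comp; apply: Spec_map_eq => c /=.
by have := hC c; rewrite /= => <-.
Qed.

Theorem proposition1p2 (k : fieldType) (kbar : closedFieldType)
    (iota : {rmorphism k -> kbar}) (hkbar : forall x, algebraicOver iota x)
    (R : scheme) (rho : morphism R (Spec k)) (hR : is_finite_scheme_over rho)
    (R' : scheme) (pr : morphism R' R) (rho' : morphism R' (Spec kbar))
    (hR' : is_fibre_product rho (Spec_map iota : morphism (Spec kbar) (Spec k))
             pr rho') :
  is_finite_scheme_over rho' /\ (smoothable rho <-> smoothable rho').
Proof.
have [n [d [r [s [rs er]]]]] := finite_scheme_alg hR.2.
have rhoE : rho = Spec_map (alg_C d) \om s.
  by rewrite -er -comp_morphismA rs.1 comp_morphism1.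
(* Uniqueness of fibre products identifies [R'] with the spectrum of the algebra that has the same
   structure constants over [kbar], so the criterion on both sides concerns the same [d]. *)
have := fibre_product_left_iso (base_change_alg iota d) (X' := R) rs.1 rs.2.
rewrite -rhoE => /(fibre_product_unique hR')[r' [s' [rs' sr' _ er']]].
have iso' : iso_pair r' s' by split.
split; first exact: (finite_scheme_of_alg iso' er').
split=> sm.
  apply: (smoothable_of_criterion iso' er').
  exact: (disc_criterion_ascent iota (criterion_of_smoothable rs er sm)).
apply: (smoothable_of_criterion rs er).
exact: (disc_criterion_descent (criterion_of_smoothable iso' er' sm)).
Qed.
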